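(* Let $1\le p\le\infty$, $0<\alpha\le r$, and $k>0$. There is a constant $C$ such that for every $f\in H_{w,p}^{r,\alpha}$ and every $n\in\mathbb N$ $$\widetilde\psi_{k,r,\alpha}\Big(f,\frac1n\Big)_{w,p}\le\frac{C}{n^k}\sum_{\nu=1}^n\nu^{k-1}E_\nu(f)_{H_{w,p}^{r,\alpha}}$$ ($C$ is independent of $f$ and $n$).
   Context: Fix real $a\ge b\ge -1/2$ and let $w(x)=(1-x)^a(1+x)^b$ on $[-1,1]$. For $1\le p<\infty$, $L_{w,p}$ is the space of measurable $f$ on $[-1,1]$ with $\|f\|_{w,p}=(\int_{-1}^1|f(x)|^pw(x)\,dx)^{1/p}<\infty$; for $p=\infty$, $L_{w,\infty}$ means $C[-1,1]$ with the maximum norm. Let $P_k^{(a,b)}$ $(k=0,1,\dots)$ be the Jacobi polynomials orthogonal on $[-1,1]$ with respect to $w$, normalized by $P_k^{(a,b)}(1)=\binom{k+a}{k}$, and put $R_k=P_k^{(a,b)}/P_k^{(a,b)}(1)$, $\mu_k=\|R_k\|_{w,2}^{-2}$, $c_k(f)=\int_{-1}^1 f(x)R_k(x)w(x)\,dx$, so that $f\sim\sum_{k\ge0}c_k(f)\mu_kR_k$ (Fourier-Jacobi series). For $0<h<\pi$ the generalized Jacobi translation $T_h=T_h^{(a,b)}$ is the operator on $L_{w,p}$ given by $T_hf\sim\sum_k c_k(f)\mu_kR_k(\cos h)R_k$; it satisfies $\|T_hf\|_{w,p}\le\|f\|_{w,p}$. For real $r>0$ let $\widetilde\Delta_t^r=(I-T_t)^{r/2}=\sum_{k=0}^\infty(-1)^k\binom{r/2}{k}T_t^k$,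 $0<t<\pi$, and $\widetilde\omega_r(f,h)_{w,p}=\sup_{0<t\le h}\|\widetilde\Delta_t^rf\|_{w,p}$ for $0<h<\pi$, $\widetilde\omega_r(f,h)_{w,p}=\sup_{0<t<\pi}\|\widetilde\Delta_t^rf\|_{w,p}$ for $h\ge\pi$. The Hölder space $H_{w,p}^{r,\alpha}$ consists of $f\in L_{w,p}$ with $\|f\|_{H_{w,p}^{r,\alpha}}=\|f\|_{w,p}+\sup_{h>0}h^{-\alpha}\widetilde\omega_r(f,h)_{w,p}<\infty$. Let $\mathcal P_n$ be the set of algebraic polynomials of degree at most $n$ and $E_n(f)_{H_{w,p}^{r,\alpha}}=\inf_{P\in\mathcal P_{n-1}}\|f-P\|_{H_{w,p}^{r,\alpha}}$, $n\in\mathbb N$. For real $0<\alpha\le r$, $k>0$ and $0<\delta<\pi$, $\widetilde\psi_{k,r,\alpha}(f,\delta)_{w,p}=\sup_{0<h\le\delta}h^{-\alpha}\,\widetilde\omega_k(\widetilde\Delta_h^rf,\delta)_{w,p}$. *)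

(* Defs.v *)
From HB Require Import structures.
From mathcomp Require Import all_boot all_order all_algebra.
From mathcomp Require Import all_classical all_reals all_analysis.

Set Implicit Arguments.
Unset Strict Implicit.
Unset Printing Implicit Defensive.

Import Order.TTheory GRing.Theory Num.Theory.
Import numFieldNormedType.Exports.

Local Open Scope classical_set_scope.
Local Open Scope ring_scope.

Section JacobiSmoothness.
Variable R : realType.

Definition gbinom (x : R) (k : nat) : R :=
  (\prod_(i < k) (x - i%:R)) / k`!%:R.

Section Weight.
Variables a b : R.

(* powR sends 0 to 0 for a negative exponent, so the values at the endpoints
   may differ from the usual convention; this only concerns a null set. *)
Definition jacobi_weight (x : R) : R := (1 - x) `^ a * (1 + x) `^ b.

Local Notation w := jacobi_weight.
Local Notation mu := (@lebesgue_measure R).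
Local Notation I := (`[(-1 : R)%R, (1 : R)%R]%classic).

(* For p = +oo this is the maximum norm on [-1, 1]; the value at p = -oo is
   never used.  Elements of L_{w,p} are represented by functions R -> R, of
   which only the restriction to [-1, 1] matters. *)
Definition wnorm (p : \bar R) (f : R -> R) : \bar R :=
  match p with
  | q%:E => ((\int[mu]_(x in I) (`|f x| `^ q * w x)%R%:E) `^ q^-1)%E
  | +oo%E => ereal_sup [set `|f x|%:E | x in I]
  | -oo%E => 0%E
  end.

Definition Lw (p : \bar R) : set (R -> R) :=
  match p with
  | q%:E => [set f | measurable_fun I f /\ (wnorm q%:E f < +oo)%E]
  | +oo%E => [set f | {within I, continuous f}]
  | -oo%E => set0
  end.

Definition is_jacobi_poly (k : nat) (P : {poly R}) : Prop :=
  [/\ size P = k.+1,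
      forall Q : {poly R}, (size Q <= k)%N ->
        \int[mu]_(x in I) (P.[x] * Q.[x] * w x) = 0
    & P.[1] = gbinom (k%:R + a) k].

Definition jacobi_poly (k : nat) : {poly R} := xget 0 (is_jacobi_poly k).

Definition jacobiR (k : nat) (x : R) : R :=
  (jacobi_poly k).[x] / (jacobi_poly k).[1].

Definition jacobi_mu (k : nat) : R := fine (wnorm 2%:E (jacobiR k)) ^- 2.

Definition jacobi_coef (k : nat) (f : R -> R) : R :=
  \int[mu]_(x in I) (f x * jacobiR k x * w x).

(* g ~ \sum_k d_k R_k as a Fourier-Jacobi series. *)
Definition has_jacobi_series (g : R -> R) (d : nat -> R) : Prop :=
  forall k, jacobi_coef k g * jacobi_mu k = d k.

(* The operators below send a function to a representative of the element of
   L_{w,p} that the defining property determines; the default value is used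
   only where no such element exists. *)
Definition jacobi_translation (p : \bar R) (h : R) (f : R -> R) : R -> R :=
  xget (fun=> 0) [set g | Lw p g /\
    has_jacobi_series g
      (fun k => jacobi_coef k f * jacobi_mu k * jacobiR k (cos h))].

Definition frac_diff_psum (p : \bar R) (r t : R) (f : R -> R) (N : nat) (x : R)
    : R :=
  \sum_(k < N)
    (-1) ^+ k * gbinom (r / 2) k * iter k (jacobi_translation p t) f x.

(* The binomial series of (I - T_t)^(r/2), summed in the norm of L_{w,p}. *)
Definition frac_diff (p : \bar R) (r t : R) (f : R -> R) : R -> R :=
  xget (fun=> 0) [set g | Lw p g /\
    wnorm p (fun x => g x - frac_diff_psum p r t f N x) @[N --> \oo] --> 0%E].

Definition modulus (p : \bar R) (r : R) (f : R -> R) (h : R) : \bar R :=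
  if h < pi
  then ereal_sup [set wnorm p (frac_diff p r t f) | t in [set t | 0 < t <= h]]
  else ereal_sup [set wnorm p (frac_diff p r t f) | t in [set t | 0 < t < pi]].

Definition holder_norm (p : \bar R) (r alpha : R) (f : R -> R) : \bar R :=
  (wnorm p f + ereal_sup
    [set (h `^ (- alpha))%:E * modulus p r f h | h in [set h : R | (0 < h)%R]])%E.

Definition holder_space (p : \bar R) (r alpha : R) : set (R -> R) :=
  [set f | Lw p f /\ (holder_norm p r alpha f < +oo)%E].

Definition polys_deg_le (n : nat) : set {poly R} :=
  [set P | (size P <= n.+1)%N].

Definition best_approx (p : \bar R) (r alpha : R) (n : nat) (f : R -> R)
    : \bar R :=
  ereal_inf [set holder_norm p r alpha (fun x => f x - P.[x])
            | P in polys_deg_le n.-1].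

Definition psi_modulus (p : \bar R) (k r alpha : R) (f : R -> R) (delta : R)
    : \bar R :=
  ereal_sup [set ((h `^ (- alpha))%:E * modulus p k (frac_diff p r h f) delta)%E
            | h in [set h | 0 < h <= delta]].

End Weight.
End JacobiSmoothness.

(* Main.v *)
From HB Require Import structures.
Require Import Defs.
From mathcomp Require Import all_boot all_order all_algebra.
From mathcomp Require Import all_classical all_reals all_analysis.
From mathcomp Require Import measurable_realfun.
From mathcomp Require Import ring lra zify.

(** Differences and translations commute, and [h^(-alpha) ||Delta_h^r g||] is at most the
Hoelder norm of [g].  Take polynomials [P_j] of degree less than [2^j] that are nearly
best approximants of [f] in the Hoelder norm, let [2^m <= n < 2^(m+1)], and write
[f = (f - P_m) + sum_(j < m) (P_(j+1) - P_j) + P_0].  Apply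
[h^(-alpha) Delta_t^k Delta_h^r] with [h, t <= 1/n].  The first term costs [E_(2^m)],
since [Delta_t^k] is bounded uniformly in [t].  A Bernstein inequality
[||Delta_t^k Q|| <= C (N t)^k ||Q||] for [deg Q <= N], [N t <= 1], bounds the [j]-th
term of the sum by [(2^j / n)^k E_(2^j)] up to a constant, and kills the constant
[P_0].  As [E_nu] decreases, the dyadic sum is at most a multiple of
[n^(-k) sum_nu nu^(k-1) E_nu] ([inverse_estimate], [dyadic_sum]).

Everything rests on the translation.  Put [e = (1 + x)/2].  On polynomials, [T_y] sends
[e^n] to an explicit combination [F_n(x, y)] of Bernstein monomials, symmetric in [x] and
[y].  The Jacobi operator [L] is tridiagonal on these monomials, so [L_x F_n = L_y F_n];
hence [T_y] multiplies the [k]-th coefficient by [R_k(y)] ([jmoment_poly_tr]).  It is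
positive ([poly_tr_ge0]): [F_n(x, y)] is the average of [(A + u B + 2 sqrt(A u B) c)^n]
over Beta distributed [u] and [c^2], where [A = X Y], [B = (1 - X)(1 - Y)], and this point
lies in [0, 1].  This is where [a >= b >= -1/2] is used.  A positive operator that fixes
constants and preserves the integral is a contraction of every [L_{w,p}], by Jensen's
inequality ([poly_tr_contract]).

Coefficient multipliers that are bounded on polynomials extend to [L_{w,p}] with the same
bound ([multiplier_ext]), because polynomials are dense ([poly_dense]) and the space is
complete ([Lw_complete]); Jacobi coefficients determine a function up to a null function
([Lw_unique]).  So the translation and the fractional difference, which are specified only
up to null functions, are handled through their multipliers, and their binomial series
converge because [sum_j |binom(r/2, j)|] is finite.

For the Bernstein inequality ([translation_bernstein], [frac_power_bound]): for fixed [x]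
the function [y |-> (T_y Q)(x)] is a polynomial of degree at most [N], and
[(I - T_(cos t)) Q] is its value at [1] minus its value at [cos t].  Interpolation at the
extrema of the [N]-th Chebyshev polynomial writes this difference with coefficients of
alternating sign, so their absolute sum is attained on the Chebyshev polynomial and equals
[1 - cos(N t) <= (N t)^2 / 2].  A contraction with [||(I - T) Q|| <= e ||Q||] satisfies
[||(I - T)^s Q|| <= C_s e^s ||Q||]: for [0 < s < 1] the coefficients of the binomial
series are negative after the first and of total sum [0], so the series regroups into
terms [I - T^j], each of norm at most [min(2, j e)]; an integer increment of [s] costs one
more factor [e]. *)

Set Implicit Arguments.
Unset Strict Implicit.
Unset Printing Implicit Defensive.

Import Order.TTheory GRing.Theory Num.Theory.
Import numFieldNormedType.Exports.
Local Open Scope classical_set_scope.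
Local Open Scope ring_scope.

(** * Pochhammer symbols and an average over the Gegenbauer measure *)

Section Pochhammer.
Context {R : realType}.
Implicit Types (x be : R) (n : nat).

Definition poch x n : R := \prod_(i < n) (x + i%:R).

Lemma poch0 x : poch x 0 = 1. Proof. by rewrite /poch big_ord0. Qed.

Lemma pochS x n : poch x n.+1 = poch x n * (x + n%:R).
Proof. by rewrite /poch big_ord_recr. Qed.

Lemma pochSl x n : poch x n.+1 = x * poch (x + 1) n.
Proof.
rewrite /poch big_ord_recl addr0; congr (_ * _); apply: eq_bigr => i _.
by rewrite lift0 -addrA nat1r.
Qed.

Lemma pochD x m n : poch x (m + n) = poch x m * poch (x + m%:R) n.
Proof.
rewrite /poch big_split_ord; congr (_ * _).
by apply: eq_bigr => i _; rewrite natrD addrA.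
Qed.

Lemma poch_gt0 x n : 0 < x -> 0 < poch x n.
Proof. by move=> x0; apply: prodr_gt0 => i _; rewrite ltr_wpDr. Qed.

Lemma poch_neq0 x n : 0 < x -> poch x n != 0.
Proof. by move=> /(poch_gt0 n) /gt_eqF ->. Qed.

(** The Chu-Vandermonde sum, with the falling factorial of [s] in place of
[(-1)^l (-s)_l]. *)
Lemma chu_vandermonde be j s : 0 < be ->
  \sum_(l < j.+1) ('C(j, l) * s ^_ l)%:R / poch be l
  = poch (be + s%:R) j / poch be j.
Proof.
elim: j be s => [|j IH] be s be0.
  by rewrite big_ord_recr big_ord0 /= !poch0 bin0 ffactn0 add0r.
rewrite big_ord_recl /= bin0 ffactn0 poch0.
under eq_bigr => l _ do rewrite binS mulnDl natrD mulrDl.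
rewrite big_split /= addrA.
have -> : (1 * 1)%:R / 1 + \sum_(i < j.+1) ('C(j, i.+1) * s ^_ i.+1)%:R / poch be i.+1
   = poch (be + s%:R) j / poch be j.
  rewrite -IH // [RHS]big_ord_recl /= bin0 ffactn0 poch0; congr (_ + _).
  by rewrite big_ord_recr /= bin_small // mul0n mul0r addr0.
have -> : \sum_(i < j.+1) ('C(j, i) * s ^_ i.+1)%:R / poch be i.+1
   = s%:R / be * (poch (be + s%:R) j / poch (be + 1) j).
  case: s => [|s].
    rewrite !mul0r big1 // => i _; by rewrite ffactnS mul0n muln0 mul0r.
  have -> : be + s.+1%:R = (be + 1) + s%:R by rewrite -natr1; ring.
  rewrite -IH ?ltr_wpDr // mulr_sumr; apply: eq_bigr => i _.
  rewrite ffactnS /= pochSl !natrM.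
  have := poch_neq0 i (ltr_wpDr ler01 be0).
  move: (poch (be + 1) i) => z z0; field.
  by rewrite z0 gt_eqF.
have h1 := poch_neq0 j be0.
have h2 : poch (be + 1) j = poch be j * (be + j%:R) / be.
  apply: (@mulfI _ be); first by rewrite gt_eqF.
  by rewrite -pochSl pochS mulrCA divff ?mulr1 // gt_eqF.
have h3 : be + j%:R != 0 by rewrite gt_eqF // ltr_wpDr.
rewrite h2 !pochS; field.
by rewrite h3 h1 gt_eqF.
Qed.

(** This clears the numerator of the moments [(1/2)_l / (be)_l] of [c^2]. *)
Lemma poch_half l : 4 ^+ l * poch (1 / 2) l * l`!%:R = ((2 * l)`!)%:R.
Proof.
elim: l => [|l IH]; first by rewrite poch0 !mulr1.
have -> : (2 * l.+1 = (2 * l).+2)%N by lia.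
rewrite !factS !natrM -IH pochS exprS.
rewrite -!natr1 natrM; field.
by [].
Qed.

(** Both sides are [n! / ((s-l)! (n-s-l)!)]; this matches the term [l] of the even part of
[(A + B + 2 sqrt(A B) c)^n] with a Chu-Vandermonde term. *)
Lemma trinomial_bin n s l : (l <= s)%N -> (s <= n)%N ->
  ('C(n, 2 * l) * 'C(n - 2 * l, s - l) * (2 * l)`!
   = 'C(n, s) * ('C(s, l) * (n - s) ^_ l) * l`!)%N.
Proof.
move=> ls sn; case: (leqP (l + s) n) => lsn; last first.
  rewrite (@ffact_small (n - s)); last by lia.
  case: (leqP (2 * l) n) => h; last by rewrite (bin_small h) !(mul0n, muln0).
  rewrite [X in (_ * X * _)%N]bin_small; first by rewrite !(muln0, mul0n).
  by lia.
apply/eqP; rewrite -(eqn_pmul2r (fact_gt0 (s - l))) -(eqn_pmul2r (fact_gt0 (n - s - l))).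
apply/eqP; transitivity n`!.
  rewrite -(bin_fact (_ : 2 * l <= n)%N); last by lia.
  rewrite -(bin_fact (_ : s - l <= n - 2 * l)%N); last by lia.
  have -> : (n - 2 * l - (s - l) = n - s - l)%N by lia.
  by ring.
rewrite -(bin_fact sn) -(bin_fact ls) -(ffact_fact (_ : l <= n - s)%N); last by lia.
by ring.
Qed.

(** The left side is the average of [(A + B + 2 sqrt(A B) c)^n] over the symmetric
distribution of [c] with [E c^(2l) = (1/2)_l / (be)_l]: odd powers of [c] drop out.  The
right side shows that this average is a combination of Bernstein monomials. *)
Lemma gegenbauer_average be (A B : R) n : 0 < be ->
  \sum_(l < n.+1) 'C(n, 2 * l)%:R * (A + B) ^+ (n - 2 * l) * (4 * (A * B)) ^+ l
      * (poch (1 / 2) l / poch be l)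
  = \sum_(j < n.+1) ('C(n, j)%:R * (poch be n / (poch be j * poch be (n - j))))
      * (A ^+ j * B ^+ (n - j)).
Proof.
move=> be0.
transitivity (\sum_(l < n.+1) \sum_(s < n.+1)
   ('C(n, s)%:R * (('C(s, l) * (n - s) ^_ l)%:R / poch be l)) * (A ^+ s * B ^+ (n - s))).
  apply: eq_bigr => l _.
  case: (leqP (2 * l) n) => h; last first.
    rewrite bin_small // !mul0r big1 // => s _.
    case: (leqP l s) => ls.
      rewrite (@ffact_small (n - s)) ?muln0 ?mul0r ?mulr0 ?mul0r //; by lia.
    by rewrite (@bin_small s) // mul0n mul0r mulr0 mul0r.
  rewrite addrC exprDn.
  transitivity (\sum_(l <= s < n.+1) 'C(n, s)%:R * (('C(s, l) * (n - s) ^_ l)%:R / poch be l)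
      * (A ^+ s * B ^+ (n - s))); last first.
    rewrite -[RHS](big_mkord xpredT (fun s => 'C(n, s)%:R * (('C(s, l) * (n - s) ^_ l)%:R / poch be l)
      * (A ^+ s * B ^+ (n - s)))).
    rewrite [RHS](big_cat_nat _ (n := l)) //=; last by lia.
    rewrite [X in _ = X + _]big_nat_cond [X in _ = X + _]big1 ?add0r // => s /andP[/andP[_ sl] _].
    by rewrite (@bin_small s) // mul0n mul0r mulr0 mul0r.
  rewrite (big_cat_nat _ (n := (n - l).+1)) //=; [|lia|lia].
  rewrite [X in _ = _ + X]big_nat_cond [X in _ = _ + X]big1 ?addr0; last first.
    move=> s /andP[/andP[h1 h2] _].
    rewrite (@ffact_small (n - s)) ?muln0 ?mul0r ?mulr0 ?mul0r //; by lia.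
  have := @big_addn R 0 +%R 0%N (n - l).+1 l xpredT (fun s => 'C(n, s)%:R *
      (('C(s, l) * (n - s) ^_ l)%:R / poch be l) * (A ^+ s * B ^+ (n - s))).
  rewrite add0n => ->.
  have -> : ((n - l).+1 - l = (n - 2 * l).+1)%N by lia.
  rewrite mulr_sumr !mulr_suml [RHS]big_mkord.
  apply: eq_bigr => i _.
  have hi := ltn_ord i.
  have := @trinomial_bin n (i + l) l (leq_addl i l) ltac:(lia) => E.
  have {}E : ('C(n, 2 * l) * 'C(n - 2 * l, i))%:R * (2 * l)`!%:R =
     ('C(n, i + l) * ('C(i + l, l) * (n - (i + l)) ^_ l) * l`!)%:R :> R.
    by rewrite -natrM -E addnK.
  rewrite -poch_half natrM in E.
  have {}E : ('C(n, 2 * l))%:R * 'C(n - 2 * l, i)%:R * (4 ^+ l * poch (1 / 2) l) =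
     'C(n, i + l)%:R * ('C(i + l, l) * (n - (i + l)) ^_ l)%:R :> R.
    apply: (@mulIf _ l`!%:R); first by rewrite pnatr_eq0 -lt0n fact_gt0.
    by rewrite -!natrM in E *; rewrite natrM mulrA in E *.
  rewrite [in RHS]mulrA -E !exprMn -mulr_natr.
  rewrite [in RHS]exprD.
  have -> : (n - (i + l) = (n - 2 * l - i) + l)%N by lia.
  rewrite [in RHS]exprD; ring.
rewrite exchange_big /=; apply: eq_bigr => s _.
rewrite -mulr_suml -mulr_sumr; congr (_ * _ * _).
have sn : (s <= n)%N by rewrite -ltnS.
rewrite -[LHS](big_mkord xpredT (fun l => ('C(s, l) * (n - s) ^_ l)%:R / poch be l)).
rewrite (big_cat_nat _ (n := s.+1)) //= [X in _ + X]big_nat_cond [X in _ + X]big1 ?addr0; last first.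
  by move=> l /andP[/andP[h1 h2] _]; rewrite (@bin_small s) // mul0n mul0r.
rewrite big_mkord chu_vandermonde //.
have -> : poch (be + (n - s)%:R) s = poch be n / poch be (n - s).
  by rewrite -[in poch be n](subnK sn) pochD mulrAC divff ?mul1r // poch_neq0.
by rewrite -mulrA -invfM [poch be s * _]mulrC.
Qed.

End Pochhammer.

(** * The Jacobi operator on Bernstein monomials *)

(** A tridiagonal operator with off-diagonal entries [lo], [hi] is symmetric for the weights
[t] as soon as [t_(j+1) lo_(j+1) = t_j hi_j]; [B] and [phi] carry its two copies. *)
Lemma tridiag_exchange {R : comNzRingType} (V : lmodType R) n (B : nat -> V)
    (t lo q hi phi : nat -> R) :
  lo 0%N = 0 -> hi n = 0 ->
  (forall j, (j < n)%N -> t j.+1 * lo j.+1 = t j * hi j) ->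
  \sum_(j < n.+1) (t j * phi j) *: (lo j *: B j.-1 - q j *: B j + hi j *: B j.+1)
  = \sum_(j < n.+1) (t j * (lo j * phi j.-1 - q j * phi j + hi j * phi j.+1)) *: B j.
Proof.
move=> lo0 hin E.
transitivity (\sum_(j < n.+1) (t j * phi j * lo j) *: B j.-1
  - \sum_(j < n.+1) (t j * phi j * q j) *: B j
  + \sum_(j < n.+1) (t j * phi j * hi j) *: B j.+1).
  rewrite -sumrB -big_split; apply: eq_bigr => j _ /=.
  by rewrite scalerDr scalerBr !scalerA.
transitivity (\sum_(j < n.+1) (t j * hi j * phi j.+1) *: B j
  - \sum_(j < n.+1) (t j * phi j * q j) *: B j
  + \sum_(j < n.+1) (t j * lo j * phi j.-1) *: B j).
  congr (_ - _ + _).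
    rewrite big_ord_recl lo0 mulr0 scale0r add0r [RHS]big_ord_recr /= hin mulr0 mul0r scale0r addr0.
    apply: eq_bigr => j _; congr (_ *: _).
    by rewrite mulrAC E // mulrAC.
  rewrite [RHS]big_ord_recl lo0 mulr0 mul0r scale0r add0r big_ord_recr /= hin mulr0 scale0r addr0.
  apply: eq_bigr => j _; congr (_ *: _).
  by rewrite E // mulrAC.
rewrite -sumrB -big_split; apply: eq_bigr => j _ /=.
rewrite -scalerBl -scalerDl; congr (_ *: _); ring.
Qed.

Section JacobiOperator.
Context {R : realType}.
Variables a b : R.
Implicit Types (f g : {poly R}) (n j s : nat).

(** The Sturm-Liouville operator of the weight: [w L f = (w (1 - x^2) f')']. *)
Definition jacobi_op f : {poly R} :=
  (1 - 'X^2) * f^`()^`() + ((b - a)%:P - (a + b + 2)%:P * 'X) * f^`().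

Fact jacobi_op_is_linear : linear jacobi_op.
Proof.
by move=> c f g; rewrite /jacobi_op !derivD !derivZ -!mul_polyC; ring.
Qed.

HB.instance Definition _ :=
  GRing.isLinear.Build R {poly R} {poly R} _ jacobi_op jacobi_op_is_linear.

(** The coordinates [(1 + x)/2] and [(1 - x)/2], in which [L] maps each Bernstein monomial
to its two neighbours and itself. *)
Definition uhalf : {poly R} := (1 / 2)%:P * (1 + 'X).
Definition dhalf : {poly R} := (1 / 2)%:P * (1 - 'X).

Lemma half_polyC : (1 / 2)%:P = 1 - (1 / 2)%:P :> {poly R}.
Proof. by rewrite -polyC1 -polyCB; congr (_%:P); field. Qed.

Lemma uhalfD : uhalf + dhalf = 1.
Proof.
rewrite /uhalf /dhalf -mulrDr; have -> : 1 + 'X + (1 - 'X) = 2%:P :> {poly R}.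
  by rewrite polyC_natr; ring.
by rewrite -polyCM; congr (_%:P); field.
Qed.

Lemma dhalfE : dhalf = 1 - uhalf. Proof. by rewrite -uhalfD addrC addKr. Qed.

Lemma XE_uhalf : 'X = uhalf *+ 2 - 1 :> {poly R}.
Proof.
rewrite /uhalf mulr2n -mulrDl -polyCD (_ : 1 / 2 + 1 / 2 = 1 :> R); last by field.
by rewrite mul1r addrC addKr.
Qed.

Lemma horner_uhalf x : uhalf.[x] = (1 + x) / 2.
Proof. by rewrite /uhalf !hornerE; field. Qed.

Lemma horner_dhalf x : dhalf.[x] = (1 - x) / 2.
Proof. by rewrite /dhalf !hornerE; field. Qed.

Lemma deriv_uhalf : uhalf^`() = (1 / 2)%:P.
Proof. by rewrite /uhalf derivM derivC mul0r add0r derivD derivX -polyC1 derivC add0r mulr1. Qed.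

Lemma deriv_dhalf : dhalf^`() = - (1 / 2)%:P.
Proof. by rewrite dhalfE derivB deriv_uhalf -polyC1 derivC add0r. Qed.

Lemma deriv_uhalf_dhalf j s : (uhalf ^+ j * dhalf ^+ s)^`() =
  (1 / 2)%:P * (uhalf ^+ j.-1 * dhalf ^+ s *+ j - uhalf ^+ j * dhalf ^+ s.-1 *+ s).
Proof.
rewrite derivM !deriv_exp deriv_uhalf deriv_dhalf.
move: (uhalf ^+ j) (dhalf ^+ s) (uhalf ^+ j.-1) (dhalf ^+ s.-1) (1 / 2)%:P.
by move=> *; ring.
Qed.

Lemma jacobi_op_half f g1 g2 : f^`() = (1 / 2)%:P * g1 -> g1^`() = (1 / 2)%:P * g2 ->
  jacobi_op f = uhalf * dhalf * g2 + ((b + 1)%:P * dhalf - (a + 1)%:P * uhalf) * g1.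
Proof.
move=> e1 e2; rewrite /jacobi_op e1 derivM derivC mul0r add0r e2.
rewrite XE_uhalf dhalfE !(polyCD, polyCB) polyCN polyC1.
have := half_polyC; set h := (1 / 2)%:P => hh.
have {}hh : h * 2 = 1 by rewrite mulr_natr mulr2n {1}hh subrK.
rewrite (_ : 1 - (uhalf *+ 2 - 1) ^+ 2 = 2 * 2 * (uhalf * (1 - uhalf))); last by ring.
rewrite (_ : 2 * 2 * (uhalf * (1 - uhalf)) * (h * (h * g2)) = (h * 2) * (h * 2) * (uhalf * (1 - uhalf)) * g2); last by ring.
rewrite hh (_ : (b%:P - a%:P - (a%:P + b%:P + (1 + 1)) * (uhalf *+ 2 - 1)) * (h * g1)
  = (h * 2) * ((b%:P + 1) * (1 - uhalf) - (a%:P + 1) * uhalf) * g1); last by ring.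
by rewrite hh; ring.
Qed.

Lemma jacobi_op_uhalf_dhalf j s : jacobi_op (uhalf ^+ j * dhalf ^+ s) =
  (j%:R * (b + j%:R)) *: (uhalf ^+ j.-1 * dhalf ^+ s.+1)
  - (j%:R * (a + 1 + s%:R) + s%:R * (b + 1 + j%:R)) *: (uhalf ^+ j * dhalf ^+ s)
  + (s%:R * (a + s%:R)) *: (uhalf ^+ j.+1 * dhalf ^+ s.-1).
Proof.
rewrite (@jacobi_op_half _ (uhalf ^+ j.-1 * dhalf ^+ s *+ j - uhalf ^+ j * dhalf ^+ s.-1 *+ s)
  ((uhalf ^+ j.-1.-1 * dhalf ^+ s *+ j.-1 - uhalf ^+ j.-1 * dhalf ^+ s.-1 *+ s) *+ j
   - (uhalf ^+ j.-1 * dhalf ^+ s.-1 *+ j - uhalf ^+ j * dhalf ^+ s.-1.-1 *+ s.-1) *+ s)); last 2 first.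
- exact: deriv_uhalf_dhalf.
- by rewrite derivB !derivMn !deriv_uhalf_dhalf; ring.
rewrite -!mul_polyC !(polyCD, polyCM) !polyC_natr polyC1.
move: uhalf dhalf => u d.
by case: j s => [|[|j]] [|[|s]] /=; rewrite ?exprS; ring.
Qed.

Definition bernp n j : {poly R} := uhalf ^+ j * dhalf ^+ (n - j).

Definition tr_coef n j : R :=
  'C(n, j)%:R * (poch (b + 1) n / (poch (b + 1) j * poch (a + 1) (n - j))).

Hypothesis a1 : -1 < a.
Hypothesis b1 : -1 < b.

Let a10 : 0 < a + 1. Proof. by rewrite -ltrBlDr sub0r. Qed.
Let b10 : 0 < b + 1. Proof. by rewrite -ltrBlDr sub0r. Qed.

(** The symmetry condition of [tridiag_exchange] for the entries of [L]. *)
Lemma tr_coef_rec n j : (j < n)%N ->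
  tr_coef n j.+1 * (j.+1%:R * (b + j.+1%:R))
  = tr_coef n j * ((n - j)%:R * (a + (n - j)%:R)).
Proof.
move=> jn; rewrite /tr_coef subnS; case E : (n - j)%N => [|m]; first by lia.
rewrite /= !pochS.
have := poch_neq0 j b10; have := poch_neq0 m a10.
move: (poch _ n) (poch _ j) (poch _ m) => x y z z0 y0.
have h1 : b + 1 + j%:R != 0 by rewrite gt_eqF // ltr_wpDr.
have h2 : a + 1 + m%:R != 0 by rewrite gt_eqF // ltr_wpDr.
have h3 : 'C(n, j.+1)%:R * j.+1%:R = 'C(n, j)%:R * m.+1%:R :> R.
  by rewrite -!natrM mulnC mul_bin_left E mulnC.
have -> : b + j.+1%:R = b + 1 + j%:R by rewrite -natr1; ring.
have -> : a + m.+1%:R = a + 1 + m%:R by rewrite -natr1; ring.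
transitivity ('C(n, j.+1)%:R * j.+1%:R * (x / (y * z))).
  by field; rewrite h1 y0 z0.
rewrite h3; field; by rewrite h2 y0 z0.
Qed.

(** The translation by [y] of the [n]-th power of [(1 + x)/2], at this point only a formula. *)
Definition tr_pow n (y : R) : {poly R} :=
  \sum_(j < n.+1) (tr_coef n j * (bernp n j).[y]) *: bernp n j.

(** [L_x F_n = L_y F_n] for the kernel [F_n] of the translation, with the variable [y] already
paired with a functional [phi]. *)
Lemma jacobi_op_exchange n (phi : {poly R} -> R) : scalar phi ->
  jacobi_op (\sum_(j < n.+1) (tr_coef n j * phi (bernp n j)) *: bernp n j)
  = \sum_(j < n.+1) (tr_coef n j * phi (jacobi_op (bernp n j))) *: bernp n j.
Proof.
move=> phil.
have phiD f g : phi (f + g) = phi f + phi g by rewrite -[f]scale1r phil mul1r scale1r.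
have phi0 : phi 0 = 0 by apply: (addrI (phi 0)); rewrite -phiD !addr0.
have phiZ c f : phi (c *: f) = c * phi f by rewrite -[c *: f]addr0 phil phi0 addr0.
have phiB f g : phi (f - g) = phi f - phi g by rewrite phiD -scaleN1r phiZ mulN1r.
pose q j : R := j%:R * (a + 1 + (n - j)%:R) + (n - j)%:R * (b + 1 + j%:R).
pose lo j : R := j%:R * (b + j%:R).
pose hi j : R := (n - j)%:R * (a + (n - j)%:R).
have LE j : (j <= n)%N -> jacobi_op (bernp n j) =
  lo j *: bernp n j.-1 - q j *: bernp n j + hi j *: bernp n j.+1.
  move=> jn; rewrite jacobi_op_uhalf_dhalf /lo /q /hi; congr (_ + _).
    case: j jn => [|j] jn; first by rewrite !mul0r !scale0r.
    by rewrite {2}/bernp /= subnSK.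
  by rewrite /bernp subnS.
have hi_n : hi n = 0 by rewrite /hi subnn mul0r.
have lo_0 : lo 0 = 0 by rewrite /lo mul0r.
transitivity (\sum_(j < n.+1) (tr_coef n j * phi (bernp n j)) *:
   (lo j *: bernp n j.-1 - q j *: bernp n j + hi j *: bernp n j.+1)).
  rewrite linear_sum; apply: eq_bigr => j _.
  by rewrite linearZ /= LE // -ltnS.
rewrite (@tridiag_exchange _ _ n (bernp n) (tr_coef n) lo q hi (fun j => phi (bernp n j)) lo_0 hi_n (@tr_coef_rec n)).
apply: eq_bigr => j _; congr ((_ * _) *: _).
have jn : (j <= n)%N by rewrite -ltnS.
by rewrite (LE _ jn) phiD phiB (phiZ (lo j)) (phiZ (q j)) (phiZ (hi j)).
Qed.

End JacobiOperator.

(** * Integrability of the Jacobi weight *)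

Lemma horner_one {R : nzRingType} (x : R) : (1 : {poly R}).[x] = 1.
Proof. by rewrite -polyC1 hornerC. Qed.

(** Unlike [hornerE], this does not split numerals. *)
Definition horner_ringE {R : comNzRingType} := (@hornerD R, @hornerN R, @hornerM R, @hornerC R,
  @hornerX R, @hornerXn R, @hornerZ R, @horner_one R).

Section Weight.
Context {R : realType}.
Variables a b : R.
Hypothesis a1 : -1 < a.
Hypothesis b1 : -1 < b.
Local Notation mu := (@lebesgue_measure R).
Local Notation I := (`[(-1 : R)%R, (1 : R)%R]%classic).
Local Notation w := (jacobi_weight a b).
Implicit Types (f g : {poly R}).

Let a10 : 0 < a + 1. Proof. by rewrite -ltrBlDr sub0r. Qed.
Let b10 : 0 < b + 1. Proof. by rewrite -ltrBlDr sub0r. Qed.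

(** The polynomial factor of the derivative of [w (1 - x^2) f]; see [is_derive_pearson_prim]. *)
Definition pearson f : {poly R} :=
  (1 - 'X^2) * f^`() + ((b - a)%:P - (a + b + 2)%:P * 'X) * f.

Definition pearson_prim f (x : R) : R :=
  (1 - x) `^ (a + 1) * (1 + x) `^ (b + 1) * f.[x].

Lemma jacobi_weight_ge0 x : 0 <= w x.
Proof. by rewrite mulr_ge0 // powR_ge0. Qed.

Lemma jacobi_weight_gt0 x : -1 < x < 1 -> 0 < w x.
Proof. by move=> /andP[x1 x2]; rewrite mulr_gt0 // powR_gt0; lra. Qed.

Lemma measurable_jacobi_weight : measurable_fun [set: R] w.
Proof.
apply: measurable_funM.
  by apply: (measurableT_comp (measurable_powR a)); exact: measurable_funB.
by apply: (measurableT_comp (measurable_powR b)); exact: measurable_funD.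
Qed.

Lemma measurable_horner f (D : set R) : measurable_fun D (horner f).
Proof.
by apply: measurable_funTS; apply: continuous_measurable_fun; exact: continuous_horner.
Qed.

Lemma is_derive_pearson_prim f (x : R) : -1 < x < 1 ->
  is_derive x 1 (pearson_prim f) (w x * (pearson f).[x]).
Proof.
move=> /andP[x1 x2].
have p1 : 0 < 1 - x by lra.
have p2 : 0 < 1 + x by lra.
have d1 : is_derive x 1 (fun x : R => 1 - x) (-1).
  by have h := is_deriveB (is_derive_cst (1 : R) x 1) (is_derive_id x 1); rewrite sub0r in h.
have d2 : is_derive x 1 (fun x : R => 1 + x) 1.
  by have h := is_deriveD (is_derive_cst (1 : R) x 1) (is_derive_id x 1); rewrite add0r in h.
have e1 : is_derive x 1 (fun x : R => (1 - x) `^ (a + 1)) ((a + 1) * (1 - x) `^ a * -1).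
  have := is_derive1_powR (a + 1) p1; rewrite addrK => h.
  by have h' := @is_derive1_comp R (fun z : R => z `^ (a + 1)) (fun x : R => 1 - x) x _ _ h d1.
have e2 : is_derive x 1 (fun x : R => (1 + x) `^ (b + 1)) ((b + 1) * (1 + x) `^ b * 1).
  have := is_derive1_powR (b + 1) p2; rewrite addrK => h.
  by have h' := @is_derive1_comp R (fun z : R => z `^ (b + 1)) (fun x : R => 1 + x) x _ _ h d2.
apply: trigger_derive.
have q1 : (1 - x) `^ (a + 1) = (1 - x) * (1 - x) `^ a.
  by rewrite -[in RHS](addrK 1 a) mulr_powRB1 // ltW.
have q2 : (1 + x) `^ (b + 1) = (1 + x) * (1 + x) `^ b.
  by rewrite -[in RHS](addrK 1 b) mulr_powRB1 // ltW.
rewrite /= /GRing.scale /= q1 q2 /jacobi_weight /pearson !horner_ringE.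
move: (_ `^ a) (_ `^ b) => A B; ring.
Qed.

(** The weight may blow up or vanish at the endpoints, so the fundamental theorem of calculus
is used on these compact subintervals, and then a limit is taken. *)
Definition inner_itv n : set R := `[-1 + n.+2%:R^-1, 1 - n.+2%:R^-1].

Lemma inner_itv_bound n : 0 < n.+2%:R^-1 :> R /\ -1 + n.+2%:R^-1 < 1 - n.+2%:R^-1 :> R.
Proof.
have h : n.+2%:R^-1 <= 2^-1 :> R by rewrite lef_pV2 ?posrE ?ltr0n // ler_nat.
have : 0 < n.+2%:R^-1 :> R by rewrite invr_gt0 ltr0n.
by move: h; set z := _ ^-1; lra.
Qed.

Lemma inner_itv_ends n :
  -1 < -1 + (n.+2%:R^-1 : R) < 1 /\ -1 < 1 - (n.+2%:R^-1 : R) < 1.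
Proof.
have [] := inner_itv_bound n; set z := _^-1 => *.
by split; apply/andP; split; lra.
Qed.

Lemma inner_itvP n x : inner_itv n x -> -1 < x < 1.
Proof. by have [h1 h2] := inner_itv_bound n; rewrite /inner_itv /= in_itv /= => /andP[];
  move: h1 h2; set z := _^-1 => *; apply/andP; split; lra. Qed.

Lemma continuous_weight_horner f n :
  {within inner_itv n, continuous (fun x => w x * f.[x])}.
Proof.
apply: derivable_within_continuous => x /inner_itvP /andP[x1 x2].
have p1 : 0 < 1 - x by lra.
have p2 : 0 < 1 + x by lra.
have d1 : is_derive x 1 (fun x : R => 1 - x) (-1).
  by have h := is_deriveB (is_derive_cst (1 : R) x 1) (is_derive_id x 1); rewrite sub0r in h.
have d2 : is_derive x 1 (fun x : R => 1 + x) 1.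
  by have h := is_deriveD (is_derive_cst (1 : R) x 1) (is_derive_id x 1); rewrite add0r in h.
apply: derivableM; last exact: derivable_horner.
apply: derivableM.
  by have h := @is_derive1_comp R (fun z : R => z `^ a) (fun x : R => 1 - x) x _ _ (is_derive1_powR a p1) d1; exact: ex_derive.
by have h := @is_derive1_comp R (fun z : R => z `^ b) (fun x : R => 1 + x) x _ _ (is_derive1_powR b p2) d2; exact: ex_derive.
Qed.

Lemma integral_inner_itv f n :
  (\int[mu]_(x in inner_itv n) (w x * (pearson f).[x])%:E =
   (pearson_prim f (1 - n.+2%:R^-1))%:E - (pearson_prim f (-1 + n.+2%:R^-1))%:E)%E.
Proof.
have [d0 lt] := inner_itv_bound n; have [x2 x1] := inner_itv_ends n.
have dI (x : R) : x \in `]-1 + n.+2%:R^-1, 1 - n.+2%:R^-1[ -> -1 < x < 1.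
  by rewrite in_itv /= => /andP[]; move: d0 lt; set z := _^-1 => *; apply/andP; split; lra.
have D (x : R) : -1 < x < 1 -> derivable (pearson_prim f) x 1.
  by move=> /(is_derive_pearson_prim f) h; exact: ex_derive.
have C (x : R) : -1 < x < 1 -> pearson_prim f x @[x --> x] --> pearson_prim f x.
  by move=> /D /derivable1_diffP /differentiable_continuous.
apply: continuous_FTC2 => //.
- exact: continuous_weight_horner.
- split; first by move=> x /dI /D.
    by apply: cvg_at_right_filter; apply: C.
  by apply: cvg_at_left_filter; apply: C.
- move=> x /dI h; rewrite derive1E.
  by have := is_derive_pearson_prim f h => hd; rewrite derive_val.
Qed.

Lemma bigcup_inner_itv : \bigcup_n inner_itv n = `]-1, 1[%classic.
Proof.
apply/seteqP; split=> x /=.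
  by move=> [n _ /inner_itvP]; rewrite in_itv.
rewrite in_itv /= => /andP[x1 x2].
pose d := Num.min (1 - x) (1 + x).
have d0 : 0 < d by rewrite lt_min; lra.
have [n nd] : exists n : nat, n.+2%:R^-1 < d.
  exists (Num.truncn d^-1).
  rewrite -[ltRHS]invrK ltf_pV2 ?posrE ?invr_gt0 ?ltr0n //.
  apply: (lt_trans (truncnS_gt _)); by rewrite ltr_nat.
exists n => //; rewrite /inner_itv /= in_itv /=.
by move: nd; rewrite lt_min => /andP[]; set z := _^-1 => *; apply/andP; split; lra.
Qed.

Lemma nondecreasing_inner_itv : nondecreasing_seq inner_itv.
Proof.
move=> m n mn; apply/subsetPset => x; rewrite /inner_itv /= !in_itv /=.
have : n.+2%:R^-1 <= m.+2%:R^-1 :> R by rewrite lef_pV2 ?posrE ?ltr0n // ler_nat !ltnS.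
by set z := _^-1; set z' := _^-1 => h /andP[h1 h2]; lra.
Qed.

Definition pearson_bound := (2 : R) `^ (a + 1) * 2 `^ (b + 1).

Lemma pearson_weight_le x : -1 < x < 1 ->
  0 <= (1 - x) `^ (a + 1) * (1 + x) `^ (b + 1) <= pearson_bound.
Proof.
move=> /andP[x1 x2]; apply/andP; split; first by rewrite mulr_ge0 // powR_ge0.
by apply: ler_pM; rewrite ?powR_ge0 //; apply: ge0_ler_powR; rewrite ?nnegrE ?ltW //; lra.
Qed.

(** Choosing [f = - x] in the Pearson derivative gives a function that is bounded below by a
positive multiple of [w], up to a bounded term: its integral over the inner intervals is
given by boundary values and stays bounded. *)
Lemma integral_weight_lty : (\int[mu]_(x in I) (w x)%:E < +oo)%E.
Proof.
rewrite integral_itv_bndoo; last first.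
  by apply/measurable_EFinP; apply: measurable_funTS; exact: measurable_jacobi_weight.
have mwE D : measurable D -> measurable_fun D (fun x => (w x)%:E).
  by move=> mD; apply/measurable_EFinP; apply: measurable_funTS; exact: measurable_jacobi_weight.
have mJ n : measurable (inner_itv n) by exact: measurable_itv.
have := @ge0_nondecreasing_set_cvg_integral _ (measurableTypeR R) R inner_itv (fun x => (w x)%:E) mu
  nondecreasing_inner_itv mJ (fun i => mwE _ (mJ i))
  (fun i x _ => (jacobi_weight_ge0 x : (0 <= (w x)%:E)%E)).
rewrite bigcup_inner_itv => cv.
(* With g the Pearson factor of - x, one has
g + (a + b + 3)(1 - x^2) = (a + 1)(1 + x) + (b + 1)(1 - x) >= 2 c. *)
pose c := Num.min (a + 1) (b + 1).
have c0 : 0 < c by rewrite lt_min a10.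
have ca : c <= a + 1 by rewrite /c ge_min lexx.
have cb : c <= b + 1 by rewrite /c ge_min lexx orbT.
pose K := (2 * c)^-1.
have K0 : 0 < K by rewrite invr_gt0 mulr_gt0.
pose g := pearson (- 'X).
have P0 : 0 <= pearson_bound by rewrite mulr_ge0 // powR_ge0.
have gw (x : R) : -1 < x < 1 -> w x <= K * (w x * g.[x]) + K * (a + b + 3) * pearson_bound.
  move=> x01; have [x1 x2] := andP x01; have [h1 h2] := andP (pearson_weight_le x01).
  have W0 := jacobi_weight_ge0 x.
  have q1 : (1 - x) `^ (a + 1) = (1 - x) * (1 - x) `^ a.
    by rewrite -[in RHS](addrK 1 a) mulr_powRB1 //; lra.
  have q2 : (1 + x) `^ (b + 1) = (1 + x) * (1 + x) `^ b.
    by rewrite -[in RHS](addrK 1 b) mulr_powRB1 //; lra.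
  have h3 : (1 - x) * (1 + x) * w x <= pearson_bound.
    by move: h2; rewrite q1 q2 /jacobi_weight; move: (_ `^ a) (_ `^ b) => A B; nra.
  have gE : 2 * c <= g.[x] + (a + b + 3) * ((1 - x) * (1 + x)).
    have -> : g.[x] + (a + b + 3) * ((1 - x) * (1 + x)) = (a + 1) * (1 + x) + (b + 1) * (1 - x).
      by rewrite /g /pearson derivN derivX !horner_ringE; ring.
    have p1 : 0 <= 1 - x by lra.
    have p2 : 0 <= 1 + x by lra.
    have := ler_wpM2r p2 ca; have := ler_wpM2r p1 cb; lra.
  rewrite [leLHS](_ : _ = K * ((2 * c) * w x)); last first.
    by rewrite mulrA mulVf ?mul1r // mulf_neq0 ?gt_eqF.
  rewrite -[K * _ * _]mulrA -mulrDr ler_pM2l //.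
  apply: (le_trans (ler_wpM2r W0 gE)).
  have ab : 0 <= a + b + 3 by have := a10; have := b10; lra.
  have := ler_wpM2l ab h3.
  move=> h; rewrite (_ : _ * w x = w x * g.[x] + (a + b + 3) * ((1 - x) * (1 + x) * w x)).
    by rewrite lerD2l.
  by ring.
pose C := K * (2 * pearson_bound) + K * (a + b + 3) * pearson_bound * 2.
have bound n : (\int[mu]_(x in inner_itv n) (w x)%:E <= C%:E)%E.
  have [d0 lt] := inner_itv_bound n; have [x2 x1] := inner_itv_ends n.
  have ig : mu.-integrable (inner_itv n) (EFin \o (fun x => w x * g.[x])).
    apply: continuous_compact_integrable; first exact: segment_compact.
    exact: continuous_weight_horner.
  have ic (r : R) : mu.-integrable (inner_itv n) (EFin \o (fun=> r)).
    apply: continuous_compact_integrable; first exact: segment_compact.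
    by apply: continuous_subspaceT => ?; exact: cvg_cst.
  apply: (@le_trans _ _ (\int[mu]_(x in inner_itv n) (K * (w x * g.[x]) + K * (a + b + 3) * pearson_bound)%:E)%E).
    apply: ge0_le_integral => //.
    - exact: mJ.
    - by move=> x _; rewrite lee_fin jacobi_weight_ge0.
    - exact: mwE.
    - apply/measurable_EFinP; apply: measurable_funD => //; apply: measurable_funM => //.
      apply: measurable_funM; last exact: measurable_horner.
      apply: measurable_funTS; exact: measurable_jacobi_weight.
    - by move=> x /inner_itvP /gw; rewrite lee_fin.
  have iK : mu.-integrable (inner_itv n) (EFin \o (fun x => K * (w x * g.[x]))).
    by have := @integrableZl _ (measurableTypeR R) R mu (inner_itv n) (mJ n) K _ ig.
  have E1 := @integralD_EFin _ (measurableTypeR R) R mu _ (mJ n) _ _ iK (ic (K * (a + b + 3) * pearson_bound)).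
  have E2 := @integralZl _ (measurableTypeR R) R mu _ (mJ n) _ ig K.
  have E3 := integral_inner_itv (- 'X) n.
  have E4 := @integral_cst _ (measurableTypeR R) R mu _ (mJ n) (K * (a + b + 3) * pearson_bound)%:E.
  rewrite /= in E1 E2 E3 E4.
  rewrite E1 [X in (X + _)%E](eq_trans _ E2) // E3 E4 /inner_itv lebesgue_measure_itv /= lte_fin lt.
  rewrite -EFinB -!EFinM -EFinD lee_fin /C; apply: lerD.
    rewrite ler_pM2l //.
    have [h1 h2] := andP (pearson_weight_le x1).
    have [h3 h4] := andP (pearson_weight_le x2).
    rewrite /pearson_prim !horner_ringE.
    move: h1 h2 h3 h4; set A := _ * _ `^ (b + 1); set B := _ * _ `^ (b + 1).
    move: d0 lt; set z := _^-1; nra.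
  apply: ler_wpM2l; first by rewrite !mulr_ge0 ?ltW //; have := a10; have := b10; lra.
  by move: d0; move: (_ ^-1) => z z0; lra.
apply: (@le_lt_trans _ _ C%:E); last by rewrite ltry.
by apply: (cvge_to_le cv); exact: nearW.
Qed.

End Weight.

(** * Moments of polynomials against the weight *)

Lemma eq_integral_on {R : realType} (D : set R) (f g : R -> \bar R) :
  (forall x, D x -> f x = g x) ->
  (\int[@lebesgue_measure R]_(x in D) f x = \int[@lebesgue_measure R]_(x in D) g x)%E.
Proof. by move=> fg; apply: eq_integral => x; rewrite inE; exact: fg. Qed.

Section Moments.
Context {R : realType}.
Variables a b : R.
Hypothesis a1 : -1 < a.
Hypothesis b1 : -1 < b.
Local Notation mu := (@lebesgue_measure R).
Local Notation I := (`[(-1 : R)%R, (1 : R)%R]%classic).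
Local Notation w := (jacobi_weight a b).
Implicit Types (f g : {poly R}).

Lemma measurable_I11 : measurable I. Proof. exact: measurable_itv. Qed.
Hint Resolve measurable_I11 : core.

Lemma weight_integrable : mu.-integrable I (EFin \o w).
Proof.
apply/integrableP; split.
  by apply/measurable_EFinP; apply: measurable_funTS; exact: measurable_jacobi_weight.
under eq_integral => x _ do rewrite /= ger0_norm ?jacobi_weight_ge0 //.
exact: integral_weight_lty.
Qed.

Lemma mul_weight_measurable (h : R -> R) : measurable_fun I h ->
  measurable_fun I (fun x => h x * w x).
Proof.
move=> mh; apply: measurable_funM => //.
by apply: measurable_funTS; exact: measurable_jacobi_weight.
Qed.

Lemma bounded_weight_integrable (h : R -> R) (M : R) : measurable_fun I h ->
  (forall x, I x -> `|h x| <= M) ->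
  mu.-integrable I (EFin \o (fun x => h x * w x)).
Proof.
move=> mh hM; apply: (@le_integrable _ _ _ mu I measurable_I11 _ (fun x => (M * w x)%:E)).
- by apply/measurable_EFinP; exact: mul_weight_measurable.
- move=> x Ix /=; rewrite lee_fin !normrM ler_wpM2r //.
  exact: le_trans (hM _ Ix) (ler_norm _).
- exact: (@integrableZl _ _ _ mu I measurable_I11 _ (fun x => (w x)%:E) weight_integrable).
Qed.

Lemma poly_bounded f : exists M : R, 0 <= M /\ forall x : R, I x -> `|f.[x]| <= M.
Proof.
exists (\sum_(i < size f) `|f`_i|); split; first exact: sumr_ge0.
move=> x; rewrite /= in_itv /= => /andP[x1 x2].
rewrite horner_coef (le_trans (ler_norm_sum _ _ _)) //; apply: ler_sum => i _.
rewrite normrM ler_piMr // normrX exprn_ile1 // ler_norml x2 andbT; lra.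
Qed.

Lemma poly_weight_integrable f :
  mu.-integrable I (EFin \o (fun x => f.[x] * w x)).
Proof.
have [M [_ hM]] := poly_bounded f.
by apply: (@bounded_weight_integrable _ M) => //; exact: measurable_horner.
Qed.

(** The integral of a polynomial against the weight. *)
Definition jmoment f : R := \int[mu]_(x in I) (f.[x] * w x).

Fact jmoment_is_scalar : scalar jmoment.
Proof.
move=> c f g; rewrite /jmoment.
under eq_Rintegral do rewrite hornerD hornerZ mulrDl -mulrA.
rewrite RintegralD // ?RintegralZl //; try exact: poly_weight_integrable.
have := @integrableZl _ _ _ mu I measurable_I11 c _ (poly_weight_integrable f).
by apply: eq_integrable => // x _ /=; rewrite EFinM.
Qed.

Lemma jmomentD f g : jmoment (f + g) = jmoment f + jmoment g.
Proof. by have := jmoment_is_scalar 1 f g; rewrite scale1r mul1r. Qed.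

Lemma jmoment0 : jmoment 0 = 0.
Proof. by apply: (addrI (jmoment 0)); rewrite -jmomentD !addr0. Qed.

Lemma jmomentZ c f : jmoment (c *: f) = c * jmoment f.
Proof. by have := jmoment_is_scalar c f 0; rewrite addr0 jmoment0 addr0. Qed.

Lemma jmomentB f g : jmoment (f - g) = jmoment f - jmoment g.
Proof. by rewrite jmomentD -scaleN1r jmomentZ mulN1r. Qed.

Lemma jmoment_sum J (r : seq J) (F : J -> {poly R}) :
  jmoment (\sum_(j <- r) F j) = \sum_(j <- r) jmoment (F j).
Proof. exact: (big_morph jmoment jmomentD jmoment0). Qed.

Lemma jmoment_ge0 f : (forall x, I x -> 0 <= f.[x]) -> 0 <= jmoment f.
Proof.
move=> f0; apply: Rintegral_ge0 => x Ix.
by rewrite mulr_ge0 ?f0 // jacobi_weight_ge0.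
Qed.

Lemma ae_inner (P : R -> Prop) : (forall x, -1 < x < 1 -> P x) ->
  {ae mu, forall x, I x -> P x}.
Proof.
move=> hP; exists [set -1; 1]; split.
- by apply: measurableU; exact: measurable_set1.
- exact: (countable_lebesgue_measure0 (finite_set_countable (finite_set2 _ _))).
- move=> x /= /not_implyP[]; rewrite /= in_itv /= => /andP[x1 x2] nP.
  have [->|n1] := eqVneq x (-1); first by left.
  have [->|n2] := eqVneq x 1; first by right.
  by exfalso; apply: nP; apply: hP; rewrite !lt_neqAle x1 x2 n2 eq_sym n1.
Qed.

Lemma cvg_powR_inv_nat (c : R) : 0 < c -> (n.+2%:R^-1 : R) `^ c @[n --> \oo] --> (0 : R).
Proof.
move=> c0; have /cvg_at_rightP := powR_cvg0 c0; apply.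
split; first by move=> n; rewrite invr_gt0 ltr0n.
by have := @cvg_harmonic R; rewrite -cvg_shiftS.
Qed.

Lemma pearson_prim_end_cvg0 (c d M : R) (u : R ^nat) : 0 < c -> 0 < d ->
  (forall n, `|u n| <= (n.+2%:R^-1 : R) `^ c * 2 `^ d * M) -> u n @[n --> \oo] --> (0 : R).
Proof.
move=> c0 d0 uM; apply/norm_cvg0P.
apply: (@squeeze_cvgr _ _ _ _ (fun=> 0) (fun n => (n.+2%:R^-1 : R) `^ c * (2 `^ d * M))).
- by apply: nearW => n; rewrite normr_ge0 /= mulrA uM.
- exact: cvg_cst.
- rewrite -[X in _ --> X](mul0r (2 `^ d * M)); apply: cvgM; last exact: cvg_cst.
  exact: cvg_powR_inv_nat.
Qed.

(** The boundary terms [(1 - x)^(a+1) (1 + x)^(b+1) f] vanish at both ends. *)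
Lemma pearson_identity f : jmoment (pearson a b f) = 0.
Proof.
have [M [M0 hM]] := poly_bounded (pearson a b f).
have [N [N0 hN]] := poly_bounded f.
pose G := fun x => ((pearson a b f).[x] * w x)%:E : \bar R.
pose F n := (G \_ (inner_itv n)).
have mG : measurable_fun I G.
  by have /integrableP[] := poly_weight_integrable (pearson a b f).
have mJ n : measurable (inner_itv n : set R) by exact: measurable_itv.
have JI n : inner_itv n `<=` I.
  move=> x /inner_itvP; rewrite /= in_itv /= => /andP[x1 x2]; by rewrite !ltW.
have [|||||_ _ cv] := @dominated_convergence _ (measurableTypeR R) R mu I measurable_I11 F G
  (fun x => (M * w x)%:E).
- move=> n; apply/(measurable_restrict _ (mJ n) measurable_I11).
  by apply: measurable_funS mG.
- exact: mG.
- apply: ae_inner => x x01.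
  have : `]-1, 1[%classic x by rewrite /= in_itv.
  rewrite -bigcup_inner_itv => -[n _ xn].
  apply: cvg_near_cst; exists n => // m /= nm; rewrite /F patchE mem_set //.
  by have h := @nondecreasing_inner_itv R n m nm; move/subsetPset : h; apply.
- exact: (@integrableZl _ _ _ mu I measurable_I11 M _ weight_integrable).
- apply: aeW => x n Ix; rewrite /F patchE; case: ifPn => _.
    rewrite /G lee_fin normrM (ger0_norm (jacobi_weight_ge0 _ _ _)).
    by rewrite ler_wpM2r ?jacobi_weight_ge0 // hM.
  by rewrite abse0 lee_fin mulr_ge0 // jacobi_weight_ge0.
rewrite /= in cv.
have E n : (\int[mu]_(x in I) F n x = (pearson_prim a b f (1 - n.+2%:R^-1) -
    pearson_prim a b f (-1 + n.+2%:R^-1))%:E)%E.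
  rewrite /F -integral_mkcondr setIidr // EFinB -integral_inner_itv //.
  by apply: eq_integral => x _; rewrite /G mulrC.
have cv0 : (pearson_prim a b f (1 - n.+2%:R^-1) -
    pearson_prim a b f (-1 + n.+2%:R^-1))%:E @[n --> \oo] --> (0%:E : \bar R).
  apply: cvg_EFin; first exact: nearW.
  rewrite -[X in _ --> X](subr0 0); apply: cvgB.
  - apply: (@pearson_prim_end_cvg0 (a + 1) (b + 1) N); rewrite -?ltrBlDr ?sub0r //.
    move=> n; have [d0 lt] := @inner_itv_bound R n; have [x2 x1] := @inner_itv_ends R n.
    rewrite /pearson_prim !normrM !(ger0_norm (powR_ge0 _ _)) subKr.
    apply: ler_pM; rewrite ?mulr_ge0 ?powR_ge0 //; last first.
      by apply: hN; rewrite /= in_itv /= !ltW //; case/andP: x1.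
    apply: ler_wpM2l; first exact: powR_ge0.
    by apply: ge0_ler_powR; rewrite ?nnegrE; move: b1 x1; set z := _^-1 => ? /andP[]*; lra.
  - apply: (@pearson_prim_end_cvg0 (b + 1) (a + 1) N); rewrite -?ltrBlDr ?sub0r //.
    move=> n; have [d0 lt] := @inner_itv_bound R n; have [x2 x1] := @inner_itv_ends R n.
    rewrite /pearson_prim !normrM !(ger0_norm (powR_ge0 _ _)) addrA addrN add0r.
    rewrite [X in X * _ <= _]mulrC.
    apply: ler_pM; rewrite ?mulr_ge0 ?powR_ge0 //; last first.
      by apply: hN; rewrite /= in_itv /= !ltW //; case/andP: x2.
    apply: ler_wpM2l; first exact: powR_ge0.
    by apply: ge0_ler_powR; rewrite ?nnegrE; move: a1 x2; set z := _^-1 => ? /andP[]*; lra.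
have : (\int[mu]_(x in I) G x = 0%:E)%E.
  apply: (@cvg_unique _ _ _ _ _ _ cv); first exact: ereal_hausdorff.
  by apply: cvg_trans cv0; apply: near_eq_cvg; apply: nearW => n; rewrite -E.
by rewrite /jmoment /Rintegral => ->.
Qed.

(** A continuous function that is zero almost everywhere on an interval is zero on it; the
weight is positive there. *)
Lemma weighted_ae0_continuous (g : R -> R) : measurable_fun I g ->
  (forall x, -1 < x < 1 -> {for x, continuous g}) ->
  (\int[mu]_(x in I) (`|g x| * w x)%:E = 0)%E ->
  forall x, -1 < x < 1 -> g x = 0.
Proof.
move=> mg cg int0 x0 x01; apply/eqP/negP => /negP g0.
have mgw : measurable_fun I (fun x => (g x * w x)%:E).
  by apply/measurable_EFinP; exact: mul_weight_measurable.
have [N [mN N0 sub]] : ae_eq mu I (fun x => (g x * w x)%:E) (cst 0%E).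
  apply/(ae_eq_integral_abs mu measurable_I11 mgw); rewrite -[RHS]int0.
  apply: eq_integral => x _ /=; by rewrite normrM (ger0_norm (jacobi_weight_ge0 _ _ _)).
have : \forall x \near x0, -1 < x < 1 /\ g x != 0.
  near=> x; split; last first.
    near: x; exact: (cvgr_neq0 _ (cg _ x01) g0).
  have : x \in `]-1, 1[ by near: x; apply: near_in_itvoo; rewrite in_itv.
  by rewrite in_itv.
move=> /nbhs_ballP[e /= e0 be].
have : (mu (ball x0 e) <= mu N)%E.
  apply: le_measure; rewrite ?inE //; first exact: measurable_ball.
  move=> x /be [x' gx]; apply: sub => /=; apply/not_implyP; split.
    by rewrite in_itv /=; case/andP: x' => *; rewrite !ltW.
  move=> [] /eqP; rewrite mulf_eq0 (negbTE gx) /= gt_eqF //.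
  exact: jacobi_weight_gt0.
have := lebesgue_measure_ball x0 (ltW e0) => /= ->; rewrite N0 lee_fin leNgt.
by rewrite pmulrn_lgt0 // e0.
Unshelve. all: by end_near. Qed.

Lemma poly_eq0_inner f : (forall x, -1 < x < 1 -> f.[x] = 0) -> f = 0.
Proof.
move=> f0; apply/eqP/negP => /negP fn0.
pose s := [seq (n.+2%:R^-1 : R) | n <- iota 0 (size f)].
have us : uniq s.
  rewrite map_inj_uniq ?iota_uniq // => m n /invr_inj /eqP.
  by rewrite eqr_nat => /eqP [].
have rs : all (root f) s.
  apply/allP => x /mapP[n _ ->]; apply/eqP/f0.
  have [d0 lt] := @inner_itv_bound R n; have := @inner_itv_ends R n.
  by move: d0 lt; set z := _^-1 => ? ? [] /andP[? ?] /andP[? ?]; apply/andP; split; lra.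
by have := max_poly_roots fn0 rs us; rewrite size_map size_iota ltnn.
Qed.

Lemma jmoment_eq0 f : (forall x, I x -> 0 <= f.[x]) -> jmoment f = 0 -> f = 0.
Proof.
move=> f0 M0; apply: poly_eq0_inner => x x01.
apply: (@weighted_ae0_continuous (horner f)) => //.
- exact: measurable_horner.
- by move=> z _; exact: continuous_horner.
- have /integrable_fin_num fi := poly_weight_integrable f.
  rewrite (@eq_integral_on _ _ _ (fun z => ((f.[z] * w z)%:E))).
    by have := fineK (fi measurable_I11); rewrite /= => <-; rewrite [X in X%:E]M0.
  by move=> z Iz; rewrite ger0_norm // f0.
Qed.

(** The bilinear form [(f, g) |-> M (f g)] is definite; all uniqueness statements for
polynomials come from this. *)
Lemma jmoment_sqr_eq0 f : jmoment (f * f) = 0 -> f = 0.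
Proof.
move=> /jmoment_eq0 f0; apply/eqP; rewrite -[_ == _]orbb -mulf_eq0; apply/eqP.
by apply: f0 => x _; rewrite hornerM -expr2 sqr_ge0.
Qed.

End Moments.

(** * Jacobi polynomials as eigenpolynomials *)

Section JacobiPolynomials.
Context {R : realType}.
Variables a b : R.
Hypothesis a1 : -1 < a.
Hypothesis b1 : -1 < b.
Local Notation mu := (@lebesgue_measure R).
Local Notation I := (`[(-1 : R)%R, (1 : R)%R]%classic).
Local Notation w := (jacobi_weight a b).
Local Notation M := (jmoment a b).
Local Notation L := (jacobi_op a b).
Implicit Types (f g Q : {poly R}) (k n : nat).

(** By the Pearson identity for [f' g], both sides are minus the symmetric form
[M ((1 - x^2) f' g')]. *)
Lemma jacobi_op_sym f g : M (L f * g) = M (f * L g).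
Proof.
suff E h1 h2 : M (L h1 * h2) = - M ((1 - 'X^2) * (h1^`() * h2^`())).
  by rewrite [f * _]mulrC !E [f^`() * _]mulrC.
apply/eqP; rewrite -addr_eq0 -jmomentD // -(pearson_identity a1 b1 (h1^`() * h2)).
by apply/eqP; congr (jmoment _ _ _); rewrite /jacobi_op /pearson derivM; ring.
Qed.

Lemma coef_jacobi_op f i : (L f)`_i =
  f`_i.+2 * (i.+1 * i.+2)%:R + (b - a) * f`_i.+1 * i.+1%:R
  - (i%:R * (i%:R + a + b + 1)) * f`_i.
Proof.
have -> : L f = f^`()^`() - 'X^2 * f^`()^`()
    + ((b - a)%:P * f^`() - (a + b + 2)%:P * ('X * f^`())).
  by rewrite /jacobi_op; ring.
rewrite coefD !coefB coefXnM !coefCM coefXM.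
rewrite !coef_deriv; case: i => [|[|i]] /=.
- by rewrite !mulr0n; ring.
- by ring.
- by rewrite !subSS subn0; ring.
Qed.

Lemma size_jacobi_op f n : (size f <= n)%N -> (size (L f) <= n)%N.
Proof.
move=> /leq_sizeP sf; apply/leq_sizeP => j nj.
by rewrite coef_jacobi_op !sf ?mul0r ?mulr0 ?mul0r ?addr0 ?subr0 // ltnW // ltnS ltnW.
Qed.

(** Gram-Schmidt, by induction on the dimension. *)
Lemma jmoment_orth_proj k f : exists g, (size g <= k)%N /\
  forall Q, (size Q <= k)%N -> M ((f - g) * Q) = 0.
Proof.
elim: k f => [|k IH] f.
  exists 0; split; first by rewrite size_poly0.
  by move=> Q; rewrite leqn0 size_poly_eq0 => /eqP ->; rewrite mulr0 jmoment0.
have [g [sg og]] := IH f; have [h [sh oh]] := IH 'X^k.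
pose P := 'X^k - h.
have Pn0 : P != 0.
  apply/negP => /eqP P0; have : P`_k = 1 - h`_k by rewrite coefB coefXn eqxx.
  rewrite P0 coef0 (leq_sizeP _ _ sh) // subr0 => /eqP.
  by rewrite eq_sym oner_eq0.
have PP : M (P * P) != 0 by apply/negP => /eqP /(jmoment_sqr_eq0 a1 b1) /eqP; apply/negP.
pose c := M ((f - g) * P) / M (P * P).
have sP : (size P <= k.+1)%N.
  rewrite /P (leq_trans (size_polyD _ _)) //.
  by rewrite geq_max size_polyXn leqnn size_polyN (leq_trans sh).
exists (g + c *: P); split.
  rewrite (leq_trans (size_polyD _ _)) // geq_max (leq_trans sg) //=.
  by rewrite (leq_trans (size_scale_leq _ _)).
move=> Q sQ; have [q [Q' [sQ' QE]]] : exists (q : R) Q', (size Q' <= k)%N /\ Q = q *: P + Q'.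
  exists Q`_k, (Q - Q`_k *: P); split; last by rewrite addrC subrK.
  apply/leq_sizeP => j kj; rewrite coefB coefZ coefB coefXn.
  rewrite (leq_sizeP _ _ sh) // subr0; have [->|jk] := eqVneq j k.
    by rewrite mulr1 subrr.
  by rewrite mulr0 subr0 (leq_sizeP _ _ sQ) // ltn_neqAle eq_sym jk.
have {}og := og Q' sQ'; have {}oh : M (P * Q') = 0 by exact: oh.
rewrite QE opprD addrA; set F := f - g in og c *; clearbody P F.
rewrite mulrDr jmomentD // !mulrBl !jmomentB // og // -!scalerAr -!scalerAl !jmomentZ // oh.
by rewrite mulr0 subr0 addr0 /c divfK // subrr.
Qed.

Lemma gbinom_neq0 k : gbinom (k%:R + a) k != 0.
Proof.
rewrite /gbinom mulf_neq0 ?invr_neq0 ?pnatr_eq0 -?lt0n ?fact_gt0 //.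
apply/prodf_neq0 => i _; rewrite gt_eqF //.
have : i.+1%:R <= k%:R :> R by rewrite ler_nat.
by rewrite -natr1; move: a1; lra.
Qed.

Lemma jacobi_orthE f g : \int[mu]_(x in I) (f.[x] * g.[x] * w x) = M (f * g).
Proof. by apply: eq_Rintegral => x _; rewrite hornerM. Qed.

(** Only the normalization at [1] needs an argument: if the monic orthogonal polynomial were
[(x - 1) q], it would be orthogonal to [q], so [(1 - x) q^2] would have integral zero. *)
Lemma jacobi_poly_exists k : exists P, is_jacobi_poly a b k P.
Proof.
have [h [sh oh]] := jmoment_orth_proj k 'X^k.
pose P := 'X^k - h.
have sP : size P = k.+1 by rewrite /P size_polyDl size_polyXn // size_polyN ltnS.
have Pn0 : P != 0 by rewrite -size_poly_eq0 sP.
have P1 : P.[1] != 0.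
  apply/negP => /factor_theorem [q PE].
  have sq : (size q <= k)%N.
    have qn0 : q != 0 by apply: contraNneq Pn0 => q0; rewrite PE q0 mul0r.
    by have := sP; rewrite PE size_Mmonic ?monicXsubC // size_XsubC addn2 /= => -[->].
  have Mq : M ((1 - 'X) * (q * q)) = 0.
    rewrite -[RHS]oppr0 -(oh q sq) -/P PE -[RHS]mulN1r -jmomentZ // scaleN1r; congr (jmoment _ _ _).
    by rewrite polyC1; ring.
  have q0 : (1 - 'X) * (q * q) = 0.
    apply: (jmoment_eq0 a1 b1) Mq => x; rewrite /= in_itv /= => /andP[_ x1].
    by rewrite !horner_ringE -expr2 mulr_ge0 ?sqr_ge0 // subr_ge0.
  have X1 : 1 - 'X != 0 :> {poly R} by rewrite -oppr_eq0 opprB -polyC1 polyXsubC_eq0.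
  move/eqP: q0; rewrite mulf_eq0 (negbTE X1) mulf_eq0 orbb /= => /eqP q0.
  by move: Pn0; rewrite PE q0 mul0r eqxx.
pose c := gbinom (k%:R + a) k / P.[1].
have c0 : c != 0 by rewrite mulf_neq0 ?gbinom_neq0 ?invr_neq0.
exists (c *: P); split.
- by rewrite size_scale.
- by move=> Q sQ; rewrite jacobi_orthE -scalerAl jmomentZ // oh // mulr0.
- by rewrite hornerZ divfK.
Qed.

Local Notation jp := (jacobi_poly a b).

Lemma jacobi_polyP k : is_jacobi_poly a b k (jp k).
Proof. by rewrite /jacobi_poly; case: xgetP => [P ->//|/= np]; have [P /np] := jacobi_poly_exists k. Qed.

Lemma size_jacobi_poly k : size (jp k) = k.+1.
Proof. by have [] := jacobi_polyP k. Qed.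

Lemma jacobi_poly_orth k Q : (size Q <= k)%N -> M (jp k * Q) = 0.
Proof. by have [_ + _] := jacobi_polyP k => o sQ; rewrite -jacobi_orthE o. Qed.

Lemma jacobi_poly1_neq0 k : (jp k).[1] != 0.
Proof. by have [_ _ ->] := jacobi_polyP k; exact: gbinom_neq0. Qed.

Lemma jmoment_orth_eq0 f : (forall k, M (f * jp k) = 0) -> f = 0.
Proof.
move=> fo; suff oQ n Q : (size Q <= n)%N -> M (f * Q) = 0.
  by apply: (jmoment_sqr_eq0 a1 b1); exact: (oQ _ _ (leqnn _)).
elim: n Q => [|n IH] Q sQ.
  by move: sQ; rewrite leqn0 size_poly_eq0 => /eqP ->; rewrite mulr0 jmoment0.
pose c := Q`_n / (jp n)`_n.
have ln : (jp n)`_n != 0.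
  have := size_jacobi_poly n; have := lead_coef_eq0 (jp n).
  by rewrite lead_coefE => + sz; rewrite sz /= => ->; rewrite -size_poly_eq0 sz.
have -> : Q = c *: jp n + (Q - c *: jp n) by rewrite addrC subrK.
rewrite mulrDr jmomentD // -scalerAr jmomentZ // fo mulr0 add0r IH //.
apply/leq_sizeP => j nj; rewrite coefB coefZ.
have [->|jn] := eqVneq j n; first by rewrite divfK // subrr.
have nj' : (n < j)%N by rewrite ltn_neqAle eq_sym jn.
by rewrite (leq_sizeP _ _ sQ) // (@leq_sizeP _ (jp n) n.+1 _) ?size_jacobi_poly // mulr0 subrr.
Qed.

Definition jacobi_eigenvalue k : R := k%:R * (k%:R + a + b + 1).

Lemma jacobi_eigenvalue_inj j k :
  jacobi_eigenvalue j = jacobi_eigenvalue k -> j = k.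
Proof.
move=> /eqP; rewrite -subr_eq0 /jacobi_eigenvalue.
have -> : j%:R * (j%:R + a + b + 1) - k%:R * (k%:R + a + b + 1)
  = (j%:R - k%:R) * ((j + k)%:R + a + b + 1) :> R by rewrite natrD; ring.
rewrite mulf_eq0 => /orP[|]; first by rewrite subr_eq0 eqr_nat => /eqP.
case: (posnP (j + k)) => [|jk].
  by move/eqP; rewrite addn_eq0 => /andP[/eqP -> /eqP ->].
have : 1 <= (j + k)%:R :> R by rewrite ler1n.
by move=> + /eqP; move: a1 b1 ((j + k)%:R) => ? ? z ? ?; exfalso; lra.
Qed.

(** [L P_k + lambda_k P_k] has degree less than [k] and is orthogonal to all such polynomials,
because [L] is symmetric and does not raise degrees. *)
Lemma jacobi_op_jacobi_poly k : L (jp k) = - jacobi_eigenvalue k *: jp k.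
Proof.
apply/eqP; rewrite scaleNr -addr_eq0; apply/eqP; set D := _ + _.
have sD : (size D <= k)%N.
  apply/leq_sizeP => j kj; rewrite coefD coefZ coef_jacobi_op.
  have h i : (k < i)%N -> (jp k)`_i = 0.
    by move=> ki; rewrite (@leq_sizeP _ (jp k) k.+1 _) ?size_jacobi_poly.
  rewrite (h j.+2) ?(h j.+1) ?ltnS // 1?leqW //; have [->|jk] := eqVneq j k.
    by rewrite /jacobi_eigenvalue; ring.
  by rewrite (h j) ?ltn_neqAle 1?eq_sym ?jk //; ring.
apply: (jmoment_sqr_eq0 a1 b1); rewrite {1}/D mulrDl jmomentD // -scalerAl jmomentZ //.
by rewrite jacobi_op_sym !jacobi_poly_orth // ?mulr0 ?addr0 // size_jacobi_op.
Qed.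

Lemma jacobi_eigenpoly q k : L q = - jacobi_eigenvalue k *: q ->
  q = (q.[1] / (jp k).[1]) *: jp k.
Proof.
move=> Lq; pose c := M (q * jp k) / M (jp k * jp k).
have jk0 : M (jp k * jp k) != 0.
  apply/negP => /eqP /(jmoment_sqr_eq0 a1 b1) /eqP.
  by rewrite -size_poly_eq0 size_jacobi_poly.
have qE : q = c *: jp k.
  apply/eqP; rewrite -subr_eq0; apply/eqP; apply: jmoment_orth_eq0 => j.
  rewrite mulrBl jmomentB // -scalerAl jmomentZ //.
  have [->|jk] := eqVneq j k; first by rewrite divfK // subrr.
  have E f l m : L f = - jacobi_eigenvalue l *: f -> l != m -> M (f * jp m) = 0.
    move=> Lf lm; have := jacobi_op_sym f (jp m).
    rewrite Lf jacobi_op_jacobi_poly -scalerAl -scalerAr !jmomentZ // => /eqP.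
    rewrite -subr_eq0 -mulrBl mulf_eq0 => /orP[|/eqP //].
    rewrite subr_eq0 eqr_opp => /eqP /jacobi_eigenvalue_inj lmE.
    by rewrite lmE eqxx in lm.
  rewrite (E q k j) // 1?eq_sym // (E (jp k) k j) // 1?eq_sym // ?mulr0 ?subrr //.
  exact: jacobi_op_jacobi_poly.
by rewrite {2}qE hornerZ mulfK ?jacobi_poly1_neq0.
Qed.

Definition jpolyR k : {poly R} := (jp k).[1]^-1 *: jp k.

Lemma jacobiRE k x : jacobiR a b k x = (jpolyR k).[x].
Proof. by rewrite /jacobiR /jpolyR hornerZ mulrC. Qed.

Lemma jpolyR1 k : (jpolyR k).[1] = 1.
Proof. by rewrite /jpolyR hornerZ mulVf // jacobi_poly1_neq0. Qed.

Lemma jpolyR_neq0 k : jpolyR k != 0.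
Proof. by apply/negP => /eqP E; have := jpolyR1 k; rewrite E horner0 => /eqP; rewrite eq_sym oner_eq0. Qed.

Lemma size_jpolyR k : size (jpolyR k) = k.+1.
Proof. by rewrite size_scale ?size_jacobi_poly // invr_neq0 // jacobi_poly1_neq0. Qed.

Lemma jacobi_op_jpolyR k : L (jpolyR k) = - jacobi_eigenvalue k *: jpolyR k.
Proof. by rewrite /jpolyR linearZ /= jacobi_op_jacobi_poly !scalerA mulrC. Qed.

(** Eigenvalues of [L] are distinct, so an eigenpolynomial is orthogonal to every [R_j] but
one. *)
Lemma jpolyR_eigen q k : L q = - jacobi_eigenvalue k *: q -> q = q.[1] *: jpolyR k.
Proof. by move=> /jacobi_eigenpoly {1}->; rewrite /jpolyR scalerA. Qed.

Lemma jpolyR_orth_eq0 f : (forall k, M (f * jpolyR k) = 0) -> f = 0.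
Proof.
move=> h; apply: jmoment_orth_eq0 => k; have := h k.
rewrite /jpolyR -scalerAr jmomentZ // => /eqP; rewrite mulf_eq0 invr_eq0.
by rewrite (negbTE (jacobi_poly1_neq0 k)) => /eqP.
Qed.

Lemma jpolyR_orth k Q : (size Q <= k)%N -> M (Q * jpolyR k) = 0.
Proof.
by move=> sQ; rewrite mulrC /jpolyR -scalerAl jmomentZ // jacobi_poly_orth // mulr0.
Qed.

End JacobiPolynomials.

(** * The Beta expectation of a polynomial *)

Section LinearExtension.
Context {R : comNzRingType} (V : lmodType R).
Implicit Types (m : nat -> V) (P : {poly R}).

(** The linear map that sends the [n]-th power of the variable to [m n]. *)
Definition lin_ext m P : V := \sum_(i < size P) P`_i *: m i.

Lemma lin_extE m P n : (size P <= n)%N -> lin_ext m P = \sum_(i < n) P`_i *: m i.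
Proof.
move=> sP; rewrite /lin_ext -!(big_mkord xpredT (fun i => P`_i *: m i)).
rewrite [RHS](big_cat_nat _ (n := size P)) //= [X in _ = _ + X]big_nat_cond.
rewrite [X in _ = _ + X]big1 ?addr0 // => i /andP[/andP[si _] _].
by rewrite nth_default // scale0r.
Qed.

Fact lin_ext_is_linear m : linear (lin_ext m).
Proof.
move=> c P Q; pose n := maxn (size P) (size Q).
have sPQ : (size (c *: P + Q)%R <= n)%N.
  rewrite (leq_trans (size_polyD _ _)) // geq_max leq_maxr andbT.
  by rewrite (leq_trans (size_scale_leq _ _)) // leq_maxl.
rewrite !(@lin_extE _ _ n) ?leq_maxl ?leq_maxr // scaler_sumr -big_split.
by apply: eq_bigr => i _ /=; rewrite coefD coefZ scalerDl scalerA.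
Qed.

HB.instance Definition _ m :=
  GRing.isLinear.Build R {poly R} V _ (lin_ext m) (lin_ext_is_linear m).

Lemma lin_extXn m n : lin_ext m 'X^n = m n.
Proof.
rewrite (@lin_extE _ _ n.+1) ?size_polyXn // big_ord_recr /= coefXn eqxx scale1r.
rewrite big1 ?add0r // => i _.
by rewrite coefXn ltn_eqF ?scale0r //.
Qed.

End LinearExtension.

Section BetaFunctional.
Context {R : realType}.
Implicit Types (P : {poly R}).

(** The Pearson identity for the [n]-th power of [(1 + x)/2] is a two-term recursion. *)
Lemma jmoment_uhalf (a b : R) n : -1 < a -> -1 < b ->
  jmoment a b (uhalf ^+ n) = jmoment a b 1 * (poch (b + 1) n / poch (a + b + 2) n).
Proof.
move=> a1 b1; elim: n => [|n IH]; first by rewrite expr0 !poch0 divr1 mulr1.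
have := pearson_identity a1 b1 (uhalf ^+ n).
have -> : pearson a b (uhalf ^+ n) =
   (2 * (b + 1 + n%:R)) *: uhalf ^+ n - (2 * (a + b + 2 + n%:R)) *: uhalf ^+ n.+1.
  rewrite /pearson XE_uhalf; have := @deriv_uhalf_dhalf R n 0%N; rewrite expr0 !mulr1 mulr0n subr0 => ->.
  have hh : (1 / 2)%:P * 2%:P = 1 :> {poly R} by rewrite -polyCM -polyC1; congr (_%:P); field.
  rewrite polyC_natr in hh; set h := (1 / 2)%:P in hh *; clearbody h.
  rewrite -!mul_polyC !(polyCD, polyCM, polyCB) polyCN !polyC_natr !polyC1.
  move: uhalf => u; case: n {IH} => [|n] /=; first by rewrite !mulr0n expr0; ring.
  have -> : (1 - (u *+ 2 - 1) ^+ 2) * (h * (u ^+ n *+ n.+1))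
    = (h * 2) * 2 * u * (1 - u) * (u ^+ n *+ n.+1) by ring.
  by rewrite hh !exprS; ring.
rewrite (jmomentB a1 b1) !(jmomentZ a1 b1) IH !pochS => /eqP; rewrite subr_eq0 => /eqP E.
have c0 : a + b + 2 + n%:R != 0.
  by rewrite gt_eqF // ltr_wpDr //; lra.
have c1 : poch (a + b + 2) n != 0 by apply: poch_neq0; lra.
apply: (@mulfI _ (2 * (a + b + 2 + n%:R))); first by rewrite mulf_neq0 // pnatr_eq0.
by rewrite -E; field; rewrite c0.
Qed.

Lemma jmoment1_gt0 (a b : R) : -1 < a -> -1 < b -> 0 < jmoment a b 1.
Proof.
move=> a1 b1; rewrite lt0r jmoment_ge0 ?andbT //; last first.
  by move=> x _; rewrite horner_one.
apply/negP => /eqP E; have : (1 : {poly R}) = 0.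
  by apply: (jmoment_eq0 a1 b1) E => x _; rewrite horner_one.
by move/eqP; rewrite oner_eq0.
Qed.

(** The expectation of [P(u)] for a Beta variable [u] with moments [(al)_n / (ga)_n]. *)
Definition beta_expect (al ga : R) : {poly R} -> R :=
  @lin_ext R R^o (fun n => poch al n / poch ga n).

(** The functional is an integral against a Jacobi weight when [al < ga], and evaluation at [1]
when [al = ga]. *)
Lemma beta_expect_ge0 (al ga : R) P : 0 < al -> al <= ga ->
  (forall x, 0 <= x <= 1 -> 0 <= P.[x]) -> 0 <= beta_expect al ga P.
Proof.
move=> al0; rewrite le_eqVlt => /orP[/eqP <- P0|alga P0].
  have -> : beta_expect al al P = P.[1].
    rewrite /beta_expect /lin_ext horner_coef; apply: eq_bigr => i _.
    by rewrite divff ?poch_neq0 // expr1n.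
  by apply: P0; rewrite ler01 lexx.
pose a := ga - al - 1; pose b := al - 1.
have a1 : -1 < a by rewrite /a; lra.
have b1 : -1 < b by rewrite /b; lra.
have -> : beta_expect al ga P = jmoment a b (P \Po uhalf) / jmoment a b 1.
  rewrite -[P]coefK poly_def /beta_expect linear_sum /= raddf_sum /= jmoment_sum // mulr_suml.
  apply: eq_bigr => i _.
  rewrite linearZ /= lin_extXn comp_polyZ (jmomentZ a1 b1) -mulrA; congr (_ * _).
  rewrite comp_Xn_poly jmoment_uhalf // [RHS]mulrAC divff ?mul1r; last first.
    by rewrite gt_eqF // jmoment1_gt0.
  by rewrite /a /b subrK; congr (_ / poch _ _); ring.
apply: divr_ge0; last by rewrite ltW // jmoment1_gt0.
apply: jmoment_ge0 => // x; rewrite /= in_itv /= => /andP[x1 x2].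
by rewrite horner_comp horner_uhalf; apply: P0; lra.
Qed.

End BetaFunctional.

(** * The translation of polynomials and its positivity *)

Lemma big_even_odd {R : nmodType} (F : nat -> R) m :
  \sum_(i < 2 * m) F i = \sum_(l < m) (F (2 * l)%N + F (2 * l).+1).
Proof.
elim: m => [|m IH]; first by rewrite !big_ord0.
have -> : (2 * m.+1 = (2 * m).+2)%N by lia.
by rewrite !big_ord_recr /= IH addrA.
Qed.

Lemma even_part_expr {R : realType} (S E : R) n :
  ((S + E) ^+ n + (S - E) ^+ n) / 2 =
  \sum_(l < n.+1) 'C(n, 2 * l)%:R * S ^+ (n - 2 * l) * (E ^+ 2) ^+ l.
Proof.
rewrite !exprDn -big_split /=.
pose F i := (S ^+ (n - i) * E ^+ i *+ 'C(n, i) + S ^+ (n - i) * (- E) ^+ i *+ 'C(n, i)).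
rewrite -/(F _) (eq_bigr (fun i : 'I_n.+1 => F i)) //.
have -> : \sum_(i < n.+1) F i = \sum_(i < 2 * n.+1) F i.
  rewrite -!(big_mkord xpredT F) [RHS](big_cat_nat _ (n := n.+1)) //=; last by lia.
  rewrite [X in _ = _ + X]big_nat_cond [X in _ = _ + X]big1 ?addr0 // => i /andP[/andP[ni _] _].
  by rewrite /F bin_small // !mulr0n addr0.
rewrite big_even_odd mulr_suml; apply: eq_bigr => l _.
have h : (- E) ^+ (2 * l) = E ^+ (2 * l) by rewrite !exprM sqrrN.
by rewrite /F ![_ ^+ (2 * l).+1]exprS h -exprM; field.
Qed.

Section Translation.
Context {R : realType}.
Variables a b : R.
Hypothesis hab : b <= a.
Hypothesis hb : - (1 / 2) <= b.
Local Notation I := (`[(-1 : R)%R, (1 : R)%R]%classic).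
Local Notation M := (jmoment a b).
Local Notation Rk := (jpolyR a b).
Implicit Types (f g G P Q : {poly R}) (k n : nat) (x y : R).

Let b1 : -1 < b. Proof. by have := hb; lra. Qed.
Let a1 : -1 < a. Proof. exact: lt_le_trans b1 hab. Qed.

(** The expansion of [G] in powers of [(1 + x)/2]. *)
Definition uhalf_coefs G : {poly R} := G \Po ('X *+ 2 - 1).

Lemma uhalf_coefsK G : uhalf_coefs G \Po uhalf = G.
Proof.
by rewrite /uhalf_coefs -comp_polyA linearB linearMn /= comp_polyX -polyC1 comp_polyC polyC1 -XE_uhalf comp_polyXr.
Qed.

Lemma size_uhalf_coefs G : size (uhalf_coefs G) = size G.
Proof.
have E : 'X *+ 2 - 1 = 2%:P * 'X + (-1)%:P :> {poly R}.
  by rewrite polyCN polyC1 polyC_natr mulr_natl.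
rewrite /uhalf_coefs size_comp_poly2 // E size_MXaddC.
by rewrite polyC_eq0 pnatr_eq0 /= size_polyC pnatr_eq0.
Qed.

Definition poly_tr y G : {poly R} := lin_ext (fun n => tr_pow a b n y) (uhalf_coefs G).

Fact poly_tr_is_linear y : linear (poly_tr y).
Proof. by move=> c f g; rewrite /poly_tr /uhalf_coefs !linearP. Qed.

HB.instance Definition _ y :=
  GRing.isLinear.Build R {poly R} {poly R} _ (poly_tr y) (poly_tr_is_linear y).

Lemma poly_trE y G : poly_tr y G = \sum_(n < size G) (uhalf_coefs G)`_n *: tr_pow a b n y.
Proof. by rewrite /poly_tr (@lin_extE _ _ _ _ (size G)) ?size_uhalf_coefs. Qed.

Lemma horner_tr_pow n x y : (tr_pow a b n y).[x] =
  \sum_(j < n.+1) tr_coef a b n j * ((bernp n j).[y] * (bernp n j).[x]).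
Proof.
rewrite /tr_pow horner_sum; apply: eq_bigr => j _.
by rewrite hornerZ mulrA.
Qed.

(** The kernels [F_n(x, y)] are symmetric.  Thus [y |-> (T_y G)(x)] is a polynomial of degree at
most that of [G]. *)
Lemma horner_poly_tr_sym x y G : (poly_tr y G).[x] = (poly_tr x G).[y].
Proof.
rewrite !poly_trE !horner_sum; apply: eq_bigr => n _.
rewrite !hornerZ !horner_tr_pow; congr (_ * _).
by apply: eq_bigr => j _; rewrite [_.[y] * _]mulrC.
Qed.

Lemma size_uhalf : size (uhalf : {poly R}) = 2.
Proof.
have h : (1 / 2 : R) != 0 by rewrite mul1r invr_eq0 pnatr_eq0.
by rewrite /uhalf mulrDr mulr1 addrC size_MXaddC polyC_eq0 (negbTE h) size_polyC h.
Qed.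

Lemma size_dhalf : (size (dhalf : {poly R}) <= 2)%N.
Proof.
rewrite dhalfE (leq_trans (size_polyD _ _)) // size_polyN size_uhalf geq_max.
by rewrite -polyC1 size_polyC oner_eq0.
Qed.

Lemma size_bernp n j : (j <= n)%N -> (size (bernp n j : {poly R}) <= n.+1)%N.
Proof.
move=> jn; rewrite /bernp (leq_trans (size_polyMleq _ _)) //.
have h1 : (size ((uhalf : {poly R}) ^+ j) <= j.+1)%N.
  by rewrite (leq_trans (size_poly_exp_leq _ _)) // size_uhalf mul1n.
have h2 : (size ((dhalf : {poly R}) ^+ (n - j)) <= (n - j).+1)%N.
  rewrite (leq_trans (size_poly_exp_leq _ _)) // ltnS.
  by have := size_dhalf; case: (size _) => [|[|[|]]] //= _; rewrite ?mul0n ?mul1n.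
by move: h1 h2; lia.
Qed.

Lemma size_tr_pow n y : (size (tr_pow a b n y) <= n.+1)%N.
Proof.
rewrite /tr_pow (leq_trans (size_sum _ _ _)) //; apply/bigmax_leqP => j _.
by rewrite (leq_trans (size_scale_leq _ _)) // size_bernp // -ltnS.
Qed.

Lemma size_poly_tr y G : (size (poly_tr y G) <= size G)%N.
Proof.
rewrite poly_trE (leq_trans (size_sum _ _ _)) //; apply/bigmax_leqP => n _.
by rewrite (leq_trans (size_scale_leq _ _)) // (leq_trans (size_tr_pow _ _)).
Qed.

(** At [y = 1] every Bernstein monomial but the last vanishes. *)
Lemma poly_tr1 G : poly_tr 1 G = G.
Proof.
have E n : tr_pow a b n 1 = uhalf ^+ n.
  rewrite /tr_pow big_ord_recr /= big1 ?add0r.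
    rewrite /tr_coef binn subnn poch0 mulr1 mul1r divff ?mul1r; last first.
      by apply: poch_neq0; have := b1; lra.
    rewrite /bernp subnn expr0 mulr1 horner_exp horner_uhalf.
    by rewrite (_ : (1 + 1) / 2 = 1) ?expr1n ?scale1r //; field.
  move=> j _; rewrite /bernp hornerM [X in _ * (_ * X)]horner_exp horner_dhalf.
  rewrite subrr mul0r expr0n subn_eq0 leqNgt ltn_ord /= !mulr0 scale0r.
  by [].
rewrite -[RHS]uhalf_coefsK -[in RHS](coefK (uhalf_coefs G)) poly_def raddf_sum /=.
rewrite size_uhalf_coefs poly_trE; apply: eq_bigr => n _.
by rewrite comp_polyZ comp_Xn_poly E.
Qed.

(** As a function of [y], the left side is an eigenpolynomial of [L] for the eigenvalue of
[R_k], by [jacobi_op_exchange] and the symmetry of [L]; so it is its value at [1] times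
[R_k(y)]. *)
Lemma jmoment_poly_tr y G k : M (poly_tr y G * Rk k) = M (G * Rk k) * (Rk k).[y].
Proof.
pose phi f := M (f * Rk k).
have phil : scalar phi.
  by move=> c f g; rewrite /phi mulrDl -scalerAl jmomentD // jmomentZ.
have phi_sum J (r : seq J) (F : J -> {poly R}) : phi (\sum_(j <- r) F j) = \sum_(j <- r) phi (F j).
  by rewrite /phi mulr_suml jmoment_sum.
have phiZ c f : phi (c *: f) = c * phi f by rewrite /phi -scalerAl jmomentZ.
have phiL f : phi (jacobi_op a b f) = - jacobi_eigenvalue a b k * phi f.
  by rewrite /phi jacobi_op_sym // jacobi_op_jpolyR // -scalerAr jmomentZ.
have E n : phi (tr_pow a b n y) = phi (uhalf ^+ n) * (Rk k).[y].
  pose q := \sum_(j < n.+1) (tr_coef a b n j * phi (bernp n j)) *: bernp n j.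
  have qE z : phi (tr_pow a b n z) = q.[z].
    rewrite /tr_pow phi_sum /q horner_sum; apply: eq_bigr => j _.
    by rewrite phiZ hornerZ; ring.
  have /(jpolyR_eigen a1 b1) q1 : jacobi_op a b q = - jacobi_eigenvalue a b k *: q.
    rewrite /q jacobi_op_exchange // scaler_sumr; apply: eq_bigr => j _.
    by rewrite phiL scalerA; congr (_ *: _); ring.
  rewrite qE q1 hornerZ -qE; congr (phi _ * _).
  have := poly_tr1 (uhalf ^+ n); rewrite /poly_tr /uhalf_coefs.
  rewrite -comp_Xn_poly -comp_polyA [uhalf \Po _](_ : _ = 'X) ?comp_polyXr ?lin_extXn //.
  rewrite /uhalf -polyC1 comp_polyM comp_polyD !comp_polyC comp_polyX.
  rewrite (_ : 1%:P + ('X *+ 2 - 1%:P) = 2%:P * 'X); last by rewrite polyC_natr; ring.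
  rewrite mulrA -polyCM (_ : 1 / 2 * 2 = 1) ?mul1r //.
  by field.
have phiG : phi G = \sum_(n < size G) (uhalf_coefs G)`_n * phi (uhalf ^+ n).
  rewrite -[in LHS](uhalf_coefsK G) -[in LHS](coefK (uhalf_coefs G)) poly_def raddf_sum.
  rewrite phi_sum size_uhalf_coefs; apply: eq_bigr => n _ /=.
  by rewrite comp_polyZ comp_Xn_poly phiZ.
rewrite -/(phi _) -/(phi G) phiG poly_trE phi_sum mulr_suml.
by apply: eq_bigr => n _; rewrite phiZ E mulrA.
Qed.

Lemma uhalf_coefs_ge0 G z : (forall t, I t -> 0 <= G.[t]) -> 0 <= z <= 1 ->
  0 <= (uhalf_coefs G).[z].
Proof.
move=> G0 /andP[z0 z1]; rewrite /uhalf_coefs horner_comp; apply: G0.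
by rewrite hornerD hornerMn hornerX hornerN horner_one /= in_itv /= mulr2n; lra.
Qed.

Lemma beta_expect_sum (al ga : R) J (r : seq J) (F : J -> {poly R}) :
  beta_expect al ga (\sum_(j <- r) F j) = \sum_(j <- r) beta_expect al ga (F j).
Proof. by rewrite /beta_expect linear_sum. Qed.

Lemma beta_expectZ (al ga c : R) f : beta_expect al ga (c *: f) = c * beta_expect al ga f.
Proof. by rewrite /beta_expect linearZ. Qed.

(** Two Beta expectations undo the coefficients of the translation: the first has parameters
[b + 1 <= a + 1], the second [1/2 <= b + 1].  What remains is the mean of two
values of [G] at points with coordinate [A + u B +- 2 c sqrt(A u B)]; as
[sqrt A + sqrt B <= 1], these lie between [0] and [1]. *)
Lemma poly_tr_ge0 x y G : I x -> I y -> (forall z, I z -> 0 <= G.[z]) ->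
  0 <= (poly_tr y G).[x].
Proof.
rewrite /= !in_itv /= => /andP[x0 x1] /andP[y0 y1] G0.
pose X := (1 + x) / 2; pose Y := (1 + y) / 2.
have X01 : 0 <= X <= 1 by rewrite /X; lra.
have Y01 : 0 <= Y <= 1 by rewrite /Y; lra.
have [X0 X1] := andP X01; have [Y0 Y1] := andP Y01.
pose A := X * Y; pose B := (1 - X) * (1 - Y).
have A0 : 0 <= A by exact: mulr_ge0.
have B0 : 0 <= B by apply: mulr_ge0; rewrite subr_ge0.
(* The kernel is first averaged over u, with X, Y the coordinates of x, y. *)
pose be := b + 1.
have be0 : 0 < be by rewrite /be; have := b1; lra.
have a10 : 0 < a + 1 by have := a1; lra.
pose g n := (uhalf_coefs G)`_n.
pose cf n j : R := 'C(n, j)%:R * (poch be n / (poch be j * poch be (n - j))).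
pose K : {poly R} := \sum_(n < size G) g n *:
  \sum_(j < n.+1) (cf n j * (A ^+ j * B ^+ (n - j))) *: 'X^(n - j).
have trK : (poly_tr y G).[x] = beta_expect be (a + 1) K.
  rewrite poly_trE horner_sum beta_expect_sum; apply: eq_bigr => n _.
  rewrite hornerZ beta_expectZ horner_tr_pow beta_expect_sum; congr (_ * _).
  apply: eq_bigr => j _; rewrite beta_expectZ /beta_expect lin_extXn.
  rewrite /bernp !hornerM !horner_exp !horner_uhalf !horner_dhalf.
  have -> : (1 - x) / 2 = 1 - X by rewrite /X; field.
  have -> : (1 - y) / 2 = 1 - Y by rewrite /Y; field.
  rewrite -/X -/Y /A /B !exprMn /tr_coef /cf -/be.
  have := poch_neq0 j be0; have := poch_neq0 (n - j) be0; have := poch_neq0 (n - j) a10.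
  move: (poch _ _) (poch _ _) (poch _ _) (poch _ _) => p1 p2 p3 p4 h1 h2 h3.
  by field; rewrite h1 h2 h3.
rewrite trK; apply: beta_expect_ge0 => //; first by rewrite /be lerD2r.
move=> u /andP[u0 u1].
pose S := A + u * B; pose D := 4 * (A * (u * B)).
pose H : {poly R} := \sum_(n < size G) g n *:
  \sum_(l < n.+1) ('C(n, 2 * l)%:R * S ^+ (n - 2 * l) * D ^+ l) *: 'X^l.
have KH : K.[u] = beta_expect (1 / 2) be H.
  rewrite /K /H horner_sum beta_expect_sum; apply: eq_bigr => n _.
  rewrite hornerZ beta_expectZ horner_sum beta_expect_sum; congr (_ * _).
  under [RHS]eq_bigr => l _ do rewrite beta_expectZ /beta_expect lin_extXn.
  rewrite gegenbauer_average //; apply: eq_bigr => j _.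
  by rewrite hornerZ hornerXn [(u * B) ^+ _]exprMn /cf; ring.
rewrite KH; apply: beta_expect_ge0 => //; first by rewrite /be; have := hb; lra.
move=> d /andP[d0 d1].
pose p := Num.sqrt A; pose q := Num.sqrt (u * B); pose c := Num.sqrt d.
have uB0 : 0 <= u * B by exact: mulr_ge0.
have p0 : 0 <= p by exact: sqrtr_ge0.
have q0 : 0 <= q by exact: sqrtr_ge0.
have c0 : 0 <= c by exact: sqrtr_ge0.
have pA : p ^+ 2 = A by exact: sqr_sqrtr.
have qB : q ^+ 2 = u * B by exact: sqr_sqrtr.
have cd : c ^+ 2 = d by exact: sqr_sqrtr.
have c1 : c <= 1 by rewrite -(@ler_sqr _ c 1) ?nnegrE // cd expr1n.
(* The even part of (S + E)^n is the average over the sign of c. *)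
pose E := 2 * p * q * c.
have ED : E ^+ 2 = D * d by rewrite /E /D -pA -qB -cd; ring.
have HE : H.[d] = ((uhalf_coefs G).[S + E] + (uhalf_coefs G).[S - E]) / 2.
  rewrite (horner_coef _ (S + E)) (horner_coef _ (S - E)) size_uhalf_coefs -big_split mulr_suml /= /H horner_sum.
  apply: eq_bigr => n _; rewrite -mulrDr -mulrA even_part_expr hornerZ horner_sum.
  by congr (_ * _); apply: eq_bigr => l _; rewrite hornerZ hornerXn ED [(D * d) ^+ _]exprMn mulrA.
have pq1 : p + q <= 1.
  have hp : p <= (X + Y) / 2.
    rewrite -(@ler_sqr _ p) ?nnegrE ?pA //; last by lra.
    by have := sqr_ge0 (X - Y); rewrite /A; lra.
  have hq : q <= ((1 - X) + (1 - Y)) / 2.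
    rewrite -(@ler_sqr _ q) ?nnegrE ?qB //; last by lra.
    have uB : u * B <= B by rewrite ler_piMl.
    by apply: (le_trans uB); have := sqr_ge0 (X - Y); rewrite /B; lra.
  by lra.
have pq0 : 0 <= p * q by exact: mulr_ge0.
have E0 : 0 <= E by rewrite /E !mulr_ge0.
have E1 : E <= 2 * (p * q).
  by rewrite /E -!mulrA ler_pM2l // mulrA ler_piMr.
have SE0 : 0 <= S - E.
  by rewrite /S -pA -qB; have := sqr_ge0 (p - q); lra.
have SE1 : S + E <= 1.
  have : (p + q) ^+ 2 <= 1 by rewrite -[leRHS](expr1n _ 2) ler_sqr ?nnegrE // addr_ge0.
  by rewrite /S -pA -qB; lra.
rewrite HE divr_ge0 // addr_ge0 //; apply: uhalf_coefs_ge0 => //; lra.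
Qed.

End Translation.

(** * Weierstrass approximation on [-1, 1] *)

Section Weierstrass.
Context {R : realType}.
Local Notation I := (`[(-1 : R)%R, (1 : R)%R]%classic).
Implicit Types (phi psi : nat -> R) (t : R).

(** The expectation of [phi k] for [k] the number of successes in [n] trials of probability [t],
by conditioning on one trial. *)
Fixpoint bern_poly n phi : {poly R} :=
  if n is m.+1 then
    (1 - 'X) * bern_poly m phi + 'X * bern_poly m (fun k => phi k.+1)
  else (phi 0%N)%:P.

Lemma bern_polyS n phi t : (bern_poly n.+1 phi).[t] =
  (1 - t) * (bern_poly n phi).[t] + t * (bern_poly n (fun k => phi k.+1)).[t].
Proof. by rewrite /= !horner_ringE. Qed.

Lemma bern_poly_le n phi psi t : 0 <= t <= 1 ->
  (forall k, (k <= n)%N -> phi k <= psi k) ->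
  (bern_poly n phi).[t] <= (bern_poly n psi).[t].
Proof.
move=> /andP[t0 t1]; elim: n phi psi => [|n IH] phi psi h; first by rewrite !hornerC h.
rewrite !bern_polyS lerD // ler_wpM2l ?subr_ge0 //; apply: IH => k kn; apply: h => //.
exact: leqW.
Qed.

Lemma bern_poly_affine n phi (c d : R) t :
  (bern_poly n (fun k => c + d * phi k)).[t] = c + d * (bern_poly n phi).[t].
Proof.
elim: n phi => [|n IH] phi; first by rewrite !hornerC.
rewrite !bern_polyS IH (IH (fun k => phi k.+1)); ring.
Qed.

Lemma bern_poly_variance n z t :
  (bern_poly n (fun k => (k%:R - z) ^+ 2)).[t] = n%:R * t * (1 - t) + (n%:R * t - z) ^+ 2.
Proof.
elim: n z => [|n IH] z; first by rewrite hornerC; ring.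
rewrite bern_polyS IH.
have -> : (fun k => (k.+1%:R - z) ^+ 2) = (fun k => (k%:R - (z - 1)) ^+ 2).
  by apply/funext => k; rewrite -natr1; ring.
by rewrite IH -natr1; ring.
Qed.

Lemma within_continuous_bounded (g : R -> R) : {within I, continuous g} ->
  exists M : R, 0 <= M /\ forall x, I x -> `|g x| <= M.
Proof.
move=> cg; have I0 : (-1 : R) <= 1 by lra.
have cng : {within I, continuous (fun x => - g x)}.
  by move=> x; apply: continuousN; exact: cg.
have [c1 _ h1] := EVT_max I0 cg; have [c2 _ h2] := EVT_max I0 cng.
exists (`|g c1| + `|g c2|); split; first by rewrite addr_ge0.
move=> x Ix; rewrite ler_norml; apply/andP; split.
  have := h2 x Ix; have := ler_norm (- g c2); rewrite normrN.
  have := normr_ge0 (g c1); lra.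
have := h1 x Ix; have := ler_norm (g c1); have := normr_ge0 (g c2); lra.
Qed.

(** The form of uniform continuity that matches the variance in Bernstein's proof. *)
Lemma quadratic_modulus (g : R -> R) (e : R) : {within I, continuous g} -> 0 < e ->
  exists N : nat, forall s t, I s -> I t -> `|g s - g t| <= e + N%:R * (s - t) ^+ 2.
Proof.
move=> cg e0; have [M [M0 gM]] := within_continuous_bounded cg.
pose P (N : nat) (s : R) := I s -> forall t, I t -> `|g s - g t| <= e + N%:R * (s - t) ^+ 2.
suff [N _ hN] : \forall N \near \oo, I `<=` P N.
  by exists N => s t Is It; exact: (hN N (leqnn _) s Is Is t It).
have /compact_near_coveringP := @segment_compact R (-1) 1.
apply => x Ix.
have gx : g y @[y --> within I (nbhs x)] --> g x.
  by move/subspace_continuousP : cg; apply.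
have e20 : 0 < e / 2 by rewrite divr_gt0.
have /cvgrPdist_lt /(_ _ e20) := gx.
rewrite near_withinE => /nbhs_ballP[d /= d0 hd].
have [N0 hN0] : exists N0 : nat, 8 * M / d ^+ 2 <= N0%:R.
  exists (Num.truncn (8 * M / d ^+ 2)).+1; exact/ltW/truncnS_gt.
exists (ball x (d / 2), [set n | (N0 <= n)%N]).
  split => /=; first by apply: nbhsx_ballx; rewrite divr_gt0.
  by exists N0.
move=> [s n] /= [bs nN0] Is t It.
have dist s' : I s' -> `|x - s'| < d -> `|g x - g s'| < e / 2 by move=> Is' h; exact: hd.
have n0 : 0 <= n%:R * (s - t) ^+ 2 :> R by rewrite mulr_ge0 ?sqr_ge0.
have xs : `|x - s| < d / 2 by exact: bs.
have [xt|xt] := ltP `|x - t| d.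
  have h1 := dist t It xt.
  have h2 : `|g x - g s| < e / 2 by apply: dist => //; move: d0; lra.
  have : `|g s - g t| <= `|g x - g s| + `|g x - g t|.
    by rewrite (distrC (g x)) -[g s - g t](subrKA (g x)) ler_normD.
  lra.
have st : d / 2 <= `|s - t|.
  have : `|x - t| <= `|x - s| + `|s - t| by rewrite -[x - t](subrKA s) ler_normD.
  lra.
have gst : `|g s - g t| <= 2 * M.
  by have := ler_normB (g s) (g t); have := gM s Is; have := gM t It; lra.
apply: (le_trans gst).
have h3 : (d / 2) ^+ 2 <= (s - t) ^+ 2.
  by rewrite -[leRHS]real_normK ?num_real // ler_sqr ?nnegrE // ?divr_ge0 // ltW.
have h4 : 8 * M <= n%:R * d ^+ 2.
  rewrite -ler_pdivrMr ?exprn_gt0 // (le_trans hN0) // ler_nat.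
  exact: nN0.
have h5 : n%:R * (d / 2) ^+ 2 <= n%:R * (s - t) ^+ 2 :> R by rewrite ler_wpM2l.
move: h5; rewrite (_ : n%:R * (d / 2) ^+ 2 = n%:R * d ^+ 2 / 4); last by field.
lra.
Qed.

Theorem weierstrass (g : R -> R) (e : R) : {within I, continuous g} -> 0 < e ->
  exists P : {poly R}, forall x, I x -> `|g x - P.[x]| <= e.
Proof.
move=> cg e0; have e20 : 0 < e / 2 by rewrite divr_gt0.
have [N hN] := quadratic_modulus cg e20.
have [n n0 hn] : exists2 n : nat, (0 < n)%N & N%:R / n%:R <= e / 2 :> R.
  exists (Num.truncn (N%:R / (e / 2))).+1 => //.
  rewrite ler_pdivrMr ?ltr0n // mulrC -ler_pdivrMr //.
  exact/ltW/truncnS_gt.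
have n0' : (0 : R) < n%:R by rewrite ltr0n.
pose phi k := g (2 * (k%:R / n%:R) - 1).
exists (bern_poly n phi \Po uhalf) => x Ix.
rewrite horner_comp horner_uhalf; set t := (1 + x) / 2.
have [x0 x1] : -1 <= x /\ x <= 1 by move: Ix; rewrite /= in_itv /= => /andP.
have t01 : 0 <= t <= 1 by rewrite /t; lra.
have xt : x = 2 * t - 1 by rewrite /t; field.
pose q k : R := (k%:R - n%:R * t) ^+ 2.
pose C : R := 4 * N%:R / n%:R ^+ 2.
have hk k : (k <= n)%N -> `|phi k - g x| <= e / 2 + C * q k.
  move=> kn; have Ik : I (2 * (k%:R / n%:R) - 1).
    have k0 : 0 <= k%:R / n%:R :> R by rewrite divr_ge0.
    have k1 : k%:R / n%:R <= 1 :> R by rewrite ler_pdivrMr // mul1r ler_nat.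
    by rewrite /= in_itv /=; apply/andP; split; lra.
  apply: (le_trans (hN _ _ Ik Ix)); rewrite lerD2l le_eqVlt; apply/orP; left; apply/eqP.
  by rewrite /C /q xt; field; rewrite gt_eqF.
have V : (bern_poly n q).[t] = n%:R * t * (1 - t).
  by rewrite /q bern_poly_variance subrr expr0n addr0.
have Cq : C * (bern_poly n q).[t] <= e / 2.
  rewrite V; apply: le_trans hn.
  have -> : C * (n%:R * t * (1 - t)) = N%:R / n%:R * (4 * (t * (1 - t))).
    by rewrite /C; field; rewrite gt_eqF.
  rewrite ler_piMr ?divr_ge0 //.
  by have := sqr_ge0 (2 * t - 1); lra.
have up : (bern_poly n phi).[t] <= (g x + e / 2) + C * (bern_poly n q).[t].
  rewrite -bern_poly_affine; apply: bern_poly_le => // k kn.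
  by have := hk k kn; rewrite ler_norml => /andP[]; lra.
have lo : (g x - e / 2) + (- C) * (bern_poly n q).[t] <= (bern_poly n phi).[t].
  rewrite -bern_poly_affine; apply: bern_poly_le => // k kn.
  by have := hk k kn; rewrite ler_norml => /andP[]; lra.
by rewrite ler_norml; apply/andP; split; lra.
Qed.

End Weierstrass.

(** * The weighted spaces *)

Section WeightedSpaces.
Context {R : realType}.
Variables a b : R.
Hypothesis a1 : -1 < a.
Hypothesis b1 : -1 < b.
Variable p : \bar R.
Hypothesis p1 : (1 <= p)%E.
Local Notation mu := (@lebesgue_measure R).
Local Notation I := (`[(-1 : R)%R, (1 : R)%R]%classic).
Local Notation w := (jacobi_weight a b).
Local Notation N := (wnorm a b p).
Local Notation X := (Lw a b p).
Implicit Types (f g : R -> R) (q c : R).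

Lemma Lw_measurable f : X f -> measurable_fun I f.
Proof.
case: p p1 => [q _ []//|_ /= cf|//].
by apply: subspace_continuous_measurable_fun => //; exact: measurable_I11.
Qed.

Lemma wnorm_ge0 f : (0 <= N f)%E.
Proof.
case: p p1 => [q _|_|//]; first exact: poweR_ge0.
apply: (@le_trans _ _ (`|f 0|)%:E); first by rewrite lee_fin.
by apply: ereal_sup_ubound; exists 0 => //; rewrite /= in_itv /=; apply/andP; split; lra.
Qed.

Lemma wnorm_lty f : X f -> (N f < +oo)%E.
Proof.
case: p p1 => [q _ []//|_ /= cf|//].
have [M [_ hM]] := within_continuous_bounded cf.
apply: (@le_lt_trans _ _ M%:E); last by rewrite ltry.
by apply: ge_ereal_sup => _ [x Ix <-]; rewrite lee_fin hM.
Qed.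

Lemma eq_wnorm f g : (forall x, I x -> f x = g x) -> N f = N g.
Proof.
move=> fg; case: p => [q||//] /=.
  have -> // : (\int[mu]_(x in I) (`|f x| `^ q * w x)%:E =
                \int[mu]_(x in I) (`|g x| `^ q * w x)%:E)%E.
  by apply: eq_integral_on => x Ix; rewrite fg.
congr ereal_sup; apply/seteqP; split=> _ [x Ix <-]; exists x => //; by rewrite fg.
Qed.

Lemma wnorm_Rle q f c : 0 < q -> 0 <= c ->
  (wnorm a b q%:E f <= c%:E)%E <->
  (\int[mu]_(x in I) (`|f x| `^ q * w x)%:E <= (c `^ q)%:E)%E.
Proof.
move=> q0 c0; rewrite /wnorm; set J := (\int[mu]_(x in I) _)%E.
have J0 : (0 <= J)%E.
  by apply: integral_ge0 => x _; rewrite lee_fin mulr_ge0 ?powR_ge0 // jacobi_weight_ge0.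
have qi : 0 <= q^-1 by rewrite invr_ge0 ltW.
split => h.
- have -> : J = ((J `^ q^-1) `^ q)%E by rewrite -poweRrM mulVf ?gt_eqF // poweRe1.
  rewrite -poweR_EFin; apply: gt0_ler_poweR => //; first exact: ltW.
  + by rewrite in_itv /= poweR_ge0 leey.
  + by rewrite in_itv /= lee_fin c0 leey.
- have -> : c%:E = ((c `^ q)%:E `^ q^-1)%E.
    by rewrite poweR_EFin -powRrM mulfV ?gt_eqF // powRr1.
  apply: gt0_ler_poweR => //; rewrite in_itv /= ?J0 ?leey //.
  by rewrite lee_fin powR_ge0.
Qed.

Lemma ge1_gt0 q : (1 <= q%:E)%E -> 0 < q.
Proof. by rewrite lee_fin; apply: lt_le_trans. Qed.

(** [f |-> f w^(1/q)] embeds [L_{w,q}] isometrically in the unweighted space, where Minkowski's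
inequality is known. *)
Definition weight_lift q f := (fun x => f x * w x `^ q^-1) \_ I.

Lemma weight_lift_measurable q f : measurable_fun I f ->
  measurable_fun [set: R] (weight_lift q f).
Proof.
move=> mf; apply/(measurable_restrictT _ (@measurable_I11 R)); apply: measurable_funM => //.
apply: measurable_funTS.
by apply: (measurableT_comp (measurable_powR q^-1)); exact: measurable_jacobi_weight.
Qed.

Lemma wnorm_lift q f : 0 < q ->
  wnorm a b q%:E f = ('N[mu]_q%:E[EFin \o weight_lift q f])%E.
Proof.
move=> q0; rewrite unlock /Lnorm /wnorm; congr (_ `^ _)%E.
transitivity (\int[mu]_x (((fun x => (`|f x| `^ q * w x)%:E) \_ I) x))%E.
  exact: integral_mkcond.
apply: eq_integral_on => x _ /=.
rewrite /weight_lift /patch; case: ifPn => xI.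
  rewrite normrM powRM // (ger0_norm (powR_ge0 (w x) q^-1)).
  by rewrite -powRrM mulVf ?gt_eqF // powRr1 ?jacobi_weight_ge0.
by rewrite normr0 powR0 // gt_eqF.
Qed.

Lemma wnorm_triangle f g : X f -> X g ->
  (N (fun x => f x + g x)%R <= N f + N g)%E.
Proof.
move=> Xf Xg; have mf := Lw_measurable Xf; have mg := Lw_measurable Xg.
move: Xf Xg; case: p p1 => [q q1 Xf Xg|_ Xf Xg|//].
- have q0 := ge1_gt0 q1.
  rewrite !wnorm_lift //.
  have -> : EFin \o weight_lift q (fun x => f x + g x)
          = EFin \o (weight_lift q f \+ weight_lift q g)%R.
    apply/funext => x /=; rewrite /weight_lift !patchE; case: ifPn => _.
      by rewrite mulrDl.
    by rewrite addr0.
  by apply: minkowski_EFin; rewrite -?lee_fin //; exact: weight_lift_measurable.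
- apply: ge_ereal_sup => _ [x Ix <-].
  apply: (@le_trans _ _ (`|f x|%:E + `|g x|%:E)%E).
    by rewrite -EFinD lee_fin ler_normD.
  by apply: leeD; apply: ereal_sup_ubound; exists x.
Qed.

Lemma wnorm_scale f c : X f -> (N (fun x => c * f x)%R = `|c|%:E * N f)%E.
Proof.
move=> Xf; have mf := Lw_measurable Xf.
move: Xf; case: p p1 => [q q1 Xf|_ Xf|//].
- have q0 := ge1_gt0 q1.
  rewrite /wnorm; set J := (\int[mu]_(x in I) (`|f x| `^ q * w x)%:E)%E.
  have J0 : (0 <= J)%E.
    by apply: integral_ge0 => x _; rewrite lee_fin mulr_ge0 ?powR_ge0 // jacobi_weight_ge0.
  have -> : (\int[mu]_(x in I) (`|c * f x| `^ q * w x)%:E = (`|c| `^ q)%:E * J)%E.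
    rewrite -ge0_integralZl_EFin ?powR_ge0 //.
    - by apply: eq_integral_on => x _; rewrite normrM powRM // -mulrA EFinM.
    - by move=> x _; rewrite lee_fin mulr_ge0 ?powR_ge0 // jacobi_weight_ge0.
    - apply/measurable_EFinP; apply: mul_weight_measurable => //.
      apply: (measurableT_comp (measurable_powR q)).
      exact: measurableT_comp.
  rewrite poweRM ?lee_fin ?powR_ge0 // poweR_EFin -powRrM mulfV ?gt_eqF // powRr1 //.
- rewrite /wnorm.
  have E : [set `|c * f x|%:E | x in I] = [set (`|c|%:E * y)%E | y in [set `|f x|%:E | x in I]].
    apply/seteqP; split=> [_ [x Ix <-]|_ [_ [x Ix <-] <-]].
      by exists `|f x|%:E; [exists x|rewrite normrM].
    by exists x => //; rewrite normrM.
  rewrite E; have [->|c0] := eqVneq c 0.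
    rewrite normr0 mul0e; apply/eqP; rewrite eq_le; apply/andP; split.
      by apply: ge_ereal_sup => _ [y _ <-]; rewrite mul0e.
    apply: ereal_sup_ubound; exists `|f 0|%:E; last by rewrite mul0e.
    by exists 0 => //; rewrite /= in_itv /=; apply/andP; split; lra.
  by rewrite ereal_sup_pZl // normr_gt0.
Qed.

Lemma Lw_add f g : X f -> X g -> X (fun x => f x + g x).
Proof.
move=> Xf Xg; have := wnorm_triangle Xf Xg; have := wnorm_lty Xf; have := wnorm_lty Xg.
move: Xf Xg; case: p p1 => [q _ [mf _] [mg _] hg hf h|_ cf cg _ _ _ x|//].
- split; first exact: measurable_funD.
  exact: (le_lt_trans h (lte_add_pinfty hf hg)).
- by apply: continuousD; [exact: cf | exact: cg].
Qed.

Lemma Lw_scale c f : X f -> X (fun x => c * f x).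
Proof.
move=> Xf; have := wnorm_scale c Xf; have := wnorm_lty Xf; have := wnorm_ge0 f.
move: Xf; case: p p1 => [q _ [mf _] h0 h h'|_ cf _ _ _ x|//].
- split; first by apply: measurable_funM.
  by rewrite h' lte_mul_pinfty.
- by apply: continuousM; [exact: cvg_cst|exact: cf].
Qed.

Lemma Lw_bounded f (M : R) : measurable_fun I f ->
  (p = +oo%E -> {within I, continuous f}) ->
  (forall x, I x -> `|f x| <= M) -> X f.
Proof.
move=> mf cf fM; move: cf; case: p p1 => [q q1 _|_ cf|//]; last exact: cf.
have q0 := ge1_gt0 q1.
split => //; rewrite /wnorm; apply: poweR_lty.
have mf' : measurable_fun I (fun x => `|f x| `^ q).
  apply: (measurableT_comp (measurable_powR q)); exact: measurableT_comp.
have /integrableP[_] : mu.-integrable I (EFin \o (fun x => `|f x| `^ q * w x)).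
  apply: (@bounded_weight_integrable _ a b a1 b1 _ (M `^ q)) => // x Ix.
  rewrite ger0_norm ?powR_ge0 //; apply: ge0_ler_powR; rewrite ?nnegrE ?fM //.
  - exact: ltW.
  - exact: le_trans (normr_ge0 _) (fM _ Ix).
by under eq_integral do rewrite /= ger0_norm ?mulr_ge0 ?powR_ge0 ?jacobi_weight_ge0 //.
Qed.

Lemma Lw_poly (P : {poly R}) : X (horner P).
Proof.
have [M [_ hM]] := poly_bounded P.
apply: (@Lw_bounded _ M) => //; first exact: measurable_horner.
by move=> _; apply: continuous_subspaceT; exact: continuous_horner.
Qed.

End WeightedSpaces.

(** * Almost everywhere approximation of bounded functions by polynomials *)

Section BoundedApproximation.
Context {R : realType}.
Local Notation mu := (@lebesgue_measure R).
Local Notation I := (`[(-1 : R)%R, (1 : R)%R]%classic).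

Lemma lipschitz_continuous (F : R -> R) (m : R) :
  (forall u v, `|F u - F v| <= m * `|u - v|) -> continuous F.
Proof.
move=> lip x; apply/cvgrPdist_le => e e0.
have m1 : 0 < `|m| + 1 by have := normr_ge0 m; lra.
near=> y; apply: (le_trans (lip x y)).
have hy : `|x - y| <= e / (`|m| + 1).
  near: y; exists (e / (`|m| + 1)); first exact: divr_gt0.
  by move=> z /= /ltW.
apply: (@le_trans _ _ ((`|m| + 1) * `|x - y|)).
  by rewrite ler_wpM2r //; have := ler_norm m; lra.
by rewrite -ler_pdivlMl // mulrC.
Unshelve. all: by end_near.
Qed.

(** By Lebesgue differentiation the difference quotients [(F(x + 1/n) - F(x)) n] of the
primitive [F] of [f] converge to [f] almost everywhere.  They are continuous and bounded by
[m], so the Weierstrass theorem applies to each. *)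
Lemma bounded_poly_approx (f : R -> R) (m : R) : measurable_fun I f ->
  (forall x, I x -> `|f x| <= m) ->
  exists P : nat -> {poly R},
    (forall n x, I x -> `|(P n).[x]| <= m + 1) /\
    {ae mu, forall x, I x -> (P n).[x] @[n --> \oo] --> f x}.
Proof.
move=> mf fm.
have m0 : 0 <= m.
  apply: le_trans (normr_ge0 _) (fm 0 _); rewrite /= in_itv /=; apply/andP; split; lra.
pose g := f \_ I.
have gm x : `|g x| <= m.
  rewrite /g /patch; case: ifPn => [xI|_]; last by rewrite normr0.
  by apply: fm; exact: set_mem.
have mg : measurable_fun [set: R] g by apply/(measurable_restrictT _ (@measurable_I11 R)).
have fI : mu.-integrable I (EFin \o f).
  apply: measurable_bounded_integrable => //.
    change (mu I < +oo)%E; rewrite lebesgue_measure_itv /= lte_fin.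
    by case: ifPn => _; rewrite -?EFinB ltry.
  exists m; split; first exact: num_real.
  by move=> r mr x Ix; apply: le_trans (fm x Ix) (ltW mr).
have gT : mu.-integrable [set: R] (EFin \o g).
  have -> : EFin \o g = (EFin \o f) \_ I by rewrite -restrict_EFin.
  exact: (@integrable_mkcond _ (measurableTypeR R) R mu I (EFin \o f) (@measurable_I11 R)).1 fI.
pose F (y : R) := (\int[mu]_(t in [set` `]-oo, y]]) (g t))%R.
have gS (D : set R) : measurable D -> mu.-integrable D (EFin \o g).
  by move=> mD; apply: integrableS gT.
have lipF u v : `|F u - F v| <= m * `|u - v|.
  wlog uv : u v / v <= u => [H|].
    have [/H//|/ltW /H] := leP v u; by rewrite distrC (distrC u).
  rewrite /F (@Rintegral_itvB _ g -oo%O (BRight u) v); [|exact: gS|by []|by rewrite bnd_simp].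
  apply: (le_trans (le_normr_Rintegral _ _)); [exact: measurable_itv|exact: gS|].
  have cI : mu.-integrable [set` `]v, u]] (EFin \o (fun=> m)).
    apply: measurable_bounded_integrable => //.
      change (mu [set` `]v, u]] < +oo)%E; rewrite lebesgue_measure_itv /= lte_fin.
      by case: ifPn => _; rewrite -?EFinB ltry.
    exists `|m|; split; first exact: num_real.
    by move=> r mr x _; exact: ltW.
  apply: (@le_trans _ _ (\int[mu]_(t in [set` `]v, u]]) m)).
    apply: le_Rintegral => //.
      have := gS _ (@measurable_itv R `]v, u]); exact: integrable_abse.
  rewrite Rintegral_cst //= lebesgue_measure_itv /= lte_fin.
  case: ifPn => h /=; first by rewrite ger0_norm // subr_ge0.
  by rewrite mulr0 mulr_ge0.
pose G (n : nat) (x : R) := n.+1%:R * (F (x + n.+1%:R^-1) - F x).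
have cG n : {within I, continuous (G n)}.
  apply: continuous_subspaceT; apply: (@lipschitz_continuous _ (n.+1%:R * (m + m))) => u v.
  rewrite /G -mulrBr normrM ger0_norm // -mulrA ler_wpM2l //.
  have h1 := lipF (u + n.+1%:R^-1) (v + n.+1%:R^-1); have h2 := lipF u v.
  rewrite (_ : u + n.+1%:R^-1 - _ = u - v) in h1; last by ring.
  rewrite [X in `|X|](_ : _ =
    (F (u + n.+1%:R^-1) - F (v + n.+1%:R^-1)) - (F u - F v)); last by ring.
  by apply: (le_trans (ler_normB _ _)); lra.
have Gm n x : `|G n x| <= m.
  rewrite /G normrM ger0_norm //; apply: (le_trans (ler_wpM2l _ (lipF _ _))) => //.
  rewrite (_ : x + _ - x = n.+1%:R^-1); last by ring.
  by rewrite ger0_norm ?invr_ge0 // mulrCA mulfV ?mulr1 // pnatr_eq0.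
have i0 n : 0 < n.+1%:R^-1 :> R by rewrite invr_gt0 ltr0n.
have /choice[P hP] n := weierstrass (cG n) (i0 n).
exists P; split.
  move=> n x Ix; have := hP n x Ix; have := Gm n x.
  have : n.+1%:R^-1 <= 1 :> R by rewrite invf_le1 ?ler1n ?ltr0n.
  set z := _^-1 => z1 h1 h2.
  rewrite (_ : (P n).[x] = G n x - (G n x - (P n).[x])); last by ring.
  by apply: (le_trans (ler_normB _ _)); lra.
have := @FTC1Ny R g (fun y => gS _ (measurable_itv _)) (open_integrable_locally openT gT).
apply: filterS; first exact: (ae_filter_ringOfSetsType mu).
move=> x [dF F'g] Ix.
have GF : G n x @[n --> \oo] --> f x.
  have : h^-1 *: (F (h *: 1 + x) - F x) @[h --> 0^'] --> f x.
    have -> : f x = g x by rewrite /g /patch mem_set.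
    by rewrite -F'g derive1E; exact: dF.
  move=> /cvg_dnbhs_at_right /cvg_at_rightP /(_ (fun n => n.+1%:R^-1)) H.
  have /H : (forall n : nat, 0 < n.+1%:R^-1 :> R) /\ (n.+1%:R^-1 : R) @[n --> \oo] --> (0 : R).
    by split=> //; exact: cvg_harmonic.
  apply: cvg_trans; apply: near_eq_cvg; apply: nearW => n.
  rewrite /G invrK (_ : _%:A = n.+1%:R^-1); last exact: mulr1.
  by rewrite (addrC _ x).
have GP : (G n x - (P n).[x]) @[n --> \oo] --> (0 : R).
  apply: (@squeeze_cvgr _ _ _ _ (fun n => - n.+1%:R^-1) (fun n => n.+1%:R^-1)).
  - by apply: nearW => n; rewrite -ler_norml hP.
  - rewrite -oppr0; apply: cvgN; exact: cvg_harmonic.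
  - exact: cvg_harmonic.
have -> : (fun n => (P n).[x]) = (fun n => G n x - (G n x - (P n).[x])).
  by apply/funext => n; rewrite subKr.
by rewrite -[f x]subr0; exact: cvgB.
Qed.

End BoundedApproximation.

(** * Real-valued norms and the pairing with polynomials *)

Section NormedSpaces.
Context {R : realType}.
Variables a b : R.
Hypothesis a1 : -1 < a.
Hypothesis b1 : -1 < b.
Variable p : \bar R.
Hypothesis p1 : (1 <= p)%E.
Local Notation mu := (@lebesgue_measure R).
Local Notation I := (`[(-1 : R)%R, (1 : R)%R]%classic).
Local Notation w := (jacobi_weight a b).
Local Notation N := (wnorm a b p).
Local Notation X := (Lw a b p).
Implicit Types (f g : R -> R) (q c : R).

Lemma norm_mul3_le (u v z M : R) : `|v| <= M -> 0 <= z -> `|u * v * z| <= M * (`|u| * z).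
Proof.
move=> vM z0; rewrite !normrM (ger0_norm z0) mulrA ler_wpM2r // mulrC ler_wpM2r //.
Qed.

(** The norm as a real number; it is meaningful for elements of [L_{w,p}]. *)
Definition wnormr f : R := fine (N f).
Local Notation nr := wnormr.

Lemma wnormrE f : X f -> N f = (nr f)%:E.
Proof. by move=> Xf; rewrite fineK // ge0_fin_numE ?wnorm_ge0 ?wnorm_lty. Qed.

Lemma wnormr_ge0 f : 0 <= nr f.
Proof. by apply: fine_ge0; exact: wnorm_ge0. Qed.

Lemma wnormrP f c : X f -> (nr f <= c) = (N f <= c%:E)%E.
Proof. by move=> Xf; rewrite wnormrE // lee_fin. Qed.

Lemma eq_wnormr f g : (forall x, I x -> f x = g x) -> nr f = nr g.
Proof. by move=> fg; rewrite /wnormr (eq_wnorm a b p fg). Qed.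

Lemma wnormrD f g : X f -> X g -> nr (fun x => f x + g x) <= nr f + nr g.
Proof.
move=> Xf Xg; rewrite wnormrP; last exact: (Lw_add p1).
by rewrite EFinD -!wnormrE //; exact: wnorm_triangle.
Qed.

Lemma wnormrZ c f : X f -> nr (fun x => c * f x) = `|c| * nr f.
Proof. by move=> Xf; rewrite /wnormr wnorm_scale // wnormrE. Qed.

Lemma Lw_opp f : X f -> X (fun x => - f x).
Proof.
move=> Xf; have := Lw_scale p1 (-1) Xf; congr X.
by apply/funext => x; rewrite mulN1r.
Qed.

Lemma Lw_sub f g : X f -> X g -> X (fun x => f x - g x).
Proof. by move=> Xf Xg; apply: (Lw_add p1) => //; exact: Lw_opp. Qed.

Lemma wnormrN f : X f -> nr (fun x => - f x) = nr f.
Proof.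
move=> Xf; have := wnormrZ (-1) Xf; rewrite normrN1 mul1r => <-.
by apply: eq_wnormr => x _; rewrite mulN1r.
Qed.

Lemma wnormrB f g : X f -> X g -> nr (fun x => f x - g x) <= nr f + nr g.
Proof.
move=> Xf Xg; rewrite -(wnormrN Xg); apply: (@wnormrD f (fun x => - g x)) => //.
exact: Lw_opp.
Qed.

Lemma Lw_zero : X (fun=> 0).
Proof. by have := Lw_poly a1 b1 p1 0; congr X; apply/funext => x; rewrite horner0. Qed.

Lemma wnormr0 : nr (fun=> 0) = 0.
Proof.
have h := wnormrZ 0 Lw_zero; rewrite normr0 [RHS]mul0r in h; rewrite -[RHS]h.
by apply: eq_wnormr => x _; rewrite mulr0.
Qed.

Lemma wnormr_dist f g h : X f -> X g -> X h ->
  nr (fun x => f x - h x) <= nr (fun x => f x - g x) + nr (fun x => g x - h x).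
Proof.
move=> Xf Xg Xh; rewrite (@eq_wnormr _ (fun x => (f x - g x) + (g x - h x))).
  by apply: wnormrD; exact: Lw_sub.
by move=> x _; rewrite addrA subrK.
Qed.

Lemma le_1DpowR (x q : R) : 0 <= x -> 1 <= q -> x <= 1 + x `^ q.
Proof.
move=> x0 q1; have [x1|x1] := leP x 1.
  by apply: (le_trans x1); rewrite lerDl powR_ge0.
apply: (@le_trans _ _ (x `^ q)); last by rewrite lerDr.
by rewrite -{1}(powRr1 x0) ler_powR // ltW.
Qed.

Lemma weight_mass : (\int[mu]_(x in I) (w x)%:E)%E = (jmoment a b 1)%:E.
Proof.
rewrite /jmoment /Rintegral fineK.
  by apply: eq_integral_on => x _; rewrite hornerC mul1r.
have := integral_weight_lty a1 b1.
rewrite (@eq_integral_on _ _ _ (fun x => (1%:P.[x] * w x)%:E)); last first.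
  by move=> x _; rewrite hornerC mul1r.
move=> h; rewrite ge0_fin_numE //; apply: integral_ge0 => x _.
by rewrite lee_fin hornerC mul1r jacobi_weight_ge0.
Qed.

(** If [||f|| <= c] then [|f| / c <= 1 + (|f| / c)^q], which integrates to the mass of [w]
plus [1]. *)
Lemma Lw_L1_EFin f : X f ->
  (\int[mu]_(x in I) (`|f x| * w x)%:E <= ((jmoment a b 1 + 1) * nr f)%:E)%E.
Proof.
move=> Xf; have mf := Lw_measurable p1 Xf.
have w0 x : 0 <= w x by exact: jacobi_weight_ge0.
have W0 := jmoment1_gt0 a1 b1.
have mw : measurable_fun I w.
  by apply: measurable_funTS; exact: measurable_jacobi_weight.
have maf : measurable_fun I (fun x => `|f x|) by exact: measurableT_comp.
suff H c : 0 < c -> nr f <= c ->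
    (\int[mu]_(x in I) (`|f x| * w x)%:E <= ((jmoment a b 1 + 1) * c)%:E)%E.
  have n0 := wnormr_ge0 f.
  apply/lee_addgt0Pr => e e0.
  have E0 : 0 < e / (jmoment a b 1 + 1) by rewrite divr_gt0 // ltr_wpDr.
  apply: (le_trans (H (nr f + e / (jmoment a b 1 + 1)) _ _)); first by lra.
    by lra.
  rewrite -EFinD lee_fin mulrDr [_ * (e / _)]mulrC divfK //.
  by rewrite gt_eqF // ltr_wpDr.
move=> c0 fc; have ci : c^-1 * c = 1 by rewrite mulVf // gt_eqF.
suff : (\int[mu]_(x in I) (c^-1%:E * (`|f x| * w x)%:E) <= (jmoment a b 1 + 1)%:E)%E.
  rewrite ge0_integralZl_EFin.
  - rewrite muleC -lee_pdivlMr ?lte_fin ?invr_gt0 // => h; apply: (le_trans h).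
    by rewrite invrK EFinM.
  - exact: (@measurable_I11 R).
  - by move=> x _; rewrite lee_fin mulr_ge0.
  - by apply/measurable_EFinP; apply: mul_weight_measurable.
  - by rewrite invr_ge0 ltW.
move: Xf fc; rewrite /wnormr; case: p p1 => [q q1 Xf fc|_ Xf fc|//].
- have q0 := ge1_gt0 q1.
  have := wnorm_scale q1 c^-1 Xf => h.
  have : (wnorm a b q%:E (fun x => (c^-1 * f x)%R) <= 1%:E)%E.
    rewrite h (_ : wnorm a b q%:E f = (fine (wnorm a b q%:E f))%:E); last first.
      by rewrite fineK // ge0_fin_numE ?wnorm_ge0 ?wnorm_lty.
    rewrite -EFinM lee_fin ger0_norm ?invr_ge0 ?(ltW c0) // mulrC.
    by rewrite ler_pdivrMr // mul1r.
  move/(wnorm_Rle _ _ _ q0 ler01); rewrite powR1 => h1.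
  apply: (@le_trans _ _ (\int[mu]_(x in I) ((w x)%:E + (`|c^-1 * f x| `^ q * w x)%:E))%E).
    apply: ge0_le_integral; first exact: (@measurable_I11 R).
    - by move=> x _; rewrite -EFinM lee_fin mulr_ge0 ?invr_ge0 ?(ltW c0) // mulr_ge0.
    - apply: emeasurable_funM => //.
      by apply/measurable_EFinP; apply: mul_weight_measurable.
    - apply: emeasurable_funD; apply/measurable_EFinP => //.
      apply: mul_weight_measurable; apply: (measurableT_comp (measurable_powR q)).
      by apply: measurableT_comp => //; exact: measurable_funM.
    - move=> x _; rewrite -EFinM -EFinD lee_fin.
      have := le_1DpowR (normr_ge0 (c^-1 * f x)) q1.
      rewrite normrM (ger0_norm (x := c^-1)) ?invr_ge0 ?(ltW c0) // => h2.
      have := ler_wpM2r (w0 x) h2; rewrite mulrDl mul1r (mulrA c^-1 `|f x| (w x)); exact.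
  rewrite ge0_integralD.
  - rewrite EFinD; apply: leeD => //; by rewrite weight_mass.
  - exact: (@measurable_I11 R).
  - by move=> x _; rewrite lee_fin.
  - exact/measurable_EFinP.
  - by move=> x _; rewrite lee_fin mulr_ge0 // powR_ge0.
  - apply/measurable_EFinP; apply: mul_weight_measurable.
    apply: (measurableT_comp (measurable_powR q)).
    by apply: measurableT_comp => //; exact: measurable_funM.
- apply: (@le_trans _ _ (\int[mu]_(x in I) (w x)%:E)%E); last first.
    by rewrite weight_mass lee_fin lerDl.
  apply: ge0_le_integral; first exact: (@measurable_I11 R).
  - by move=> x _; rewrite -EFinM lee_fin mulr_ge0 ?invr_ge0 ?(ltW c0) // mulr_ge0.
  - apply: emeasurable_funM => //.
    by apply/measurable_EFinP; apply: mul_weight_measurable.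
  - exact/measurable_EFinP.
  - move=> x Ix; rewrite -EFinM lee_fin (mulrA c^-1 `|f x| (w x)) ler_piMl // mulrC ler_pdivrMr // mul1r.
    apply: le_trans fc; rewrite -lee_fin fineK.
      by apply: ereal_sup_ubound; exists x.
    by rewrite ge0_fin_numE; [exact: (@wnorm_lty _ a b +oo%E (leey _))|exact: (@wnorm_ge0 _ a b +oo%E (leey _))].
Qed.

Lemma Lw_weight_integrable f (P : {poly R}) : X f ->
  mu.-integrable I (EFin \o (fun x => f x * P.[x] * w x)).
Proof.
move=> Xf; have mf := Lw_measurable p1 Xf.
have [M [M0 hM]] := poly_bounded P.
have mfP : measurable_fun I (fun x => f x * P.[x]).
  by apply: measurable_funM => //; exact: measurable_horner.
apply/integrableP; split; first by apply/measurable_EFinP; exact: mul_weight_measurable.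
have maf : measurable_fun I (fun x => `|f x| * w x).
  by apply: mul_weight_measurable; exact: measurableT_comp.
apply: (@le_lt_trans _ _ (\int[mu]_(x in I) (M%:E * (`|f x| * w x)%:E))%E).
  apply: ge0_le_integral; first exact: (@measurable_I11 R).
  - by move=> x _; rewrite abse_ge0.
  - apply: measurableT_comp => //; apply/measurable_EFinP; exact: mul_weight_measurable.
  - by apply: emeasurable_funM => //; exact/measurable_EFinP.
  - move=> x Ix; rewrite -EFinM; change (`|f x * P.[x] * w x|%:E <= (M * (`|f x| * w x))%:E)%E.
    by rewrite lee_fin; apply: norm_mul3_le; [exact: hM|exact: jacobi_weight_ge0].
rewrite ge0_integralZl_EFin //.
- by rewrite lte_mul_pinfty ?lee_fin // (le_lt_trans (Lw_L1_EFin Xf)) // ltry.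
- by move=> x _; rewrite lee_fin mulr_ge0 // jacobi_weight_ge0.
- exact/measurable_EFinP.
Qed.

(** For [P = R_k] this is the [k]-th Jacobi coefficient. *)
Definition wpair f (P : {poly R}) : R := \int[mu]_(x in I) (f x * P.[x] * w x).

Lemma wpairDl f g P : X f -> X g ->
  wpair (fun x => f x + g x) P = wpair f P + wpair g P.
Proof.
move=> Xf Xg; rewrite /wpair -RintegralD; last 3 first.
- exact: (@measurable_I11 R).
- exact: Lw_weight_integrable.
- exact: Lw_weight_integrable.
by apply: eq_Rintegral => x _; rewrite !mulrDl.
Qed.

Lemma wpairZl c f P : X f -> wpair (fun x => c * f x) P = c * wpair f P.
Proof.
move=> Xf; rewrite /wpair -RintegralZl; last 2 first.
- exact: (@measurable_I11 R).
- exact: Lw_weight_integrable.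
by apply: eq_Rintegral => x _; rewrite -!mulrA.
Qed.

Lemma wpairBl f g P : X f -> X g ->
  wpair (fun x => f x - g x) P = wpair f P - wpair g P.
Proof.
move=> Xf Xg; rewrite -[- wpair g P]mulN1r -wpairZl // -wpairDl //; last exact: (Lw_scale p1).
by apply: eq_Rintegral => x _; rewrite mulN1r.
Qed.

Lemma wpairDr f P Q : X f -> wpair f (P + Q) = wpair f P + wpair f Q.
Proof.
move=> Xf; rewrite /wpair -RintegralD; last 3 first.
- exact: (@measurable_I11 R).
- exact: Lw_weight_integrable.
- exact: Lw_weight_integrable.
by apply: eq_Rintegral => x _; rewrite hornerD mulrDr mulrDl.
Qed.

Lemma wpairZr f c P : X f -> wpair f (c *: P) = c * wpair f P.
Proof.
move=> Xf; rewrite /wpair -RintegralZl; last 2 first.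
- exact: (@measurable_I11 R).
- exact: Lw_weight_integrable.
by apply: eq_Rintegral => x _; rewrite hornerZ; ring.
Qed.

Lemma wpair_bounded P : exists2 C : R, 0 <= C &
  forall f, X f -> `|wpair f P| <= C * nr f.
Proof.
have [M [M0 hM]] := poly_bounded P.
have W0 := jmoment1_gt0 a1 b1.
exists (M * (jmoment a b 1 + 1)) => [|f Xf].
  by rewrite mulr_ge0 // addr_ge0 // ltW.
have mf := Lw_measurable p1 Xf.
have maf : measurable_fun I (fun x => `|f x| * w x).
  by apply: mul_weight_measurable; exact: measurableT_comp.
have mfP : measurable_fun I (fun x => f x * P.[x]).
  by apply: measurable_funM => //; exact: measurable_horner.
have h := @le_normr_Rintegral _ (measurableTypeR R) R mu I _ (@measurable_I11 R) (Lw_weight_integrable P Xf).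
apply: (le_trans h).
rewrite -lee_fin /Rintegral fineK; last first.
  apply: integrable_fin_num; first exact: (@measurable_I11 R).
  exact: integrable_norm (Lw_weight_integrable P Xf).
apply: (@le_trans _ _ (\int[mu]_(x in I) (M%:E * (`|f x| * w x)%:E))%E).
  apply: ge0_le_integral; first exact: (@measurable_I11 R).
  - by move=> x _; rewrite lee_fin.
  - apply/measurable_EFinP; apply: measurableT_comp => //; exact: mul_weight_measurable.
  - by apply: emeasurable_funM => //; exact/measurable_EFinP.
  - move=> x Ix; rewrite -EFinM; change (`|f x * P.[x] * w x|%:E <= (M * (`|f x| * w x))%:E)%E.
    by rewrite lee_fin; apply: norm_mul3_le; [exact: hM|exact: jacobi_weight_ge0].
rewrite ge0_integralZl_EFin //.
- rewrite -mulrA EFinM; apply: lee_wpmul2l; first by rewrite lee_fin.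
  exact: Lw_L1_EFin.
- by move=> x _; rewrite lee_fin mulr_ge0 // jacobi_weight_ge0.
- exact/measurable_EFinP.
Qed.

Lemma jacobi_coefE k f : jacobi_coef a b k f = wpair f (jpolyR a b k).
Proof. by apply: eq_Rintegral => x _; rewrite jacobiRE. Qed.

Lemma wpair_poly P Q : wpair (horner P) Q = jmoment a b (P * Q).
Proof. by apply: eq_Rintegral => x _; rewrite hornerM. Qed.

End NormedSpaces.

(** * Jacobi coefficients determine the function *)

Section JacobiExpansion.
Context {R : realType}.
Variables a b : R.
Hypothesis a1 : -1 < a.
Hypothesis b1 : -1 < b.
Local Notation M := (jmoment a b).
Local Notation Rk := (jpolyR a b).

Definition jproj k (P : {poly R}) : R := M (P * Rk k) / M (Rk k * Rk k).

Lemma jmoment_jpolyR_neq0 k : M (Rk k * Rk k) != 0.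
Proof.
apply/eqP => h; have := jpolyR_neq0 a1 b1 k.
by rewrite (jmoment_sqr_eq0 a1 b1 h) eqxx.
Qed.

Lemma jmoment_jpolyR_orth j k : j != k -> M (Rk j * Rk k) = 0.
Proof.
rewrite neq_ltn => /orP[jk|kj].
  by apply: jpolyR_orth => //; rewrite size_jpolyR.
by rewrite mulrC; apply: jpolyR_orth => //; rewrite size_jpolyR.
Qed.

Lemma jmoment_jsum n (c : nat -> R) k :
  M ((\sum_(i < n) c i *: Rk i) * Rk k) =
  (if (k < n)%N then c k * M (Rk k * Rk k) else 0).
Proof.
rewrite mulr_suml jmoment_sum //.
under eq_bigr do rewrite -scalerAl jmomentZ //.
case: ifPn => kn.
  rewrite (bigD1 (Ordinal kn)) //= big1 ?addr0 // => i ik.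
  by rewrite jmoment_jpolyR_orth ?mulr0.
rewrite big1 // => i _; rewrite jmoment_jpolyR_orth ?mulr0 //.
by apply: contraNneq kn => <-.
Qed.

Lemma jacobi_expansion n (P : {poly R}) : (size P <= n)%N ->
  P = \sum_(i < n) jproj i P *: Rk i.
Proof.
move=> sP; apply/eqP; rewrite -subr_eq0; apply/eqP; apply: (jpolyR_orth_eq0 a1 b1) => k.
rewrite mulrBl jmomentB // (jmoment_jsum n (jproj^~ P) k); case: ifPn => kn.
  by rewrite /jproj divfK ?jmoment_jpolyR_neq0 // subrr.
by rewrite subr0 jpolyR_orth // (leq_trans sP) // leqNgt.
Qed.

End JacobiExpansion.

Section Uniqueness.
Context {R : realType}.
Variables a b : R.
Hypothesis a1 : -1 < a.
Hypothesis b1 : -1 < b.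
Variable p : \bar R.
Hypothesis p1 : (1 <= p)%E.
Local Notation mu := (@lebesgue_measure R).
Local Notation I := (`[(-1 : R)%R, (1 : R)%R]%classic).
Local Notation w := (jacobi_weight a b).
Local Notation X := (Lw a b p).
Local Notation nr := (wnormr a b p).
Implicit Types (f g d : R -> R).

Lemma wpair_sum f n (F : nat -> {poly R}) : X f ->
  wpair a b f (\sum_(i < n) F i) = \sum_(i < n) wpair a b f (F i).
Proof.
move=> Xf; elim: n => [|n IH]; last by rewrite !big_ord_recr /= (wpairDr a1 b1 p1) // IH.
rewrite !big_ord0; have := wpairZr a1 b1 p1 0 0 Xf; by rewrite scaler0 mul0r.
Qed.

Lemma wpair_eq0 d : X d -> (forall k, wpair a b d (jpolyR a b k) = 0) ->
  forall P, wpair a b d P = 0.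
Proof.
move=> Xd h P; rewrite (jacobi_expansion a1 b1 (leqnn (size P))).
rewrite (wpair_sum _ (fun i => jproj a b i P *: jpolyR a b i)) // big1 // => i _.
by rewrite (wpairZr a1 b1 p1) // h mulr0.
Qed.

(** Let [g] be [d] truncated to [-1, 1].  Polynomials converge boundedly to [g] almost
everywhere, so [d g w] has integral zero; it is nonnegative and vanishes only with [d]. *)
Lemma wpair_ae0 d : X d -> (forall P, wpair a b d P = 0) ->
  {ae mu, forall x, I x -> d x = 0}.
Proof.
move=> Xd h; have md := Lw_measurable p1 Xd.
have w0 x : 0 <= w x by exact: jacobi_weight_ge0.
pose g x := Num.max (-1) (Num.min (d x) 1).
have mg : measurable_fun I g.
  by apply: measurable_maxr => //; apply: measurable_minr.
have g1 x : I x -> `|g x| <= 1.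
  move=> _; rewrite ler_norml /g le_max lexx /= ge_max ge_min lexx orbT andbT; lra.
have dg0 x : 0 <= d x * g x.
  rewrite /g; have [d0|d0] := leP 0 (d x).
    apply: mulr_ge0 => //; rewrite le_max le_min d0 ler01; by rewrite orbT.
  apply: mulr_le0; first exact: ltW.
  rewrite ge_max ge_min (ltW d0) /=; lra.
have [P [Pb Pc]] := bounded_poly_approx mg g1.
have id : mu.-integrable I (EFin \o (fun x => `|d x| * w x)).
  have := Lw_weight_integrable a1 b1 p1 1 Xd => /integrable_norm.
  apply: eq_integrable; first exact: (@measurable_I11 R).
  by move=> x _ /=; rewrite hornerC mulr1 normrM (ger0_norm (w0 x)).
have [|||||_ _ cv] := @dominated_convergence _ (measurableTypeR R) R mu I (@measurable_I11 R)
  (fun n x => (d x * (P n).[x] * w x)%:E) (fun x => (d x * g x * w x)%:E)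
  (fun x => (2%:E * (`|d x| * w x)%:E)%E).
- by move=> n; have /measurable_int := Lw_weight_integrable a1 b1 p1 (P n) Xd.
- by apply/measurable_EFinP; apply: mul_weight_measurable; apply: measurable_funM.
- apply: filterS Pc; first exact: (ae_filter_ringOfSetsType mu).
  move=> x Pc Ix; apply: cvg_EFin; first exact: nearW.
  by apply: cvgM; [apply: cvgM; [exact: cvg_cst|exact: Pc]|exact: cvg_cst].
- exact: integrableZl.
- apply: aeW => x n Ix; rewrite -EFinM.
  change (`|d x * (P n).[x] * w x|%:E <= (2 * (`|d x| * w x))%:E)%E.
  rewrite lee_fin; apply: norm_mul3_le => //.
  by have := Pb n x Ix; rewrite (_ : 1 + 1 = 2 :> R) //; ring.
have J0 : (\int[mu]_(x in I) (d x * g x * w x)%:E = 0)%E.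
  have E : [sequence (\int[mu]_(x in I) (d x * (P n).[x] * w x)%:E)%E]_n = (fun=> 0%E).
    apply/funext => n; have := h (P n); rewrite /wpair /Rintegral => h'.
    rewrite -[LHS]fineK ?h' //; apply: integrable_fin_num; first exact: (@measurable_I11 R).
    exact: (Lw_weight_integrable a1 b1 p1 (P n) Xd).
  rewrite E in cv; have /cvg_lim <- // := cv.
  exact: lim_cst.
have mdg : measurable_fun I (fun x => (d x * g x * w x)%:E).
  by apply/measurable_EFinP; apply: mul_weight_measurable; apply: measurable_funM.
have dgw x : 0 <= d x * g x * w x by rewrite mulr_ge0.
have H : {ae mu, forall x, I x -> (d x * g x * w x)%:E = 0%E}.
  have [h0 _] := @ae_eq_integral_abs _ (measurableTypeR R) R mu I (@measurable_I11 R) _ mdg.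
  apply: h0; rewrite -[RHS]J0.
  by apply: eq_integral_on => x _; rewrite gee0_abs // lee_fin.
have inner : {ae mu, forall x, I x -> -1 < x < 1} by exact: ae_inner.
apply: filterS2 H inner; first exact: (ae_filter_ringOfSetsType mu).
move=> x H inn Ix; have /eqP := H Ix; rewrite eqe.
have wx : w x != 0 by rewrite gt_eqF // jacobi_weight_gt0 // inn.
rewrite mulf_eq0 (negbTE wx) orbF mulf_eq0 => /orP[/eqP//|/eqP gx].
move: gx; rewrite /g; case: (leP (d x) 1) => d1; case: (leP (-1) _) => d2 //; lra.
Qed.

(** Continuity up to the endpoints, used through [quadratic_modulus]. *)
Lemma within_continuous_eq0 d : {within I, continuous d} ->
  (forall x, -1 < x < 1 -> d x = 0) -> forall x, I x -> d x = 0.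
Proof.
move=> cd d0 x Ix; apply/eqP; rewrite -normr_le0; apply/ler_addgt0Pr => e e0.
have e20 : 0 < e / 2 by rewrite divr_gt0.
have [K hK] := quadratic_modulus cd e20.
have K1 : 0 < K%:R + 1 :> R by have := ler0n R K; lra.
pose h := Num.min (1 / 2) (e / 2 / (K%:R + 1)).
have h0 : 0 < h by rewrite lt_min !divr_gt0.
have h1 : h <= 1 / 2 by rewrite ge_min lexx.
have h2 : K%:R * h ^+ 2 <= e / 2.
  have : h <= e / 2 / (K%:R + 1) by rewrite ge_min lexx orbT.
  rewrite ler_pdivlMr // => h3.
  have h4 : h ^+ 2 <= h by rewrite expr2 ler_piMl ?(ltW h0) //; lra.
  have := ler_wpM2l (ler0n R K) h4; have := ltW h0; nra.
have [t [t1 t2]] : exists t, -1 < t < 1 /\ (x - t) ^+ 2 <= h ^+ 2.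
  move: Ix; rewrite /= in_itv /= => /andP[x1 x2].
  have [x0|x0] := leP 0 x.
    exists (x - h); split; first by apply/andP; split; lra.
    by rewrite (_ : x - (x - h) = h) //; ring.
  exists (x + h); split; first by apply/andP; split; lra.
  by rewrite (_ : x - (x + h) = - h) ?sqrrN //; ring.
have It : I t by rewrite /= in_itv /=; case/andP: t1 => ? ?; apply/andP; split; lra.
have := hK x t Ix It; rewrite (d0 t t1) subr0 add0r => h5; apply: (le_trans h5).
have := ler_wpM2l (ler0n R K) t2; lra.
Qed.

Lemma wnormr_ae0 d : X d -> {ae mu, forall x, I x -> d x = 0} -> nr d = 0.
Proof.
move=> Xd; have md := Lw_measurable p1 Xd.
have w0 x : 0 <= w x by exact: jacobi_weight_ge0.
rewrite /wnormr; move: Xd; case: p p1 => [q q1 Xd|_ cd|//] ae0.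
- have q0 := ge1_gt0 q1.
  apply/eqP; rewrite eq_le; apply/andP; split; last exact/fine_ge0/(wnorm_ge0 _ _ q1).
  rewrite -lee_fin fineK ?ge0_fin_numE ?wnorm_ge0 ?(wnorm_lty q1 Xd) //.
  apply/(wnorm_Rle _ _ _ q0 (lexx 0)); rewrite powR0 ?gt_eqF //.
  have -> // : (\int[mu]_(x in I) (`|d x| `^ q * w x)%:E = 0)%E.
  rewrite (@ge0_ae_eq_integral _ (measurableTypeR R) R mu I _ (cst 0%E) (@measurable_I11 R)) ?integral0 //.
  + apply/measurable_EFinP; apply: mul_weight_measurable.
    apply: (measurableT_comp (measurable_powR q)); exact: measurableT_comp.
  + by move=> x _; rewrite lee_fin mulr_ge0 // powR_ge0.
  + apply: filterS ae0; first exact: (ae_filter_ringOfSetsType mu).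
    by move=> x d0 Ix; rewrite d0 // normr0 powR0 ?gt_eqF // mul0r.
- have din x : -1 < x < 1 -> d x = 0.
    apply: (weighted_ae0_continuous (a := a) (b := b) md).
      move=> y y1; have : y \in `](-1 : R), 1[ by rewrite in_itv.
      have lt11 : (-1 : R) < 1 by lra.
      by have [cin _ _] := (continuous_within_itvP d lt11).1 cd; exact: cin.
    rewrite (@ge0_ae_eq_integral _ (measurableTypeR R) R mu I _ (cst 0%E) (@measurable_I11 R)) ?integral0 //.
    + apply/measurable_EFinP; apply: mul_weight_measurable; exact: measurableT_comp.
    + by move=> z _; rewrite lee_fin mulr_ge0.
    + apply: filterS ae0; first exact: (ae_filter_ringOfSetsType mu).
      by move=> z d0 Iz; rewrite d0 // normr0 mul0r.
  have dI := within_continuous_eq0 cd din.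
  rewrite /wnorm (_ : [set _ | x in I] = [set 0%E]) ?ereal_sup1 //.
  apply/seteqP; split => [_ [x Ix <-]|_ ->]; first by rewrite dI // normr0.
  have I0 : I 0 by rewrite /= in_itv /=; apply/andP; split; lra.
  by exists 0 => //; rewrite dI // normr0.
Qed.

Lemma Lw_unique d : X d -> (forall k, wpair a b d (jpolyR a b k) = 0) -> nr d = 0.
Proof. by move=> Xd h; apply: wnormr_ae0 => //; apply: wpair_ae0 => //; exact: wpair_eq0. Qed.

End Uniqueness.

(** * Density of polynomials and completeness *)

Section DensityCompleteness.
Context {R : realType}.
Variables a b : R.
Hypothesis a1 : -1 < a.
Hypothesis b1 : -1 < b.
Local Notation mu := (@lebesgue_measure R).
Local Notation I := (`[(-1 : R)%R, (1 : R)%R]%classic).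
Local Notation w := (jacobi_weight a b).
Implicit Types (f g d : R -> R) (q : R).

Lemma cvg_norm_powR (S : Type) (F : set_system S) (FF : ProperFilter F) q (u : S -> R) (l : R) :
  1 <= q ->
  u n @[n --> F] --> l -> `|u n| `^ q @[n --> F] --> `|l| `^ q.
Proof.
move=> q1 cv; have q0 : 0 < q by exact: lt_le_trans q1.
have cn : `|u n| @[n --> F] --> `|l| by exact: cvg_norm.
have [l0|l0] := eqVneq l 0; last first.
  have n0 : 0 < `|l| by rewrite normr_gt0.
  have h : expR (q * ln `|u n|) @[n --> F] --> expR (q * ln `|l|).
    apply: continuous_cvg; first exact: continuous_expR.
    apply: cvgM; first exact: cvg_cst.
    by apply: continuous_cvg => //; exact: continuous_ln.
  rewrite {2}/powR gt_eqF //; apply: cvg_trans h; apply: near_eq_cvg.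
  near=> n; rewrite /powR gt_eqF //; near: n.
  exact: (cvgr_gt _ cn).
rewrite l0 normr0 in cn *; rewrite powR0 ?gt_eqF //.
apply: (squeeze_cvgr _ (cvg_cst 0) cn); near=> n.
rewrite powR_ge0 /=; have n1 : `|u n| <= 1 by near: n; exact: (cvgr_le _ cn).
have [->|u0] := eqVneq (u n) 0; first by rewrite normr0 powR0 ?gt_eqF.
rewrite -{2}(powRr1 (normr_ge0 (u n))); apply: ger_powR => //.
by rewrite normr_gt0 u0.
Unshelve. all: by end_near.
Qed.

Lemma wpow_measurable q f : measurable_fun I f ->
  measurable_fun I (fun x => (`|f x| `^ q * w x)%:E).
Proof.
move=> mf; apply/measurable_EFinP; apply: mul_weight_measurable.
by apply: (measurableT_comp (measurable_powR q)); exact: measurableT_comp.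
Qed.

Lemma wpow_ge0 q f x : (0 <= (`|f x| `^ q * w x)%:E)%E.
Proof. by rewrite lee_fin mulr_ge0 ?powR_ge0 // jacobi_weight_ge0. Qed.

Lemma Lw_finP q f c : (1 <= q%:E)%E -> 0 <= c -> measurable_fun I f ->
  (\int[mu]_(x in I) (`|f x| `^ q * w x)%:E <= (c `^ q)%:E)%E ->
  Lw a b q%:E f /\ wnormr a b q%:E f <= c.
Proof.
move=> q1 c0 mf; have q0 := ge1_gt0 q1.
move/(wnorm_Rle _ _ _ q0 c0) => h.
have Xf : Lw a b q%:E f by split => //; apply: le_lt_trans h _; rewrite ltry.
by split => //; rewrite wnormrP.
Qed.

(** Dominated convergence in [L_{w,q}]. *)
Lemma wnormr_dominated q f (g : nat -> R -> R) G (e : R) : (1 <= q%:E)%E ->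
  measurable_fun I f -> (forall n, measurable_fun I (g n)) ->
  Lw a b q%:E G ->
  (forall n x, I x -> `|f x - g n x| <= `|G x|) ->
  {ae mu, forall x, I x -> g n x @[n --> \oo] --> f x} ->
  0 < e -> exists n, Lw a b q%:E (fun x => f x - g n x) /\
                     wnormr a b q%:E (fun x => f x - g n x) <= e.
Proof.
move=> q1 mf mg XG bd cv e0; have q0 := ge1_gt0 q1.
have mG := Lw_measurable q1 XG.
have w0 x : 0 <= w x by exact: jacobi_weight_ge0.
have md n : measurable_fun I (fun x => f x - g n x) by apply: measurable_funB.
have [|||||_ _ cvI] := @dominated_convergence _ (measurableTypeR R) R mu I (@measurable_I11 R)
  (fun n x => (`|f x - g n x| `^ q * w x)%:E) (cst 0%E)
  (fun x => (`|G x| `^ q * w x)%:E).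
- by move=> n; exact: wpow_measurable.
- exact: measurable_cst.
- apply: filterS cv; first exact: (ae_filter_ringOfSetsType mu).
  move=> x cv Ix; apply: cvg_EFin; first exact: nearW.
  rewrite -(mul0r (w x)); apply: cvgM; last exact: cvg_cst.
  have -> : 0 = `|f x - f x| `^ q by rewrite subrr normr0 powR0 // gt_eqF.
  by apply: cvg_norm_powR => //; apply: cvgB; [exact: cvg_cst|exact: cv].
- have [_ GI] := XG; apply/integrableP; split; first exact: wpow_measurable.
  have : (wnorm a b q%:E G <= (fine (wnorm a b q%:E G))%:E)%E.
    by rewrite fineK // ge0_fin_numE // (wnorm_ge0 _ _ q1).
  move/(wnorm_Rle _ _ _ q0 (fine_ge0 (wnorm_ge0 _ _ q1 G))) => h.
  apply: le_lt_trans (ltry ((fine (wnorm a b q%:E G)) `^ q)); apply: le_trans h.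
  rewrite le_eqVlt; apply/orP; left; apply/eqP; apply: eq_integral_on => x _.
  by rewrite gee0_abs // wpow_ge0.
- apply: aeW => x n Ix.
  have hp : `|f x - g n x| `^ q <= `|G x| `^ q.
    by apply: ge0_ler_powR; rewrite ?nnegrE ?bd // ltW.
  rewrite gee0_abs; last exact: (wpow_ge0 q (fun x => f x - g n x)).
  by rewrite lee_fin; exact: (ler_wpM2r (w0 x) hp).
rewrite integral0 in cvI.
have eq0 : (0 < (e `^ q)%:E)%E by rewrite lte_fin powR_gt0.
have [n hn] : exists n, (\int[mu]_(x in I) (`|f x - g n x| `^ q * w x)%:E <= (e `^ q)%:E)%E.
  apply: contrapT => /forallNP H; move: eq0; rewrite ltNge => /negP; apply.
  apply: (cvge_to_ge cvI); apply: nearW => n.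
  by have /negP := H n; rewrite -ltNge => /ltW.
by exists n; apply: Lw_finP => //; exact: ltW.
Qed.

(** Truncate [f], then approximate the truncation boundedly by polynomials; both steps
converge in norm by domination. *)
Lemma poly_dense_fin q f e : (1 <= q%:E)%E -> Lw a b q%:E f -> 0 < e ->
  exists P : {poly R}, wnormr a b q%:E (fun x => f x - P.[x]) <= e.
Proof.
move=> q1 Xf e0; have mf := Lw_measurable q1 Xf.
have e2 : 0 < e / 2 by rewrite divr_gt0.
pose g n x := Num.max (- n%:R) (Num.min (f x) n%:R).
have mg n : measurable_fun I (g n) by apply: measurable_maxr => //; apply: measurable_minr.
have gE n x : `|f x| <= n%:R -> g n x = f x.
  by rewrite ler_norml /g => /andP[h1 h2]; rewrite (min_idPl h2) (max_idPr h1).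
have gn n x : `|g n x| <= n%:R.
  have n0 := ler0n R n.
  rewrite ler_norml /g le_max lexx /= ge_max ge_min lexx orbT andbT; lra.
have bd n x : I x -> `|f x - g n x| <= `|f x|.
  move=> _; have n0 := ler0n R n.
  rewrite /g; case: (leP (f x) n%:R) => h1; case: (leP (- n%:R) _) => h2.
  - by rewrite subrr normr0.
  - rewrite !ler0_norm; lra.
  - rewrite !ger0_norm; lra.
  - lra.
have [|n [Xd hn]] := wnormr_dominated q1 mf mg Xf bd _ e2.
  apply: aeW => x Ix; apply: cvg_near_cst.
  near=> n; apply: gE; apply: ltW; near: n; exact: nbhs_infty_gtr.
have [P [Pb Pc]] := bounded_poly_approx (mg n) (fun x _ => gn n x).
have mP m : measurable_fun I (horner (P m)) by exact: measurable_horner.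
have XG : Lw a b q%:E (fun=> n%:R + (n%:R + 1)).
  by have := Lw_poly a1 b1 q1 (n%:R + (n%:R + 1))%:P; congr Lw; apply/funext => x; rewrite hornerC.
have [||m [Xd' hm]] := wnormr_dominated q1 (mg n) mP XG _ _ e2.
- move=> m x Ix; rewrite (ger0_norm (_ : 0 <= n%:R + (n%:R + 1))) ?addr_ge0 //.
  by apply: (le_trans (ler_normB _ _)); apply: lerD; [exact: gn|exact: Pb].
- exact: Pc.
exists (P m).
have Xg : Lw a b q%:E (g n).
  by apply: (Lw_bounded a1 b1 q1 (mg n) _ (fun x _ => gn n x)).
apply: (le_trans (wnormr_dist q1 Xf Xg (Lw_poly a1 b1 q1 (P m)))).
by apply: (le_trans (lerD hn hm)); rewrite -splitr.
Unshelve. all: by end_near.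
Qed.

Lemma poly_dense p f e : (1 <= p)%E -> Lw a b p f -> 0 < e ->
  exists P : {poly R}, wnormr a b p (fun x => f x - P.[x]) <= e.
Proof.
case: p => [q| |] //; first exact: poly_dense_fin.
move=> p1 cf e0; have [P hP] := weierstrass cf e0; exists P.
have Xd := Lw_sub p1 cf (Lw_poly a1 b1 p1 P).
by rewrite wnormrP //; apply: ge_ereal_sup => _ [x Ix <-]; rewrite lee_fin hP.
Qed.

(** Lower semicontinuity of the norm under almost everywhere convergence, by Fatou's lemma. *)
Lemma wnormr_fatou q (v : nat -> R -> R) g (c : R) : (1 <= q%:E)%E -> 0 <= c ->
  (forall n, Lw a b q%:E (v n)) -> (forall n, wnormr a b q%:E (v n) <= c) ->
  measurable_fun I g -> {ae mu, forall x, I x -> v n x @[n --> \oo] --> g x} ->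
  Lw a b q%:E g /\ wnormr a b q%:E g <= c.
Proof.
move=> q1 c0 Xv vc mg cv; have q0 := ge1_gt0 q1.
have w0 x : 0 <= w x by exact: jacobi_weight_ge0.
have mv n := Lw_measurable q1 (Xv n).
apply: Lw_finP => //.
pose F n x := (`|v n x| `^ q * w x)%:E.
have mF n : measurable_fun I (F n) by exact: wpow_measurable.
have F0 n x : I x -> (0 <= F n x)%E by move=> _; exact: wpow_ge0.
have FF := @fatou _ (measurableTypeR R) R mu I (@measurable_I11 R) F mF F0.
apply: (@le_trans _ _ (\int[mu]_(x in I) limn_einf (F^~ x))%E).
  apply: (@ae_ge0_le_integral _ (measurableTypeR R) R mu I (@measurable_I11 R)).
  - by move=> x _; exact: wpow_ge0.
  - exact: wpow_measurable.
  - move=> x Ix; rewrite limn_einf_lim; apply: lime_ge; first exact: is_cvg_einfs.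
    by apply: nearW => n; apply: le_ereal_inf_tmp => _ [m _ <-]; exact: F0.
  - rewrite /limn_einf; apply: measurableT_comp => //.
    apply: (@measurable_fun_limn_esup _ (measurableTypeR R) R I (fun n x => (- F n x)%E)) => n.
    change (measurable_fun I (EFin \o (fun x => - (`|v n x| `^ q * w x)))).
    apply/measurable_EFinP; apply: measurable_funN; apply: mul_weight_measurable.
    by apply: (measurableT_comp (measurable_powR q)); exact: measurableT_comp.
  - apply: filterS cv; first exact: (ae_filter_ringOfSetsType mu).
    move=> x cv Ix.
    have -> : limn_einf (F^~ x) = (`|g x| `^ q * w x)%:E; last by [].
    apply: (cvg_limn_einf_sup _).1; apply: cvg_EFin; first exact: nearW.
    apply: cvgM; last exact: cvg_cst.
    by apply: cvg_norm_powR => //; exact: cv.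
apply: (le_trans FF); rewrite limn_einf_lim; apply: lime_le; first exact: is_cvg_einfs.
apply: nearW => n; apply: (@le_trans _ _ (\int[mu]_(x in I) F n x)%E).
  by apply: ereal_inf_lbound; exists n => //=.
by apply/(wnorm_Rle _ _ _ q0 c0); rewrite -wnormrP.
Qed.

End DensityCompleteness.

Section Completeness.
Context {R : realType}.
Variables a b : R.
Hypothesis a1 : -1 < a.
Hypothesis b1 : -1 < b.
Local Notation mu := (@lebesgue_measure R).
Local Notation I := (`[(-1 : R)%R, (1 : R)%R]%classic).
Local Notation w := (jacobi_weight a b).
Implicit Types (f g d : R -> R) (q : R).

Lemma cvg_bounded_variation (u : nat -> R) (K : R) :
  (forall n, \sum_(0 <= k < n) `|u k.+1 - u k| <= K) -> cvgn u.
Proof.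
move=> h.
have : cvgn [normed series (telescope u)].
  apply: nondecreasing_is_cvgn.
    by apply: nondecreasing_series => n _ _; exact: normr_ge0.
  by exists K => _ [n _ <-]; exact: h.
move/normed_cvg => c.
have -> : u = (fun n => u 0%N + series (telescope u) n).
  by apply/funext => n; rewrite -eq_sum_telescope.
by apply: is_cvgD => //; exact: is_cvg_cst.
Qed.

Lemma sum_geometric n : \sum_(0 <= k < n) (2 ^ k.+1)%:R^-1 = 1 - (2 ^ n)%:R^-1 :> R.
Proof.
elim: n => [|n IH]; first by rewrite big_nil expn0 invr1 subrr.
rewrite big_nat_recr //= IH expnS natrM invfM.
by set z := (2 ^ n)%:R^-1; lra.
Qed.

Lemma inv2_gt0 n : 0 < (2 ^ n)%:R^-1 :> R.
Proof. by rewrite invr_gt0 ltr0n expn_gt0. Qed.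

(** The bound [2^-n - 2^-(n+k)] is what the induction needs. *)
Lemma wnormr_tail p (u : nat -> R -> R) n k : (1 <= p)%E ->
  (forall n, Lw a b p (u n)) ->
  (forall n, wnormr a b p (fun x => u n.+1 x - u n x) <= (2 ^ n.+1)%:R^-1) ->
  wnormr a b p (fun x => u (n + k)%N x - u n x) <= (2 ^ n)%:R^-1.
Proof.
move=> p1 Xu hu.
suff : wnormr a b p (fun x => u (n + k)%N x - u n x) <= (2 ^ n)%:R^-1 - (2 ^ (n + k))%:R^-1.
  by have := inv2_gt0 (n + k); lra.
elim: k => [|k IH].
  rewrite addn0 subrr (@eq_wnormr _ _ _ _ _ (fun=> 0)); last by move=> x _; rewrite subrr.
  by rewrite wnormr0.
rewrite addnS; apply: (le_trans (wnormr_dist p1 (Xu _) (Xu (n + k)%N) (Xu _))).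
have := hu (n + k)%N; rewrite expnS natrM invfM.
move: IH; set z := (2 ^ (n + k))%:R^-1; set y := (2 ^ n)%:R^-1.
move: (wnormr _ _ _ _) => A; move: (wnormr _ _ _ _) => B; lra.
Qed.

(** The increments have a summable [L^1] norm, so their sum is finite almost everywhere and the
sequence converges there; Fatou's lemma bounds the distance to the limit. *)
Lemma Lw_complete_fin q (u : nat -> R -> R) : (1 <= q%:E)%E ->
  (forall n, Lw a b q%:E (u n)) ->
  (forall n, wnormr a b q%:E (fun x => u n.+1 x - u n x) <= (2 ^ n.+1)%:R^-1) ->
  exists g, Lw a b q%:E g /\
    forall n, wnormr a b q%:E (fun x => g x - u n x) <= (2 ^ n)%:R^-1.
Proof.
move=> q1 Xu hu.
have w0 x : 0 <= w x by exact: jacobi_weight_ge0.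
have mu_ n := Lw_measurable q1 (Xu n).
have Xd n : Lw a b q%:E (fun x => u n.+1 x - u n x) by exact: Lw_sub.
have md n : measurable_fun I (fun x => (`|u n.+1 x - u n x| * w x)%:E).
  apply/measurable_EFinP; apply: mul_weight_measurable; apply: measurableT_comp => //.
  exact: measurable_funB.
have d0 n x : I x -> (0 <= (`|u n.+1 x - u n x| * w x)%:E)%E.
  by move=> _; rewrite lee_fin mulr_ge0.
pose S x := (\sum_(0 <= n <oo) (`|u n.+1 x - u n x| * w x)%:E)%E.
have S0 x : (0 <= S x)%E by apply: nneseries_ge0 => n _ _; rewrite lee_fin mulr_ge0.
have mS : measurable_fun I S by apply: ge0_emeasurable_sum => // n x Ix _; exact: d0.
have SI : (\int[mu]_(x in I) S x < +oo)%E.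
  rewrite (@integral_nneseries _ (measurableTypeR R) R mu I (@measurable_I11 R) _ md d0).
  have K0 : 0 <= jmoment a b 1 + 1 by rewrite addr_ge0 // ltW // jmoment1_gt0.
  apply: le_lt_trans (ltry (jmoment a b 1 + 1)).
  apply: le_trans (epsilon_trick0 xpredT K0).
  apply: lee_nneseries => [n _ _|n _]; first by apply: integral_ge0 => x Ix; exact: d0.
  apply: (le_trans (Lw_L1_EFin a1 b1 q1 (Xd n))).
  by rewrite lee_fin ler_wpM2l.
have Sfin : {ae mu, forall x, I x -> S x \is a fin_num}.
  apply: (@integrable_ae _ (measurableTypeR R) R mu I (@measurable_I11 R)); apply/integrableP; split => //.
  by under eq_integral do rewrite gee0_abs //.
(* On D the weight is positive, so finiteness of S bounds the variation of the sequence. *)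
pose D := `](-1 : R), 1[%classic `&` (I `&` [set x | (S x < +oo)%E]).
have mD : measurable (D : set (measurableTypeR R)).
  apply: measurableI; first exact: measurable_itv.
  exact: (@emeasurable_fun_infty_o _ (measurableTypeR R) R I S (@measurable_I11 R) mS).
have cvD x : D x -> cvgn (u^~ x).
  move=> [/= x1 [_ Sx]].
  have wx : 0 < w x by apply: jacobi_weight_gt0; move: x1; rewrite in_itv.
  apply: (@cvg_bounded_variation _ (fine (S x) / w x)) => n.
  rewrite ler_pdivlMr // -lee_fin fineK ?ge0_fin_numE // mulr_suml -sumEFin.
  by apply: nneseries_lim_ge => k _ _; rewrite lee_fin mulr_ge0.
pose g := (fun x => limn (u^~ x)) \_ D.
have DI : D `<=` I by move=> x [_ []].
have mg : measurable_fun I g.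
  apply: measurable_funTS; apply/(measurable_restrictT _ mD).
  apply: (@measurable_fun_cvg _ (measurableTypeR R) R D u).
    by move=> n; apply: measurable_funS (mu_ n) => //; exact: (@measurable_I11 R).
  by move=> x Dx; exact: cvD.
have cvg_ae : {ae mu, forall x, I x -> u n x @[n --> \oo] --> g x}.
  have inner : {ae mu, forall x, I x -> -1 < x < 1} by exact: ae_inner.
  apply: filterS2 Sfin inner; first exact: (ae_filter_ringOfSetsType mu).
  move=> x Sx x1 Ix.
  have Dx : D x.
    split; first by rewrite /= in_itv /= x1.
    by split => //=; have := Sx Ix; rewrite ge0_fin_numE.
  by rewrite /g /patch mem_set //; exact: cvD.
have tail n : Lw a b q%:E (fun x => g x - u n x) /\
              wnormr a b q%:E (fun x => g x - u n x) <= (2 ^ n)%:R^-1.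
  apply: (@wnormr_fatou _ a b q (fun m x => u (n + m)%N x - u n x)) => //.
  - by move=> m; exact: Lw_sub.
  - by move=> m; exact: wnormr_tail.
  - exact: measurable_funB.
  - apply: filterS cvg_ae; first exact: (ae_filter_ringOfSetsType mu).
    move=> x cx Ix; apply: cvgB; last exact: cvg_cst.
    by have := cx Ix; rewrite -(cvg_shiftn n); under eq_fun do rewrite addnC.
exists g; split; last by move=> n; have [] := tail n.
have := Lw_add q1 (tail 0%N).1 (Xu 0%N); congr (Lw _ _ _).
by apply/funext => x; rewrite subrK.
Qed.

Lemma Lw_complete_sup (u : nat -> R -> R) :
  (forall n, Lw a b +oo%E (u n)) ->
  (forall n, wnormr a b +oo%E (fun x => u n.+1 x - u n x) <= (2 ^ n.+1)%:R^-1) ->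
  exists g, Lw a b +oo%E g /\
    forall n, wnormr a b +oo%E (fun x => g x - u n x) <= (2 ^ n)%:R^-1.
Proof.
move=> Xu hu; have p1 : (1 <= +oo :> \bar R)%E by rewrite leey.
have ptw f c x : Lw a b +oo%E f -> wnormr a b +oo%E f <= c -> I x -> `|f x| <= c.
  move=> Xf; rewrite wnormrP // => h Ix; rewrite -lee_fin; apply: le_trans h.
  by apply: ereal_sup_ubound; exists x.
have cv x : I x -> cvgn (u^~ x).
  move=> Ix; apply: (@cvg_bounded_variation _ 1) => n.
  apply: (@le_trans _ _ (\sum_(0 <= k < n) (2 ^ k.+1)%:R^-1)).
    by apply: ler_sum => k _; apply: (ptw (fun x => u k.+1 x - u k x)) => //; exact: Lw_sub.
  by rewrite sum_geometric; have := inv2_gt0 n; lra.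
pose g x := limn (u^~ x).
have gu n x : I x -> `|g x - u n x| <= (2 ^ n)%:R^-1.
  move=> Ix.
  have h : `|u m x - u n x| @[m --> \oo] --> `|g x - u n x|.
    by apply: cvg_norm; apply: cvgB; [exact: cv|exact: cvg_cst].
  apply: (cvgr_to_le h); exists n => // m /= nm.
  rewrite -(subnKC nm); apply: (ptw (fun x => u (n + (m - n))%N x - u n x)) => //.
    exact: Lw_sub.
  exact: wnormr_tail.
have cg : {within I, continuous g}.
  apply/subspace_continuousP => x Ix; apply/cvgrPdist_le => e e0.
  have [n hn] : exists n, (2 ^ n)%:R^-1 <= e / 3.
    have e3 : 0 < e / 3 by rewrite divr_gt0.
    have [n _ hn] := near_infty_natSinv_lt (PosNum e3).
    exists n; apply: ltW; apply: le_lt_trans (hn n (leqnn n)).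
    by rewrite lef_pV2 ?posrE ?ltr0n ?expn_gt0 // ler_nat ltn_expl.
  have cu : u n @ within I (nbhs x) --> u n x.
    by have := Xu n => /= /subspace_continuousP; exact.
  have e3 : 0 < e / 3 by rewrite divr_gt0.
  have /cvgrPdist_le /(_ _ e3) H := cu.
  near=> y.
  have Iy : I y by near: y; exact: withinT.
  have h1 : `|u n x - u n y| <= e / 3 by near: y.
  have h2 := gu n x Ix; have h3 := gu n y Iy.
  rewrite (_ : g x - g y = (g x - u n x) + (u n x - u n y) - (g y - u n y)); last by ring.
  apply: (le_trans (ler_normB _ _)); apply: (le_trans (lerD (ler_normD _ _) (lexx _))).
  apply: (le_trans (lerD (lerD (le_trans h2 hn) h1) (le_trans h3 hn))); lra.
exists g; split => // n.
rewrite wnormrP //; last exact: (Lw_sub p1 cg (Xu n)).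
by apply: ge_ereal_sup => _ [x Ix <-]; rewrite lee_fin gu.
Unshelve. all: by end_near.
Qed.

Lemma Lw_complete p (u : nat -> R -> R) : (1 <= p)%E ->
  (forall n, Lw a b p (u n)) ->
  (forall n, wnormr a b p (fun x => u n.+1 x - u n x) <= (2 ^ n.+1)%:R^-1) ->
  exists g, Lw a b p g /\
    forall n, wnormr a b p (fun x => g x - u n x) <= (2 ^ n)%:R^-1.
Proof.
case: p => [q| |] //; first exact: Lw_complete_fin.
by move=> _; exact: Lw_complete_sup.
Qed.

End Completeness.

(** * Coefficient multipliers *)

Section Multipliers.
Context {R : realType}.
Variables a b : R.
Hypothesis a1 : -1 < a.
Hypothesis b1 : -1 < b.
Variable p : \bar R.
Hypothesis p1 : (1 <= p)%E.
Local Notation M := (jmoment a b).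
Local Notation Rk := (jpolyR a b).
Local Notation X := (Lw a b p).
Local Notation nr := (wnormr a b p).
Local Notation "f '^^' k" := (wpair a b f (Rk k)) (at level 30).
Implicit Types (m : nat -> R) (P Q : {poly R}) (f g : R -> R).

(** The operator that multiplies the [k]-th Jacobi coefficient of a polynomial by [m k]. *)
Definition jmul m P : {poly R} := \sum_(k < size P) (m k * jproj a b k P) *: Rk k.

Lemma jmoment_jmul m P k : M (jmul m P * Rk k) = m k * M (P * Rk k).
Proof.
rewrite /jmul (jmoment_jsum a1 b1 (size P) (fun k => m k * jproj a b k P)).
case: ifPn => kP; first by rewrite -mulrA /jproj divfK ?jmoment_jpolyR_neq0.
by rewrite jpolyR_orth ?mulr0 // leqNgt.
Qed.

Lemma size_jmul m P : (size (jmul m P) <= size P)%N.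
Proof.
apply: (leq_trans (size_sum _ _ _)); apply/bigmax_leqP => i _.
by apply: (leq_trans (size_scale_leq _ _)); rewrite size_jpolyR.
Qed.

Lemma jmoment_inj P Q : (forall k, M (P * Rk k) = M (Q * Rk k)) -> P = Q.
Proof.
move=> h; apply/eqP; rewrite -subr_eq0; apply/eqP; apply: (jpolyR_orth_eq0 a1 b1) => k.
by rewrite mulrBl jmomentB // h subrr.
Qed.

Lemma jmul_unique m P Q : (forall k, M (Q * Rk k) = m k * M (P * Rk k)) -> jmul m P = Q.
Proof. by move=> h; apply: jmoment_inj => k; rewrite jmoment_jmul h. Qed.

Lemma jmulB m P Q : jmul m (P - Q) = jmul m P - jmul m Q.
Proof.
apply: jmul_unique => k.
by rewrite !mulrBl !jmomentB // !jmoment_jmul mulrBr.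
Qed.

Lemma jmul_comp m1 m2 P : jmul (fun k => m1 k * m2 k) P = jmul m1 (jmul m2 P).
Proof. by apply: jmul_unique => k; rewrite !jmoment_jmul mulrA. Qed.

Lemma jmul_lin c1 m1 c2 m2 P :
  jmul (fun k => c1 * m1 k + c2 * m2 k) P = c1 *: jmul m1 P + c2 *: jmul m2 P.
Proof.
apply: jmul_unique => k; rewrite mulrDl -!scalerAl jmomentD // !jmomentZ // !jmoment_jmul; ring.
Qed.

Lemma jmul1 P : jmul (fun=> 1) P = P.
Proof. by apply: jmul_unique => k; rewrite mul1r. Qed.

Lemma eq_jmul m1 m2 P : m1 =1 m2 -> jmul m1 P = jmul m2 P.
Proof. by move=> e; apply: jmul_unique => k; rewrite jmoment_jmul e. Qed.

Lemma wpair_jmul m P k : horner (jmul m P) ^^ k = m k * (horner P ^^ k).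
Proof. by rewrite !wpair_poly jmoment_jmul. Qed.

Local Notation nrp P := (nr (horner P)).

Lemma Lw_horner P : X (horner P). Proof. exact: Lw_poly. Qed.

Lemma wnormr_polyD P Q : nrp (P + Q) <= nrp P + nrp Q.
Proof.
rewrite (@eq_wnormr _ _ _ _ _ (fun x => P.[x] + Q.[x])); last by move=> x _; rewrite hornerD.
by apply: wnormrD => //; exact: Lw_horner.
Qed.

Lemma wnormr_polyZ c P : nrp (c *: P) = `|c| * nrp P.
Proof.
rewrite -wnormrZ //; last exact: Lw_horner.
by apply: eq_wnormr => x _; rewrite hornerZ.
Qed.

Lemma wnormr_polyB P Q : nrp (P - Q) <= nrp P + nrp Q.
Proof. by apply: (le_trans (wnormr_polyD _ _)); rewrite -scaleN1r wnormr_polyZ normrN1 mul1r. Qed.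

Lemma wnormr_poly_sum n (F : nat -> {poly R}) :
  nrp (\sum_(i < n) F i) <= \sum_(i < n) nrp (F i).
Proof.
elim: n => [|n IH].
  by rewrite !big_ord0 -(scale0r 0) wnormr_polyZ normr0 mul0r.
by rewrite !big_ord_recr /=; apply: (le_trans (wnormr_polyD _ _)); rewrite lerD2r.
Qed.

Lemma wnormr_poly_eq0 P : nrp P = 0 -> P = 0.
Proof.
move=> h; apply: jmoment_inj => k; rewrite mul0r jmoment0 // -wpair_poly.
have [C C0 hC] := wpair_bounded a1 b1 p1 (Rk k).
by apply/eqP; rewrite -normr_le0; apply: (le_trans (hC _ (Lw_horner P))); rewrite h mulr0.
Qed.

Lemma cvg_ord_sum n (F : nat -> nat -> R) (l : nat -> R) :
  (forall k, F i k @[i --> \oo] --> l k) ->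
  \sum_(k < n) F i k @[i --> \oo] --> \sum_(k < n) l k.
Proof.
move=> h; elim: n => [|n IH].
  by rewrite big_ord0; under eq_fun do rewrite big_ord0; exact: cvg_cst.
rewrite big_ord_recr /=; under eq_fun do rewrite big_ord_recr /=.
exact: cvgD.
Qed.

(** Only finitely many coefficients of [P] are nonzero, so bounds pass to pointwise limits of
multipliers. *)
Lemma jmul_lim (mN : nat -> nat -> R) m P (c : R) :
  (forall k, mN n k @[n --> \oo] --> m k) ->
  (forall n, nrp (jmul (mN n) P) <= c) -> nrp (jmul m P) <= c.
Proof.
move=> cv h.
pose D n := \sum_(k < size P) `|m k - mN n k| * (`|jproj a b k P| * nrp (Rk k)).
have D0 : D n @[n --> \oo] --> \sum_(k < size P) (0 * (`|jproj a b k P| * nrp (Rk k))).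
  apply: (@cvg_ord_sum (size P) (fun n k => `|m k - mN n k| * (`|jproj a b k P| * nrp (Rk k)))
    (fun k => 0 * (`|jproj a b k P| * nrp (Rk k)))) => k; apply: cvgM; last exact: cvg_cst.
  rewrite -(@normr0 _ R) -(subrr (m k)); apply: cvg_norm; apply: cvgB; [exact: cvg_cst|exact: cv].
rewrite big1 in D0; last by move=> k _; rewrite mul0r.
have hD : (c + D n) @[n --> \oo] --> c + 0 by apply: cvgD => //; exact: cvg_cst.
rewrite addr0 in hD; apply: (cvgr_to_ge hD); apply: nearW => n.
have -> : jmul m P = jmul (mN n) P + (1 *: jmul m P + (-1) *: jmul (mN n) P).
  by rewrite scale1r scaleN1r addrC subrK.
apply: (le_trans (wnormr_polyD _ _)); apply: lerD => //.
rewrite -jmul_lin /jmul.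
apply: (le_trans (wnormr_poly_sum (size P)
  (fun k => ((1 * m k + -1 * mN n k) * jproj a b k P) *: Rk k))).
apply: ler_sum => k _; rewrite wnormr_polyZ normrM mulrA ler_wpM2r ?wnormr_ge0 //.
by rewrite mul1r mulN1r.
Qed.

Lemma le_of_le_add_pow2 (x y K : R) : 0 <= K -> (forall n, x <= y + K * (2 ^ n)%:R^-1) -> x <= y.
Proof.
move=> K0 h; apply/ler_addgt0Pr => e e0.
have K1 : 0 < K + 1 by lra.
have e1 : 0 < e / (K + 1) by rewrite divr_gt0.
have [n _ hn] := near_infty_natSinv_lt (PosNum e1).
apply: (le_trans (h n)); rewrite lerD2l.
have hz : (2 ^ n)%:R^-1 <= e / (K + 1).
  apply: ltW; apply: le_lt_trans (hn n (leqnn n)).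
  by rewrite lef_pV2 ?posrE ?ltr0n ?expn_gt0 // ler_nat ltn_expl.
apply: (le_trans (ler_wpM2l K0 hz)); rewrite mulrCA ler_piMr ?(ltW e0) //.
by rewrite ler_pdivrMr // mul1r; lra.
Qed.

(** Approximate [f] by polynomials so fast that their images have summable increments. *)
Lemma multiplier_ext m (C : R) : 0 <= C ->
  (forall P, nrp (jmul m P) <= C * nrp P) -> forall f, X f ->
  exists g, [/\ X g, forall k, g ^^ k = m k * (f ^^ k) & nr g <= C * nr f].
Proof.
move=> C0 hm f Xf; have C1 : 0 < C + 1 by lra.
(* The factor 1 / (C + 1) makes the increments of the images at most 2^-(n+1). *)
pose e n : R := (2 ^ n.+2)%:R^-1 / (C + 1).
have e0 n : 0 < e n by rewrite divr_gt0 // inv2_gt0.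
have /choice[P hP] n := poly_dense a1 b1 p1 Xf (e0 n).
have ee n : e n.+1 = e n / 2 by rewrite /e expnS natrM invfM; ring.
have Ce n : C * (e n + e n) <= (2 ^ n.+1)%:R^-1.
  have h : (C + 1) * (e n + e n) = (2 ^ n.+1)%:R^-1.
    rewrite /e -mulrDl mulrC divfK ?gt_eqF // expnS natrM invfM.
    by rewrite -mulrDl -[RHS]mul1r; congr (_ * _); lra.
  by rewrite -h ler_wpM2r ?addr_ge0 ?(ltW (e0 n)) //; lra.
have hu n : nr (fun x => (jmul m (P n.+1)).[x] - (jmul m (P n)).[x]) <= (2 ^ n.+1)%:R^-1.
  rewrite (@eq_wnormr _ _ _ _ _ (horner (jmul m (P n.+1 - P n)))); last first.
    by move=> x _; rewrite jmulB hornerD hornerN.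
  apply: (le_trans (hm _)); apply: le_trans (Ce n); apply: ler_wpM2l => //.
  rewrite (@eq_wnormr _ _ _ _ _ (fun x => (f x - (P n).[x]) - (f x - (P n.+1).[x]))); last first.
    by move=> x _; rewrite hornerD hornerN; ring.
  apply: (le_trans (wnormrB p1 (Lw_sub p1 Xf (Lw_horner _)) (Lw_sub p1 Xf (Lw_horner _)))).
  apply: lerD; first exact: hP.
  by apply: (le_trans (hP _)); rewrite ee ler_pdivrMr // ler_peMr ?(ltW (e0 n)) //; lra.
have [g [Xg hg]] := Lw_complete a1 b1 p1 (fun n => Lw_horner (jmul m (P n))) hu.
have en n : e n <= (2 ^ n)%:R^-1.
  have h : (C + 1) * e n = (2 ^ n.+2)%:R^-1 by rewrite /e mulrC divfK ?gt_eqF.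
  have h2 : e n <= (C + 1) * e n by rewrite ler_peMl ?(ltW (e0 n)) //; lra.
  apply: (le_trans h2); rewrite h lef_pV2 ?posrE ?ltr0n ?expn_gt0 // ler_nat.
  by rewrite leq_exp2l // -addn2 leq_addr.
exists g; split => // [k|].
  have [K K0 hK] := wpair_bounded a1 b1 p1 (Rk k).
  apply/eqP; rewrite -subr_eq0 -normr_le0.
  apply: (@le_of_le_add_pow2 _ _ (K + `|m k| * K)) => [|n]; first by rewrite addr_ge0 ?mulr_ge0.
  have E : g ^^ k - m k * (f ^^ k) =
     (fun x => g x - (jmul m (P n)).[x]) ^^ k - m k * ((fun x => f x - (P n).[x]) ^^ k).
    rewrite !(wpairBl a1 b1 p1) //; try exact: Lw_horner.
    by rewrite wpair_jmul; ring.
  rewrite E add0r mulrDl; apply: (le_trans (ler_normB _ _)); apply: lerD.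
    apply: (le_trans (hK _ (Lw_sub p1 Xg (Lw_horner _)))); exact: ler_wpM2l.
  rewrite normrM -mulrA ler_wpM2l //.
  apply: (le_trans (hK _ (Lw_sub p1 Xf (Lw_horner _)))); apply: ler_wpM2l => //.
  exact: le_trans (hP n) (en n).
apply: (@le_of_le_add_pow2 _ _ (1 + C)) => [|n]; first by lra.
rewrite (@eq_wnormr _ _ _ _ _ (fun x => (g x - (jmul m (P n)).[x]) + (jmul m (P n)).[x])); last first.
  by move=> x _; rewrite subrK.
apply: (le_trans (wnormrD p1 (Lw_sub p1 Xg (Lw_horner _)) (Lw_horner _))).
have h1 := hg n; have h2 := hm (P n).
have h3 : nrp (P n) <= nr f + (2 ^ n)%:R^-1.
  rewrite (@eq_wnormr _ _ _ _ _ (fun x => f x - (f x - (P n).[x]))); last by move=> x _; rewrite subKr.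
  apply: (le_trans (wnormrB p1 Xf (Lw_sub p1 Xf (Lw_horner _)))); rewrite lerD2l.
  exact: le_trans (hP n) (en n).
apply: (le_trans (lerD h1 (le_trans h2 (ler_wpM2l C0 h3)))).
by set z := _^-1; lra.
Qed.

Lemma wnormr_eq_coef f g : X f -> X g -> (forall k, f ^^ k = g ^^ k) ->
  nr (fun x => f x - g x) = 0.
Proof.
move=> Xf Xg h; apply: (Lw_unique a1 b1 p1); first exact: Lw_sub.
by move=> k; rewrite (wpairBl a1 b1 p1) // h subrr.
Qed.

Lemma wnormr_coef_eq f g : X f -> X g -> (forall k, f ^^ k = g ^^ k) -> nr f = nr g.
Proof.
move=> Xf Xg h; have h0 := wnormr_eq_coef Xf Xg h.
have h1 := wnormr_eq_coef Xg Xf (fun k => esym (h k)).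
apply/eqP; rewrite eq_le; apply/andP; split.
  rewrite (@eq_wnormr _ _ _ _ f (fun x => (f x - g x) + g x)); last by move=> x _; rewrite subrK.
  by apply: (le_trans (wnormrD p1 (Lw_sub p1 Xf Xg) Xg)); rewrite h0 add0r.
rewrite (@eq_wnormr _ _ _ _ g (fun x => (g x - f x) + f x)); last by move=> x _; rewrite subrK.
by apply: (le_trans (wnormrD p1 (Lw_sub p1 Xg Xf) Xf)); rewrite h1 add0r.
Qed.

Lemma multiplier_bound m (C : R) f g : 0 <= C ->
  (forall P, nrp (jmul m P) <= C * nrp P) -> X f -> X g ->
  (forall k, g ^^ k = m k * (f ^^ k)) -> nr g <= C * nr f.
Proof.
move=> C0 hm Xf Xg h; have [g' [Xg' hg' hn]] := multiplier_ext C0 hm Xf.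
by rewrite (wnormr_coef_eq Xg Xg') // => k; rewrite h hg'.
Qed.

End Multipliers.

(** * The translation is a contraction on polynomials *)

Section TranslationContraction.
Context {R : realType}.
Variables a b : R.
Hypothesis hab : b <= a.
Hypothesis hb : - (1 / 2) <= b.
Local Notation mu := (@lebesgue_measure R).
Local Notation I := (`[(-1 : R)%R, (1 : R)%R]%classic).
Local Notation w := (jacobi_weight a b).
Local Notation M := (jmoment a b).
Local Notation Rk := (jpolyR a b).
Local Notation T := (poly_tr a b).
Implicit Types (P Q G : {poly R}) (q y : R).

Lemma jacobi_b_gtN1 : -1 < b. Proof. by have := hb; lra. Qed.
Lemma jacobi_a_gtN1 : -1 < a. Proof. by have := hab; have := hb; lra. Qed.
Local Notation a1 := jacobi_a_gtN1.
Local Notation b1 := jacobi_b_gtN1.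

Lemma poly_tr_jmul y P : T y P = jmul a b (fun k => (Rk k).[y]) P.
Proof.
apply/esym/(jmul_unique a1 b1) => k.
by rewrite (jmoment_poly_tr hab hb) mulrC.
Qed.

Lemma jpolyR0 : Rk 0 = 1.
Proof.
have : (size (Rk 0) <= 1)%N by rewrite (size_jpolyR a1 b1).
move/size1_polyC => h; have := jpolyR1 a1 b1 0; rewrite h hornerC => ->.
by rewrite polyC1.
Qed.

Lemma poly_tr_one y : T y 1 = 1.
Proof.
rewrite poly_tr_jmul; apply: (jmul_unique a1 b1) => k; rewrite mul1r.
have [->|k0] := eqVneq k 0%N; first by rewrite jpolyR0 hornerC mul1r.
have -> : M (Rk k) = 0; last by rewrite mulr0.
have := jmoment_jpolyR_orth a1 b1 (j := 0%N) (k := k); rewrite jpolyR0 mul1r; apply.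
by rewrite eq_sym.
Qed.

Lemma poly_trD y P Q : T y (P + Q) = T y P + T y Q.
Proof.
rewrite !poly_tr_jmul; apply: (jmul_unique a1 b1) => k.
by rewrite !mulrDl !(jmomentD a1 b1) !(jmoment_jmul a1 b1) mulrDr.
Qed.

Lemma poly_trZ y c P : T y (c *: P) = c *: T y P.
Proof.
rewrite !poly_tr_jmul; apply: (jmul_unique a1 b1) => k.
by rewrite -!scalerAl !(jmomentZ a1 b1) !(jmoment_jmul a1 b1) mulrCA.
Qed.

Lemma poly_trC y c : T y c%:P = c%:P.
Proof. by rewrite -[c%:P]mulr1 mul_polyC poly_trZ poly_tr_one. Qed.

Lemma poly_tr_le x y P Q : I x -> I y -> (forall z, I z -> P.[z] <= Q.[z]) ->
  (T y P).[x] <= (T y Q).[x].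
Proof.
move=> Ix Iy PQ; have -> : Q = P + (Q - P) by rewrite addrC subrK.
rewrite poly_trD hornerD lerDl; apply: (poly_tr_ge0 hab hb) => // z Iz.
by rewrite hornerD hornerN subr_ge0 PQ.
Qed.

Lemma poly_tr_norm_le x y P c : I x -> I y -> (forall z, I z -> `|P.[z]| <= c) ->
  `|(T y P).[x]| <= c.
Proof.
move=> Ix Iy Pc; rewrite ler_norml; apply/andP; split.
  rewrite -[leLHS](hornerC _ x) -(poly_trC y); apply: poly_tr_le => // z Iz.
  by rewrite hornerC; have := Pc z Iz; rewrite ler_norml => /andP[].
rewrite -[leRHS](hornerC _ x) -(poly_trC y); apply: poly_tr_le => // z Iz.
by rewrite hornerC; have := Pc z Iz; rewrite ler_norml => /andP[].
Qed.

(** The graph of [x |-> x^q] lies above its tangent at [t]; this is Young's inequality. *)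
Lemma powR_tangent q (x t : R) : 1 <= q -> 0 <= x -> 0 < t ->
  t `^ q + q * t `^ (q - 1) * (x - t) <= x `^ q.
Proof.
move=> q1 x0 t0; have q0 : 0 < q by exact: lt_le_trans q1.
have [->|qn1] := eqVneq q 1.
  by rewrite subrr powRr0 !powRr1 ?(ltW t0) //; lra.
have qg : 1 < q by rewrite lt_neqAle eq_sym qn1.
have tq : t `^ q = t * t `^ (q - 1).
  by rewrite -{2}(powRr1 (ltW t0)) -powRD ?subrKC ?(gt_eqF t0) ?implybT // addrC subrK.
have q1' : 0 < q - 1 by lra.
pose r := q / (q - 1).
have r0 : 0 < r by rewrite divr_gt0.
have hr : q^-1 + r^-1 = 1.
  by rewrite /r invf_div; field; rewrite gt_eqF.
have := conjugate_powR x0 (powR_ge0 t (q - 1)) q0 r0 hr.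
have -> : (t `^ (q - 1)) `^ r = t `^ q.
  by rewrite -powRrM /r mulrCA mulfV ?mulr1 // gt_eqF.
have -> : r^-1 = 1 - q^-1 by rewrite -hr; ring.
rewrite tq; move: (t `^ (q - 1)) (x `^ q) => u v.
move=> h.
have : q * (x * u) <= q * (v / q + t * u * (1 - q^-1)) by rewrite ler_wpM2l // ltW.
rewrite mulrDr [q * (v / q)]mulrC divfK ?gt_eqF //.
rewrite [q * (t * u * _)]mulrCA mulrBr mulr1 mulfV ?gt_eqF //; lra.
Qed.

Lemma jmoment_EFin P : (M P)%:E = (\int[mu]_(x in I) (P.[x] * w x)%:E)%E.
Proof.
rewrite /jmoment /Rintegral fineK //.
by apply: integrable_fin_num; [exact: (@measurable_I11 R)|exact: (poly_weight_integrable a1 b1)].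
Qed.

(** Jensen's inequality for the positive operator [T_y], with the convex function [|t|^q]
replaced by a polynomial majorant [G] so that [T_y] applies to it. *)
Lemma poly_tr_jensen q x y P G : 1 <= q -> I x -> I y ->
  (forall z, I z -> `|P.[z]| `^ q <= G.[z]) ->
  `|(T y P).[x]| `^ q <= (T y G).[x].
Proof.
move=> q1 Ix Iy hG; have q0 : 0 < q by exact: lt_le_trans q1.
have [t0|tn0] := eqVneq (T y P).[x] 0.
  rewrite t0 normr0 powR0 ?gt_eqF //; apply: (poly_tr_ge0 hab hb) => // z Iz.
  by apply: le_trans (hG z Iz); exact: powR_ge0.
set t := `|(T y P).[x]|; have t0 : 0 < t by rewrite normr_gt0.
pose s : R := Num.sg (T y P).[x].
have sP : s * (T y P).[x] = t by rewrite /s /t -normrEsg.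
have s1 z : s * z <= `|z|.
  apply: (le_trans (ler_norm _)); rewrite normrM normr_sg tn0 mul1r //.
pose K := q * t `^ (q - 1).
have K0 : 0 <= K by rewrite mulr_ge0 ?powR_ge0 // ltW.
have := @poly_tr_le x y ((t `^ q - K * t)%:P + (K * s) *: P) G Ix Iy.
rewrite poly_trD poly_trC poly_trZ hornerD hornerC hornerZ -(mulrA K s) sP subrK; apply.
move=> z Iz; apply: le_trans (hG z Iz); apply: le_trans (powR_tangent q1 (normr_ge0 _) t0).
rewrite hornerD hornerC hornerZ -/K.
have := ler_wpM2l K0 (s1 P.[z]); rewrite mulrA; lra.
Qed.

Lemma poly_tr_contract p y P : (1 <= p)%E -> I y ->
  wnormr a b p (horner (T y P)) <= wnormr a b p (horner P).
Proof.
case: p => [q| |//] p1 Iy.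
- have q0 := ge1_gt0 p1; have q1 : 1 <= q by rewrite -lee_fin.
  set c := wnormr a b _ (horner P); have c0 : 0 <= c by apply: wnormr_ge0.
  have w0 x : 0 <= w x by exact: jacobi_weight_ge0.
  have Lw_horner Q : Lw a b q%:E (horner Q) by apply: Lw_poly; [exact: a1|exact: b1|].
  rewrite wnormrP //; apply/(wnorm_Rle _ _ _ q0 c0).
  have : (wnorm a b q%:E (horner P) <= c%:E)%E by rewrite -wnormrP.
  move/(wnorm_Rle _ _ _ q0 c0) => hP.
  have mpw Q : measurable_fun I (fun x => (`|Q.[x]| `^ q * w x)%:E).
    by apply: wpow_measurable; exact: measurable_horner.
  have W0 := jmoment1_gt0 a1 b1.
  apply/lee_addgt0Pr => e e0.
  have e1 : 0 < e / (2 * M 1) by rewrite divr_gt0 // mulr_gt0.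
  set d := e / (2 * M 1) in e1.
  have cP : {within I, continuous (fun x => `|P.[x]| `^ q)}.
    apply: continuous_subspaceT => x.
    exact: (@cvg_norm_powR R R (nbhs x) _ q (horner P) _ q1 (@continuous_horner R P x)).
  have [G hG] := weierstrass cP e1.
  pose G' := G + d%:P.
  have hG1 z : I z -> `|P.[z]| `^ q <= G'.[z].
    by move=> /hG; rewrite /G' hornerD hornerC ler_norml => /andP[_]; lra.
  have hG2 z : I z -> G'.[z] <= `|P.[z]| `^ q + 2 * d.
    by move=> /hG; rewrite /G' hornerD hornerC ler_norml => /andP[]; lra.
  have G'0 z : I z -> 0 <= G'.[z] by move=> Iz; apply: le_trans (hG1 z Iz); exact: powR_ge0.
  have mG Q : measurable_fun I (fun x => (Q.[x] * w x)%:E).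
    apply/measurable_EFinP; apply: mul_weight_measurable; exact: measurable_horner.
  apply: (@le_trans _ _ (\int[mu]_(x in I) ((T y G').[x] * w x)%:E)%E).
    apply: ge0_le_integral => //.
    - by move=> x _; exact: wpow_ge0.
    - exact: mpw.
    - exact: mG.
    - by move=> x Ix; rewrite lee_fin; apply: ler_wpM2r => //; exact: poly_tr_jensen.
  rewrite -jmoment_EFin -[T y G']mulr1 -jpolyR0 (jmoment_poly_tr hab hb) jpolyR0.
  rewrite hornerC !mulr1 jmoment_EFin.
  apply: (@le_trans _ _ (\int[mu]_(x in I) ((`|P.[x]| `^ q * w x)%:E + ((2 * d)%:P.[x] * w x)%:E))%E).
    apply: ge0_le_integral => //.
    - by move=> x Ix; rewrite lee_fin mulr_ge0 // G'0.
    - exact: mG.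
    - by apply: emeasurable_funD; [exact: mpw|exact: mG].
    - move=> x Ix; rewrite -EFinD lee_fin hornerC -mulrDl; apply: ler_wpM2r => //; exact: hG2.
  have d20 : 0 <= 2 * d by rewrite mulr_ge0 // ltW.
  rewrite ge0_integralD; last 5 first.
  - exact: (@measurable_I11 R).
  - by move=> x _; exact: wpow_ge0.
  - exact: mpw.
  - by move=> x _; rewrite lee_fin hornerC mulr_ge0.
  - exact: mG.
  apply: leeD => //; rewrite -jmoment_EFin -[(2 * d)%:P]mulr1 mul_polyC (jmomentZ a1 b1).
  rewrite lee_fin /d mulrAC mulrA -mulrA mulrC divfK ?gt_eqF //.
  by rewrite mulr_gt0.
- have Lw_horner Q : Lw a b +oo%E (horner Q) by apply: Lw_poly; [exact: a1|exact: b1|].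
  rewrite wnormrP //; apply: ge_ereal_sup => _ [x Ix <-]; rewrite lee_fin.
  apply: poly_tr_norm_le => // z Iz; rewrite -lee_fin -wnormrE //.
  by apply: ereal_sup_ubound; exists z.
Qed.

End TranslationContraction.

(** * Coefficients of the binomial series *)

Section BinomialSeries.
Context {R : realType}.
Implicit Types (s th x e : R).

(** The coefficients of the binomial series of [(1 - x)^s]. *)
Definition bcoef s (j : nat) : R := (-1) ^+ j * gbinom s j.

Lemma bcoef0 s : bcoef s 0 = 1.
Proof. by rewrite /bcoef /gbinom big_ord0 expr0 mul1r invr1 mulr1. Qed.

Lemma bcoefS s j : bcoef s j.+1 * j.+1%:R = bcoef s j * (j%:R - s).
Proof.
rewrite /bcoef /gbinom big_ord_recr /= factS natrM exprS.
have h1 : j.+1%:R != 0 :> R by rewrite pnatr_eq0.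
have h2 : j`!%:R != 0 :> R by rewrite pnatr_eq0 -lt0n fact_gt0.
rewrite invfM; move: h1 h2; move: (\prod_(i < j) _) => A; move: (j.+1%:R : R) (j`!%:R : R) => u v h1 h2.
by field; rewrite h1 h2.
Qed.

Lemma bcoef_absorb s j : bcoef (s + 1) j.+1 * j.+1%:R = - (s + 1) * bcoef s j.
Proof.
rewrite /bcoef /gbinom big_ord_recl /= factS natrM exprS subr0.
have h1 : j.+1%:R != 0 :> R by rewrite pnatr_eq0.
have h2 : j`!%:R != 0 :> R by rewrite pnatr_eq0 -lt0n fact_gt0.
have -> : \prod_(i < j) (s + 1 - (bump 0 i)%:R) = \prod_(i < j) (s - i%:R).
  by apply: eq_bigr => i _; rewrite /bump /= add1n -natr1; ring.
rewrite invfM; move: h1 h2; move: (\prod_(i < j) _) => A; move: (j.+1%:R : R) (j`!%:R : R) => u v h1 h2.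
by field; rewrite h1 h2.
Qed.

(** Pascal's rule expresses [(1 - x)^(s+1) = (1 - x) (1 - x)^s]. *)
Lemma bcoef_pascal s j : bcoef (s + 1) j.+1 = bcoef s j.+1 - bcoef s j.
Proof.
have h1 : j.+1%:R != 0 :> R by rewrite pnatr_eq0.
apply: (mulIf h1); rewrite mulrBl bcoef_absorb bcoefS -natr1; ring.
Qed.

(** The partial sums at [x = 1]: division of [(1 - x)^s] by [1 - x]. *)
Lemma bcoef_sum s n : \sum_(j < n.+1) bcoef s j = bcoef (s - 1) n.
Proof.
elim: n => [|n IH]; first by rewrite big_ord1 !bcoef0.
by rewrite big_ord_recr /= IH -{2}(subrK 1 s) bcoef_pascal addrC subrK.
Qed.

Definition bpsum s (n : nat) x : R := \sum_(j < n) bcoef s j * x ^+ j.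

Lemma bpsum_pascal s n x : bpsum (s + 1) n.+1 x = bpsum s n.+1 x - x * bpsum s n x.
Proof.
rewrite /bpsum [in LHS]big_ord_recl [in X in _ = X - _]big_ord_recl /= !bcoef0.
rewrite -addrA; congr (_ + _); rewrite mulr_sumr -sumrB; apply: eq_bigr => i _.
by rewrite /bump /= add1n bcoef_pascal exprS; ring.
Qed.

Section Theta.
Variable th : R.
Hypothesis th0 : 0 <= th.
Hypothesis th1 : th < 1.
Local Notation S n := (bcoef (th - 1) n).

Lemma bcoef_rem_gt0 n : 0 < S n.
Proof.
elim: n => [|n IH]; first by rewrite bcoef0.
have h : 0 < S n.+1 * n.+1%:R.
  rewrite bcoefS mulr_gt0 //; have := ler0n R n; have := th1; lra.
by move: h; rewrite pmulr_lgt0 // ltr0n.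
Qed.

Lemma bcoef_tailE n : bcoef th n.+1 * n.+1%:R = - th * S n.
Proof. by have := bcoef_absorb (th - 1) n; rewrite !subrK. Qed.

Lemma bcoef_tail_le0 n : bcoef th n.+1 <= 0.
Proof.
have h : bcoef th n.+1 * n.+1%:R <= 0.
  rewrite bcoef_tailE mulr_le0_ge0 ?oppr_le0 //.
  exact: ltW (bcoef_rem_gt0 n).
by move: h; rewrite pmulr_lle0 // ltr0n.
Qed.

Lemma bcoef_rem_diff n : S n.+1 = S n + bcoef th n.+1.
Proof. by rewrite -!bcoef_sum [in LHS]big_ord_recr. Qed.

(** [S n] is the product of the [1 - th/i] for [1 <= i <= n], and
[1 - th/i <= exp (- th/i) <= (1 + 1/i)^(-th)]. *)
Lemma bcoef_rem_le n : S n <= n.+1%:R `^ (- th).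
Proof.
elim: n => [|n IH]; first by rewrite bcoef0 powR1.
have n0 : 0 < n.+1%:R :> R by rewrite ltr0n.
have hx : S n.+1 = S n * (1 - th / n.+1%:R).
  have h1 : n.+1%:R != 0 :> R by rewrite pnatr_eq0.
  apply: (mulIf h1); rewrite bcoefS -[RHS]mulrA; congr (_ * _).
  by rewrite mulrBl mul1r divfK // -natr1; ring.
set x : R := n.+1%:R^-1; have x0 : 0 < x by rewrite invr_gt0.
have E : n.+2%:R = n.+1%:R * (1 + x) :> R.
  by rewrite mulrDr mulr1 /x mulfV ?gt_eqF // natr1.
rewrite E powRM; [rewrite hx -/x|exact: ltW|by lra].
have hp : 1 - th * x <= (1 + x) `^ (- th).
  rewrite /powR gt_eqF; last by lra.
  apply: (@le_trans _ _ (expR (- th * x))); first by have := expR_ge1Dx (- th * x); lra.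
  rewrite ler_expR mulNr mulNr lerN2 ler_wpM2l //.
  by apply: le_ln1Dx; lra.
have [h|h] := leP 0 (1 - th * x).
  by apply: ler_pM => //; exact: ltW (bcoef_rem_gt0 n).
apply: (@le_trans _ _ 0); last by rewrite mulr_ge0 ?powR_ge0.
by rewrite mulr_ge0_le0 // ltW // bcoef_rem_gt0.
Qed.

Lemma bcoef_moment n :
  \sum_(j < n) j.+1%:R * - bcoef th j.+1 <= n%:R * S n / (1 - th).
Proof.
have t0 : 0 < 1 - th by have := th1; lra.
elim: n => [|n IH]; first by rewrite big_ord0 mul0r mul0r.
rewrite big_ord_recr /=; apply: (le_trans (lerD IH (lexx _))).
rewrite mulrN [n.+1%:R * bcoef th _]mulrC bcoef_tailE.
rewrite [n.+1%:R * bcoef _ _]mulrC bcoefS ler_pdivlMr // mulrDl divfK ?gt_eqF //.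
have := bcoef_rem_gt0 n; move: (S n) => z z0.
have h : 0 <= z * ((1 - th) * (1 - th)).
  by apply: mulr_ge0; [exact: ltW|apply: mulr_ge0; exact: ltW].
nra.
Qed.

(** [S N] is minus the sum of the coefficients after the [N]-th, up to the vanishing limit of
[S]. *)
Lemma bcoef_tail_sum N k :
  \sum_(j < k) - bcoef th (N + j).+1 = S N - S (N + k).
Proof.
elim: k => [|k IH]; first by rewrite big_ord0 addn0 subrr.
by rewrite big_ord_recr /= IH addnS bcoef_rem_diff; ring.
Qed.

Lemma bcoef_abs_sum n : \sum_(j < n) `|bcoef th j| <= 2.
Proof.
case: n => [|n]; first by rewrite big_ord0.
rewrite big_ord_recl bcoef0 normr1.
have -> : \sum_(i < n) `|bcoef th (lift ord0 i)| = 1 - S n.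
  have -> : 1 - S n = S 0 - S (0 + n) by rewrite bcoef0 add0n.
  rewrite -bcoef_tail_sum; apply: eq_bigr => i _.
  by rewrite /= /bump /= add1n add0n ler0_norm // bcoef_tail_le0.
have := bcoef_rem_gt0 n; lra.
Qed.

(** Splitting the sum at [N] close to [1/e] uses the bound [j e] before [N] and the bound [2]
after it; both parts are of order [S N <= (N + 1)^(-th)]. *)
Lemma bcoef_min_sum e : 0 < e -> exists N : nat, forall k,
  S (N + k) + \sum_(j < N + k) - bcoef th j.+1 * Num.min 2 (j.+1%:R * e)
  <= ((1 - th)^-1 + 2) * e `^ th.
Proof.
move=> e0; have t0 : 0 < 1 - th by have := th1; lra.
have ei0 : 0 <= e^-1 by rewrite invr_ge0 ltW.
have := truncn_itv ei0; set N := Num.truncn _ => /andP[N1 N2].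
exists N => k.
rewrite big_split_ord /=.
have h1 : \sum_(j < N) - bcoef th j.+1 * Num.min 2 (j.+1%:R * e) <= S N / (1 - th).
  apply: (@le_trans _ _ ((\sum_(j < N) j.+1%:R * - bcoef th j.+1) * e)).
    rewrite mulr_suml; apply: ler_sum => j _.
    rewrite [j.+1%:R * - _]mulrC -mulrA; apply: ler_wpM2l; first by rewrite oppr_ge0 bcoef_tail_le0.
    by rewrite ge_min lexx orbT.
  apply: (le_trans (ler_wpM2r (ltW e0) (bcoef_moment N))).
  rewrite mulrAC ler_wpM2r ?invr_ge0 ?(ltW t0) // mulrAC ler_piMl ?(ltW (bcoef_rem_gt0 N)) //.
  by rewrite -ler_pdivlMr // mul1r.
have h2 : \sum_(j < k) - bcoef th (N + j).+1 * Num.min 2 ((N + j).+1%:R * e)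
          <= 2 * (S N - S (N + k)).
  rewrite -bcoef_tail_sum mulr_sumr; apply: ler_sum => j _.
  rewrite [2 * _]mulrC; apply: ler_wpM2l; first by rewrite oppr_ge0 bcoef_tail_le0.
  by rewrite ge_min lexx.
have h3 : S N <= e `^ th.
  apply: (le_trans (bcoef_rem_le N)).
  have -> : e `^ th = (e^-1 `^ th)^-1.
    by rewrite -powRN -powR_inv1 ?(ltW e0) // -powRrM mulrNN mul1r.
  rewrite powRN lef_pV2 ?posrE ?powR_gt0 ?invr_gt0 ?ltr0n //.
  by apply: ge0_ler_powR; rewrite ?nnegrE ?invr_ge0 ?(ltW e0) //; exact: ltW.
have h4 := bcoef_rem_gt0 (N + k).
have h5 : ((1 - th)^-1 + 2) * S N <= ((1 - th)^-1 + 2) * e `^ th.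
  by rewrite ler_wpM2l // addr_ge0 // invr_ge0 ltW.
apply: le_trans h5; move: h1 h2 h4.
move: (S N) (S (N + k)) => A B; move: (\sum_(j < N) _) (\sum_(j < k) _) => D E.
move: ((1 - th)^-1) => y; lra.
Qed.

End Theta.

End BinomialSeries.

(** * Fractional powers of I - T *)

Section BinomialFunction.
Context {R : realType}.
Implicit Types (s th x e : R).

(** Induction on the integer part. *)
Lemma nonneg_frac_ind (P : R -> Prop) :
  (forall th, 0 <= th -> th < 1 -> P th) -> (forall s, 0 <= s -> P s -> P (s + 1)) ->
  forall s, 0 <= s -> P s.
Proof.
move=> h0 h1 s s0; have := truncn_itv s0; set N := Num.truncn s => /andP[N1 N2].
have -> : s = (s - N%:R) + N%:R by rewrite subrK.
have t0 : 0 <= s - N%:R by rewrite subr_ge0.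
have t1 : s - N%:R < 1 by move: N2; rewrite -natr1; lra.
move: (s - N%:R) t0 t1 => th t0 t1.
elim: N {N1 N2} => [|n IH]; first by rewrite addr0; exact: h0.
by rewrite -natr1 addrA; apply: h1 => //; rewrite addr_ge0.
Qed.

Lemma bcoef_summable s : 0 <= s ->
  exists A : R, forall n, \sum_(j < n) `|bcoef s j| <= A.
Proof.
move: s; apply: nonneg_frac_ind => [th th0 th1|s s0 [A hA]].
  by exists 2 => n; exact: bcoef_abs_sum.
have A0 : 0 <= A by have := hA 0%N; rewrite big_ord0.
exists (A + A) => -[|n]; first by rewrite big_ord0 addr_ge0.
rewrite big_ord_recl bcoef0 normr1.
apply: (@le_trans _ _ (1 + (\sum_(i < n) `|bcoef s i.+1| + \sum_(i < n) `|bcoef s i|))).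
  rewrite lerD2l -big_split /=; apply: ler_sum => i _.
  by rewrite /bump /= add1n bcoef_pascal ler_normB.
rewrite addrA; apply: lerD => //.
have := hA n.+1; rewrite big_ord_recl bcoef0 normr1; apply: le_trans; rewrite lerD2l.
by apply: ler_sum => i _.
Qed.

(** The value of [(1 - x)^s] as the sum of its binomial series, for [|x| <= 1]. *)
Definition bpow s x : R := limn (fun n => bpsum s n x).

Lemma bpow_cvg s x : 0 <= s -> `|x| <= 1 -> bpsum s n x @[n --> \oo] --> bpow s x.
Proof.
move=> s0 x1; have [A hA] := bcoef_summable s0.
apply: (@cvg_bounded_variation _ _ A) => n; apply: le_trans (hA n).
rewrite big_mkord; apply: ler_sum => j _.
have -> : bpsum s j.+1 x - bpsum s j x = bcoef s j * x ^+ j.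
  by rewrite /bpsum big_ord_recr /=; ring.
rewrite normrM normrX ler_piMr //.
by rewrite exprn_ile1.
Qed.

Lemma bpowS s x : 0 <= s -> `|x| <= 1 -> bpow (s + 1) x = (1 - x) * bpow s x.
Proof.
move=> s0 x1; have s1 : 0 <= s + 1 by lra.
have h1 := bpow_cvg s1 x1; have h2 := bpow_cvg s0 x1.
have h1' : bpsum (s + 1) n.+1 x @[n --> \oo] --> bpow (s + 1) x by rewrite (cvg_shiftS (fun n => bpsum (s + 1) n x)).
have h2' : bpsum s n.+1 x @[n --> \oo] --> bpow s x by rewrite (cvg_shiftS (fun n => bpsum s n x)).
rewrite mulrBl mul1r.
have h3 : bpsum s n.+1 x - x * bpsum s n x @[n --> \oo] --> bpow s x - x * bpow s x.
  by apply: cvgB => //; apply: cvgM => //; exact: cvg_cst.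
have E : (fun n => bpsum s n.+1 x - x * bpsum s n x) = (fun n => bpsum (s + 1) n.+1 x).
  by apply/funext => n; rewrite bpsum_pascal.
by rewrite E in h3; exact: (cvg_unique _ h1' h3).
Qed.

End BinomialFunction.

Section FractionalPowers.
Context {R : realType}.
Variables a b : R.
Hypothesis hab : b <= a.
Hypothesis hb : - (1 / 2) <= b.
Variable p : \bar R.
Hypothesis p1 : (1 <= p)%E.
Local Notation I := (`[(-1 : R)%R, (1 : R)%R]%classic).
Local Notation Rk := (jpolyR a b).
Local Notation T := (poly_tr a b).
Local Notation nrp P := (wnormr a b p (horner P)).
Local Notation a1 := (jacobi_a_gtN1 hab hb).
Local Notation b1 := (jacobi_b_gtN1 hb).
Implicit Types (P Q : {poly R}) (y s th e : R) (n : nat).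

(** [R_k] is an eigenfunction of the contraction [T_y], with eigenvalue [R_k(y)]. *)
Lemma jpolyR_le1 k y : I y -> `|(Rk k).[y]| <= 1.
Proof.
move=> Iy; have h := poly_tr_contract hab hb (Rk k) p1 Iy.
have E : T y (Rk k) = (Rk k).[y] *: Rk k.
  rewrite (poly_tr_jmul hab hb); apply: (jmul_unique a1 b1) => j.
  rewrite -scalerAl (jmomentZ a1 b1).
  have [->//|jk] := eqVneq j k.
  by rewrite (jmoment_jpolyR_orth a1 b1) ?mulr0 // eq_sym.
have n0 : 0 < nrp (Rk k).
  rewrite lt_neqAle wnormr_ge0 // andbT eq_sym; apply/eqP => h0.
  by have := jpolyR_neq0 a1 b1 k; rewrite (wnormr_poly_eq0 a1 b1 p1 h0) eqxx.
by rewrite E (wnormr_polyZ a1 b1 p1) -ler_pdivlMr // mulfV ?gt_eqF // in h.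
Qed.

Lemma jmul_exp y j P : jmul a b (fun k => (Rk k).[y] ^+ j) P = iter j (T y) P.
Proof.
elim: j => [|j IH].
  by rewrite -[RHS](jmul1 a1 b1); apply: (eq_jmul a1 b1) => k; rewrite expr0.
rewrite iterS -IH (poly_tr_jmul hab hb) -(jmul_comp a1 b1).
by apply: (eq_jmul a1 b1) => k; rewrite exprS.
Qed.

Lemma size_iter_tr y j P : (size (iter j (T y) P) <= size P)%N.
Proof.
elim: j => [//|j IH]; rewrite iterS; apply: leq_trans IH; exact: (size_poly_tr hab hb).
Qed.

Lemma iter_tr_contract y j P : I y -> nrp (iter j (T y) P) <= nrp P.
Proof.
move=> Iy; elim: j => [//|j IH]; rewrite iterS; apply: le_trans IH.
exact: (poly_tr_contract hab hb).
Qed.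

Lemma jmul_bsum y s m n P :
  jmul a b (fun k => \sum_(j < n) bcoef s (m + j) * (Rk k).[y] ^+ (m + j)) P =
  \sum_(j < n) bcoef s (m + j) *: iter (m + j) (T y) P.
Proof.
elim: n => [|n IH].
  rewrite big_ord0; apply: (jmul_unique a1 b1) => k.
  by rewrite big_ord0 !mul0r (jmoment0 a1 b1).
rewrite big_ord_recr /= -IH -jmul_exp -[X in _ = X + _]scale1r -(jmul_lin a1 b1).
by apply: (eq_jmul a1 b1) => k; rewrite big_ord_recr /= mul1r.
Qed.

(** Tails of the binomial series of [(I - T_y)^s], uniformly in [y] and [P]. *)
Lemma binomial_tail s : 0 <= s -> exists tau : nat -> R,
  [/\ forall n, 0 <= tau n, tau n @[n --> \oo] --> (0 : R) &
   forall n y P, I y ->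
   nrp (jmul a b (fun k => bpow s (Rk k).[y] - bpsum s n (Rk k).[y]) P) <= tau n * nrp P].
Proof.
move=> s0; have [A hA] := bcoef_summable s0.
pose B n := \sum_(j < n) `|bcoef s j|.
have ndB : {homo B : n m / (n <= m)%N >-> n <= m}.
  by apply/nondecreasing_seqP => n; rewrite /B big_ord_recr /= lerDl.
have cB : cvgn B.
  by apply: nondecreasing_is_cvgn => //; exists A => _ [n _ <-]; exact: hA.
have leB n : B n <= limn B by apply: nondecreasing_cvgn_le.
exists (fun n => limn B - B n); split.
- by move=> n; rewrite subr_ge0.
- by rewrite -(subrr (limn B)); apply: cvgB => //; exact: cvg_cst.
move=> n y P Iy.
apply: (@jmul_lim _ a b a1 b1 p p1 (fun N k => \sum_(j < N) bcoef s (n + j) * (Rk k).[y] ^+ (n + j))).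
  move=> k.
  have -> : (fun N => \sum_(j < N) bcoef s (n + j) * (Rk k).[y] ^+ (n + j)) =
            (fun N => bpsum s (N + n) (Rk k).[y] - bpsum s n (Rk k).[y]).
    by apply/funext => N; rewrite addnC /bpsum big_split_ord /=; ring.
  apply: cvgB; last exact: cvg_cst.
  rewrite (cvg_shiftn n (fun N => bpsum s N (Rk k).[y])); apply: bpow_cvg => //.
  exact: jpolyR_le1.
move=> N; rewrite jmul_bsum.
apply: (le_trans (wnormr_poly_sum a1 b1 p1 N (fun j => bcoef s (n + j) *: iter (n + j) (T y) P))).
apply: (@le_trans _ _ ((B (n + N)%N - B n) * nrp P)); last first.
  by rewrite ler_wpM2r ?wnormr_ge0 // lerD2r.
have -> : B (n + N)%N - B n = \sum_(j < N) `|bcoef s (n + j)|.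
  by rewrite /B big_split_ord /=; ring.
rewrite mulr_suml; apply: ler_sum => j _.
by rewrite (wnormr_polyZ a1 b1 p1) ler_wpM2l // iter_tr_contract.
Qed.

(** [I - T^j] telescopes into [j] terms [T^i (I - T)]. *)
Lemma iter_tr_diff y e n j Q : I y -> 0 <= e ->
  (forall Q, (size Q <= n)%N -> nrp (Q - T y Q) <= e * nrp Q) -> (size Q <= n)%N ->
  nrp (Q - iter j (T y) Q) <= Num.min 2 (j%:R * e) * nrp Q.
Proof.
move=> Iy e0 he sQ; rewrite minr_pMl ?wnormr_ge0 // le_min; apply/andP; split.
  apply: (le_trans (wnormr_polyB a1 b1 p1 _ _)).
  by have := iter_tr_contract j Q Iy; lra.
elim: j => [|j IH].
  rewrite subrr mul0r mul0r -(scale0r 0) (wnormr_polyZ a1 b1 p1) normr0 mul0r //.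
rewrite iterS -[Q - _](subrKA (iter j (T y) Q)).
apply: (le_trans (wnormr_polyD a1 b1 p1 _ _)).
have h1 : nrp (iter j (T y) Q - T y (iter j (T y) Q)) <= e * nrp Q.
  apply: (le_trans (he _ (leq_trans (size_iter_tr y j Q) sQ))).
  by rewrite ler_wpM2l // iter_tr_contract.
apply: (le_trans (lerD IH h1)); rewrite -natr1; lra.
Qed.

(** If [I - T_y] has norm at most [e] on polynomials of size at most [n], then [(I - T_y)^s] has
norm of order [e^s] there.  For [0 < s < 1] the series is regrouped as in
[S K Q - sum_(j >= 1) bcoef_j (Q - T^j Q)], where all [- bcoef_j] are nonnegative. *)
Lemma frac_power_bound s : 0 <= s -> exists2 C : R, 0 <= C &
  forall y e n, I y -> 0 < e ->
  (forall Q, (size Q <= n)%N -> nrp (Q - T y Q) <= e * nrp Q) ->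
  forall Q, (size Q <= n)%N ->
  nrp (jmul a b (fun k => bpow s (Rk k).[y]) Q) <= C * e `^ s * nrp Q.
Proof.
move: s; apply: nonneg_frac_ind => [th th0 th1|s s0 [C C0 hC]].
  exists ((1 - th)^-1 + 2) => [|y e n Iy e0 he Q sQ].
    by rewrite addr_ge0 // invr_ge0; lra.
  have [N hN] := bcoef_min_sum th0 th1 e0.
  apply: (@jmul_lim _ a b a1 b1 p p1
    (fun i k => \sum_(j < (N + i).+1) bcoef th (0 + j) * (Rk k).[y] ^+ (0 + j))).
    move=> k; have := bpow_cvg th0 (jpolyR_le1 k Iy).
    rewrite -(cvg_shiftn N.+1); apply: cvg_trans; apply: near_eq_cvg; apply: nearW => i.
    by rewrite /= /bpsum addnS addnC.
  move=> i; rewrite jmul_bsum.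
  have -> : \sum_(j < (N + i).+1) bcoef th (0 + j) *: iter (0 + j) (T y) Q =
     bcoef (th - 1) (N + i) *: Q +
     \sum_(j < N + i) - bcoef th j.+1 *: (Q - iter j.+1 (T y) Q).
    rewrite -bcoef_sum scaler_suml !big_ord_recl /= -addrA; congr (_ + _).
    rewrite -big_split /=; apply: eq_bigr => j _.
    by rewrite /bump /= !add1n scalerBr !scaleNr opprK addrA subrr add0r.
  apply: (le_trans (wnormr_polyD a1 b1 p1 _ _)).
  rewrite (wnormr_polyZ a1 b1 p1) gtr0_norm ?bcoef_rem_gt0 //.
  apply: (le_trans (lerD (lexx _) (wnormr_poly_sum a1 b1 p1 (N + i)
    (fun j => - bcoef th j.+1 *: (Q - iter j.+1 (T y) Q))))).
  apply: le_trans (ler_wpM2r (wnormr_ge0 a b p1 _) (hN i)).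
  rewrite mulrDl lerD2l mulr_suml; apply: ler_sum => j _.
  rewrite (wnormr_polyZ a1 b1 p1) ger0_norm ?oppr_ge0 ?bcoef_tail_le0 // -mulrA.
  rewrite ler_wpM2l ?oppr_ge0 ?bcoef_tail_le0 //.
  exact: (@iter_tr_diff _ _ n _ _ Iy (ltW e0)).
exists C => // y e n Iy e0 he Q sQ.
have -> : jmul a b (fun k => bpow (s + 1) (Rk k).[y]) Q =
  jmul a b (fun k => bpow s (Rk k).[y]) Q - T y (jmul a b (fun k => bpow s (Rk k).[y]) Q).
  rewrite (poly_tr_jmul hab hb) -(jmul_comp a1 b1) -[X in _ = X - _]scale1r -[X in _ = _ + X]scaleN1r.
  rewrite -(jmul_lin a1 b1); apply: (eq_jmul a1 b1) => k.
  by rewrite bpowS ?jpolyR_le1 //; ring.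
apply: (le_trans (he _ (leq_trans (size_jmul a1 b1 _ _) sQ))).
apply: (le_trans (ler_wpM2l (ltW e0) (hC y e n Iy e0 he Q sQ))).
rewrite powRD ?(gt_eqF e0) ?implybT // powRr1 ?(ltW e0) //.
by rewrite !mulrA [e * C]mulrC -[C * e * _]mulrA [e * _]mulrC !mulrA.
Qed.

End FractionalPowers.

(** * Chebyshev nodes and the Bernstein inequality *)

Section Chebyshev.
Context {R : realType}.
Implicit Types (x : nat -> R) (G : {poly R}).

Lemma sin_le_id (v : R) : 0 <= v -> sin v <= v.
Proof.
rewrite le_eqVlt => /orP[/eqP <-|v0]; first by rewrite sin0.
have [c _] := @MVT R sin cos 0 v v0 (fun z _ => is_derive_sin z)
  (continuous_subspaceT (@continuous_sin R)).
by rewrite sin0 !subr0 => ->; rewrite ler_piMl ?cos_le1 // ltW.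
Qed.

(** [1 - cos u = 2 (sin (u/2))^2]. *)
Lemma one_sub_cos_le (u : R) : 0 <= u -> u <= 1 -> 1 - cos u <= u ^+ 2 / 2.
Proof.
move=> u0 u1; have v0 : 0 <= u / 2 by lra.
have -> : u = (u / 2) *+ 2 by rewrite mulr2n -splitr.
move: v0; set v := u / 2 => v0; rewrite cos_mulr2n.
have s0 : 0 <= sin v.
  by apply: sin_ge0_pi; rewrite v0 /=; have := pi_ge2 R; rewrite /v; lra.
have h := ler_pM s0 s0 (sin_le_id v0) (sin_le_id v0).
have := cos2Dsin2 v; rewrite !expr2 in h *; rewrite mulr2n; lra.
Qed.

Lemma cos_natpi j : cos (j%:R * pi) = (-1) ^+ j :> R.
Proof.
elim: j => [|j IH]; first by rewrite mul0r cos0.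
by rewrite -natr1 mulrDl mul1r cosDpi IH exprS mulN1r.
Qed.

(** The Chebyshev polynomials of orders [n] and [n + 1]. *)
Fixpoint cheb_pair n : {poly R} * {poly R} :=
  if n is m.+1 then
    let: (P, Q) := cheb_pair m in (Q, 2 *: ('X * Q) - P)
  else (1, 'X).

Lemma cheb_pair_cos n s :
  (cheb_pair n).1.[cos s] = cos (n%:R * s) /\ (cheb_pair n).2.[cos s] = cos (n.+1%:R * s).
Proof.
elim: n => [|n]; first by rewrite /= hornerC hornerX mul0r cos0 mul1r.
rewrite /=; case: (cheb_pair n) => P Q /= [hP hQ]; split => //.
rewrite hornerD hornerN hornerZ (mulrC 'X) hornerMX hP hQ.
have -> : n.+2%:R * s = n.+1%:R * s + s by rewrite -[n.+2%:R]natr1 mulrDl mul1r.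
have -> : n%:R * s = n.+1%:R * s - s by rewrite -[n.+1%:R]natr1 mulrDl mul1r addrK.
by rewrite cosB cosD; ring.
Qed.

Lemma size_cheb_pair n : (size (cheb_pair n).1 <= n.+1)%N /\ (size (cheb_pair n).2 <= n.+2)%N.
Proof.
elim: n => [|n]; first by rewrite /= size_poly1 size_polyX.
rewrite /=; case: (cheb_pair n) => P Q /= [hP hQ]; split => //.
apply: (leq_trans (size_polyD _ _)); rewrite geq_max size_polyN; apply/andP; split.
  apply: (leq_trans (size_scale_leq _ _)); apply: (leq_trans (size_polyMleq _ _)).
  by rewrite size_polyX /= ltnS.
by apply: (leq_trans hP); rewrite ltnW.
Qed.

Definition lag_factor x j i : {poly R} := (x j - x i)^-1 *: ('X - (x i)%:P).

Definition lagrange_poly x n j : {poly R} :=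
  (\prod_(0 <= i < j) lag_factor x j i) * (\prod_(j.+1 <= i < n.+1) lag_factor x j i).

Lemma size_prod_linear m n (F : nat -> {poly R}) : (forall i, (size (F i) <= 2)%N) ->
  (size (\prod_(m <= i < n) F i)%R <= (n - m).+1)%N.
Proof.
move=> hF; elim: n => [|n IH]; first by rewrite big_geq // size_poly1.
have [mn|nm] := leqP m n; last by rewrite big_geq // size_poly1.
rewrite big_nat_recr //=; apply: (leq_trans (size_polyMleq _ _)).
have := hF n; move: IH; set u := size (\prod_(m <= i < n) F i)%R; set v := size (F n); lia.
Qed.

Lemma size_lag_factor x j i : (size (lag_factor x j i) <= 2)%N.
Proof. by apply: (leq_trans (size_scale_leq _ _)); rewrite size_XsubC. Qed.

Lemma size_lagrange_poly x n j : (j <= n)%N -> (size (lagrange_poly x n j) <= n.+1)%N.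
Proof.
move=> jn; apply: (leq_trans (size_polyMleq _ _)).
have := size_prod_linear 0 j (size_lag_factor x j).
have := size_prod_linear j.+1 n.+1 (size_lag_factor x j).
by rewrite subn0; lia.
Qed.

Lemma lag_factorE x j i y : (lag_factor x j i).[y] = (y - x i) / (x j - x i).
Proof. by rewrite hornerZ hornerXsubC mulrC. Qed.

Lemma lagrange_node x n j k : (forall i i', (i < i' <= n)%N -> x i != x i') ->
  (j <= n)%N -> (k <= n)%N -> (lagrange_poly x n j).[x k] = (j == k)%:R.
Proof.
move=> xi jn kn; rewrite hornerM !horner_prod.
have [<-|jk] := eqVneq j k.
  rewrite !big1_seq ?mulr1 // => i /andP[_]; rewrite mem_index_iota => /andP[h1 h2];
  rewrite lag_factorE mulfV // subr_eq0.
    by apply: xi; rewrite h1 -ltnS.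
  by rewrite eq_sym; apply: xi; rewrite h2.
move: jk; rewrite neq_ltn => /orP[jk|kj].
  have kin : k \in index_iota j.+1 n.+1 by rewrite mem_index_iota jk ltnS.
  by rewrite [X in _ * X](big_rem k) //= lag_factorE subrr mul0r mul0r mulr0.
have kin : k \in index_iota 0 j by rewrite mem_index_iota.
by rewrite (big_rem k) //= lag_factorE subrr mul0r !mul0r.
Qed.

Lemma lagrange_interpolation x n G : (forall i i', (i < i' <= n)%N -> x i != x i') ->
  (size G <= n.+1)%N -> G = \sum_(j < n.+1) G.[x j] *: lagrange_poly x n j.
Proof.
move=> xi sG; apply/eqP; rewrite -subr_eq0; apply/eqP.
apply: (@roots_geq_poly_eq0 _ _ [seq x i | i <- iota 0 n.+1]).
- apply/allP => y /mapP[k]; rewrite mem_iota add0n /= => kn ->.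
  rewrite /root hornerD hornerN horner_sum (bigD1 (Ordinal kn)) //= big1 ?addr0.
    by rewrite hornerZ lagrange_node // eqxx mulr1 subrr.
  move=> i ik; rewrite hornerZ lagrange_node //; last by rewrite -ltnS.
  have -> : (nat_of_ord i == k) = false by apply/negbTE; apply: contraNneq ik => ik; apply/eqP/val_inj.
  by rewrite mulr0.
- rewrite map_inj_in_uniq ?iota_uniq // => i j.
  rewrite !mem_iota !add0n /= !ltnS => hi hj xij; apply/eqP; apply: contraT.
  rewrite neq_ltn => /orP[ij|ji].
    by have := xi i j; rewrite ij hj xij eqxx => /(_ isT).
  by have := xi j i; rewrite ji hi xij eqxx => /(_ isT).
- rewrite size_map size_iota; apply: (leq_trans (size_polyD _ _)).
  rewrite geq_max sG size_polyN; apply: (leq_trans (size_sum _ _ _)).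
  apply/bigmax_leqP => i _; apply: (leq_trans (size_scale_leq _ _)).
  by apply: size_lagrange_poly; rewrite -ltnS.
Qed.

Lemma prod_nonpos_sign m n (F : nat -> R) : (m <= n)%N ->
  (forall i, (m <= i < n)%N -> F i <= 0) -> 0 <= (-1) ^+ (n - m) * \prod_(m <= i < n) F i.
Proof.
elim: n => [|n IH] mn hF; first by rewrite big_geq // mulr1 sub0n expr0.
move: mn; rewrite leq_eqVlt => /orP[/eqP ->|]; first by rewrite subnn big_geq // mulr1 expr0.
rewrite ltnS => mn.
rewrite big_nat_recr //= subSn // exprS.
have h : 0 <= (-1) ^+ (n - m) * \prod_(m <= i < n) F i.
  by apply: IH => // i /andP[h1 h2]; apply: hF; rewrite h1 ltnW.
have Fn : F n <= 0 by apply: hF; rewrite mn ltnSn.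
rewrite (_ : _ * _ = ((-1) ^+ (n - m) * \prod_(m <= i < n) F i) * - F n); last by ring.
by rewrite mulr_ge0 // oppr_ge0.
Qed.

Lemma prod_nonneg m n (F : nat -> R) :
  (forall i, (m <= i < n)%N -> 0 <= F i) -> 0 <= \prod_(m <= i < n) F i.
Proof. by move=> h; rewrite big_nat_cond prodr_ge0 // => i /andP[/h]. Qed.

(** For nodes that decrease from [1], and [c] between the first two of them, the coefficients of
[G |-> G(1) - G(c)] alternate in sign: only the factors with [0 < i < j] of the [j]-th
Lagrange polynomial are negative at [c]. *)
Lemma lagrange_diff_sign x n (c : R) j :
  (forall i i', (i < i' <= n)%N -> x i' < x i) -> x 0%N = 1 -> c <= 1 ->
  (forall i, (0 < i <= n)%N -> x i <= c) -> (j <= n)%N ->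
  0 <= (-1) ^+ j * ((lagrange_poly x n j).[1] - (lagrange_poly x n j).[c]).
Proof.
move=> xd x0 c1 xc jn.
have xi i i' : (i < i' <= n)%N -> x i != x i' by move=> h; rewrite gt_eqF // xd.
have -> : (lagrange_poly x n j).[1] = (j == 0%N)%:R by have := lagrange_node xi jn (leq0n n); rewrite x0.
rewrite hornerM !horner_prod.
have right i : (j.+1 <= i < n.+1)%N -> 0 <= (lag_factor x j i).[c].
  move=> /andP[h1 h2]; rewrite lag_factorE divr_ge0 // subr_ge0.
    by apply: xc; rewrite (leq_trans _ h1).
  by apply/ltW/xd; rewrite h1 -ltnS.
case: j jn right => [|j] jn right.
  rewrite expr0 mul1r big_geq // mul1r subr_ge0 big_nat_cond.
  apply: prodr_ile1 => i /andP[hi _]; rewrite right //= lag_factorE x0.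
  have h : x i < 1 by rewrite -x0; apply: xd; move: hi; rewrite ltnS.
  by rewrite ler_pdivrMr ?subr_gt0 // mul1r lerD2r.
rewrite sub0r big_ltn // lag_factorE -mulrA.
have q0 : 0 <= (c - x 0%N) / (x j.+1 - x 0%N).
  rewrite -mulrNN -invrN !opprB divr_ge0 // subr_ge0; first by rewrite x0.
  by apply/ltW/xd; rewrite jn.
have := @prod_nonpos_sign 1 j.+1 (fun i => (lag_factor x j.+1 i).[c]) isT.
rewrite subSS subn0 exprS => h.
have {}h : 0 <= (-1) ^+ j * \prod_(1 <= i < j.+1) (lag_factor x j.+1 i).[c].
  apply: h => i /andP[h1 h2]; rewrite lag_factorE.
  rewrite mulr_ge0_le0 ?subr_ge0 ?xc ?h1 ?(leq_trans (ltnW h2)) //.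
  by rewrite invr_le0 subr_le0; apply/ltW/xd; rewrite h2.
have := mulr_ge0 (mulr_ge0 q0 h) (prod_nonneg right).
move=> H; apply: (le_trans H); rewrite le_eqVlt; apply/orP; left; apply/eqP; ring.
Qed.

End Chebyshev.

Section Bernstein.
Context {R : realType}.
Variables a b : R.
Hypothesis hab : b <= a.
Hypothesis hb : - (1 / 2) <= b.
Variable p : \bar R.
Hypothesis p1 : (1 <= p)%E.
Local Notation I := (`[(-1 : R)%R, (1 : R)%R]%classic).
Local Notation T := (poly_tr a b).
Local Notation nrp P := (wnormr a b p (horner P)).
Local Notation a1 := (jacobi_a_gtN1 hab hb).
Local Notation b1 := (jacobi_b_gtN1 hb).

Lemma cos_itv (s : R) : I (cos s).
Proof. by rewrite /= in_itv /= cos_geN1 cos_le1. Qed.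

(** The coefficients [g j] of [G |-> G(1) - G(cos t)] at the extrema of the Chebyshev polynomial
have the signs of its values there, so [sum_j |g j|] is the functional at that polynomial. *)
Lemma translation_bernstein (t : R) n (Q : {poly R}) : (0 < n)%N -> 0 < t -> n%:R * t <= 1 ->
  (size Q <= n.+1)%N -> nrp (Q - T (cos t) Q) <= (n%:R * t) ^+ 2 / 2 * nrp Q.
Proof.
move=> n0 t0 nt sQ.
have nR : 0 < n%:R :> R by rewrite ltr0n.
have pi0 := pi_gt0 R; have pi2 := pi_ge2 R.
(* The extrema of the Chebyshev polynomial of order n; t <= 1 / n < pi / n puts cos t
between the first two. *)
pose x (j : nat) : R := cos (j%:R * (pi / n%:R)).
have ang j : (j <= n)%N -> j%:R * (pi / n%:R) \in `[0, pi : R].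
  move=> jn; rewrite in_itv /= mulr_ge0 ?divr_ge0 ?(ltW pi0) //= mulrA ler_pdivrMr //.
  by rewrite mulrC ler_wpM2l ?(ltW pi0) // ler_nat.
have xd i i' : (i < i' <= n)%N -> x i' < x i.
  move=> /andP[h1 h2]; rewrite /x ltr_cos ?ang // ?(ltnW (leq_trans h1 h2)) //.
  by rewrite ltr_pM2r ?divr_gt0 // ltr_nat.
have x0 : x 0%N = 1 by rewrite /x mul0r cos0.
have tn : t <= pi / n%:R by rewrite ler_pdivlMr // mulrC; lra.
have tpi : t \in `[0, pi : R].
  have /andP[_ h] := ang 1%N n0; rewrite mul1r in h.
  by rewrite in_itv /= (ltW t0) (le_trans tn).
have xc i : (0 < i <= n)%N -> x i <= cos t.
  move=> /andP[h1 h2]; have := leP (x i) (cos t); case => //.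
  rewrite /x ltr_cos ?ang // => h.
  have d0 : 0 <= pi / n%:R :> R by rewrite divr_ge0 ?(ltW pi0).
  have i1 : 1 <= i%:R :> R by rewrite ler1n.
  have := ler_wpM2r d0 i1; rewrite mul1r; lra.
have xi i i' : (i < i' <= n)%N -> x i != x i' by move=> h; rewrite gt_eqF // xd.
pose g j := (lagrange_poly x n j).[1] - (lagrange_poly x n j).[cos t].
have gs j : (j <= n)%N -> `|g j| = (-1) ^+ j * g j.
  move=> jn; have h := lagrange_diff_sign xd x0 (cos_le1 t) xc jn.
  by rewrite -[RHS]ger0_norm // normrM normrX normrN1 expr1n mul1r.
have func (G : {poly R}) : (size G <= n.+1)%N ->
    G.[1] - G.[cos t] = \sum_(j < n.+1) G.[x j] * g j.
  move=> sG; rewrite {1 2}(lagrange_interpolation xi sG) !horner_sum -sumrB.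
  by apply: eq_bigr => j _; rewrite !hornerZ -mulrBr.
have sumg : \sum_(j < n.+1) `|g j| <= (n%:R * t) ^+ 2 / 2.
  have [sV _] := @size_cheb_pair R n; have := func _ sV.
  rewrite -[X in _.[X] - _](cos0 R) !(cheb_pair_cos n _).1 mulr0 cos0 => hV.
  apply: (@le_trans _ _ (1 - cos (n%:R * t))); last first.
    by apply: one_sub_cos_le => //; rewrite mulr_ge0 // ltW.
  rewrite hV le_eqVlt; apply/orP; left; apply/eqP; apply: eq_bigr => j _.
  have jn : (j <= n)%N by rewrite -ltnS.
  rewrite gs // /x (cheb_pair_cos n _).1.
  have -> : n%:R * (j%:R * (pi / n%:R)) = j%:R * pi :> R by field; rewrite gt_eqF.
  by rewrite cos_natpi.
have E z : (Q - T (cos t) Q).[z] = (\sum_(j < n.+1) g j *: T (x j) Q).[z].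
  have h := func (T z Q) (leq_trans (size_poly_tr hab hb z Q) sQ).
  have e1 : (T z Q).[1] = Q.[z] by rewrite horner_poly_tr_sym (poly_tr1 _ hb).
  have e2 : (T z Q).[cos t] = (T (cos t) Q).[z] by exact: horner_poly_tr_sym.
  rewrite e1 e2 in h; rewrite hornerD hornerN h horner_sum; apply: eq_bigr => j _.
  by rewrite hornerZ mulrC; congr (_ * _); exact: horner_poly_tr_sym.
rewrite (@eq_wnormr _ _ _ _ _ _ (fun z _ => E z)).
apply: (le_trans (wnormr_poly_sum a1 b1 p1 n.+1 (fun j => g j *: T (x j) Q))).
apply: le_trans (ler_wpM2r (wnormr_ge0 a b p1 _) sumg); rewrite mulr_suml.
apply: ler_sum => j _; rewrite (wnormr_polyZ a1 b1 p1) ler_wpM2l //.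
by apply: (poly_tr_contract hab hb) => //; exact: cos_itv.
Qed.

End Bernstein.

(** * Translations and differences on the weighted spaces *)

Section OperatorsOnLw.
Context {R : realType}.
Variables a b : R.
Hypothesis hab : b <= a.
Hypothesis hb : - (1 / 2) <= b.
Variable p : \bar R.
Hypothesis p1 : (1 <= p)%E.
Local Notation mu := (@lebesgue_measure R).
Local Notation I := (`[(-1 : R)%R, (1 : R)%R]%classic).
Local Notation w := (jacobi_weight a b).
Local Notation Rk := (jpolyR a b).
Local Notation X := (Lw a b p).
Local Notation nr := (wnormr a b p).
Local Notation a1 := (jacobi_a_gtN1 hab hb).
Local Notation b1 := (jacobi_b_gtN1 hb).
Local Notation T := (jacobi_translation a b p).
Local Notation D := (frac_diff a b p).
Local Notation "f '^^' k" := (wpair a b f (Rk k)) (at level 30).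
Implicit Types (f g : R -> R) (r t h : R).

(** So the factor [mu_k] cancels from the series that specify the operators. *)
Lemma jacobi_mu_neq0 k : jacobi_mu a b k != 0.
Proof.
have p2 : (1 <= 2%:E :> \bar R)%E by rewrite lee_fin; lra.
rewrite /jacobi_mu.
have -> : wnorm a b 2%:E (jacobiR a b k) = wnorm a b 2%:E (horner (Rk k)).
  by apply: eq_wnorm => x _; rewrite jacobiRE.
rewrite invr_eq0 expf_eq0; apply/eqP => h; have := jpolyR_neq0 a1 b1 k.
by rewrite (wnormr_poly_eq0 a1 b1 p2 h) eqxx.
Qed.

Lemma has_jacobi_seriesP g (f : R -> R) (c : nat -> R) :
  has_jacobi_series a b g (fun k => jacobi_coef a b k f * jacobi_mu a b k * c k) <->
  forall k, g ^^ k = c k * (f ^^ k).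
Proof.
split=> h k.
  have := h k; rewrite !jacobi_coefE mulrAC => /(mulIf (jacobi_mu_neq0 k)) ->.
  exact: mulrC.
by rewrite !jacobi_coefE h; ring.
Qed.

(** The representative chosen for [T_t f] is known only through these two properties; all
further statements about it use nothing else. *)
Lemma translation_spec t f : X f ->
  X (T t f) /\ forall k, T t f ^^ k = (Rk k).[cos t] * (f ^^ k).
Proof.
move=> Xf.
have hm P : nr (horner (jmul a b (fun k => (Rk k).[cos t]) P)) <= 1 * nr (horner P).
  rewrite mul1r -(poly_tr_jmul hab hb); apply: (poly_tr_contract hab hb) => //.
  exact: cos_itv.
have [g [Xg hg _]] := multiplier_ext a1 b1 p1 ler01 hm Xf.
have [XT hT] : [set g | X g /\ has_jacobi_series a b g
    (fun k => jacobi_coef a b k f * jacobi_mu a b k * jacobiR a b k (cos t))] (T t f).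
  apply: (@xgetPex _ (fun=> 0)); exists g; split => //.
  by apply/has_jacobi_seriesP => k; rewrite hg jacobiRE.
split => // k; move/has_jacobi_seriesP: hT => ->; by rewrite jacobiRE.
Qed.

Lemma iter_translation_spec t f j : X f ->
  X (iter j (T t) f) /\ forall k, iter j (T t) f ^^ k = (Rk k).[cos t] ^+ j * (f ^^ k).
Proof.
move=> Xf; elim: j => [|j [Xj hj]].
  by split => // k; rewrite expr0 mul1r.
have [Xt ht] := translation_spec t Xj; split => // k.
by rewrite ht hj exprS mulrA.
Qed.

Lemma psum_spec r t f n : X f -> X (frac_diff_psum a b p r t f n) /\
  forall k, frac_diff_psum a b p r t f n ^^ k = bpsum (r / 2) n (Rk k).[cos t] * (f ^^ k).
Proof.
move=> Xf; elim: n => [|n [Xn hn]].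
  have E : frac_diff_psum a b p r t f 0 = (fun=> 0).
    by apply/funext => x; rewrite /frac_diff_psum big_ord0.
  rewrite E; split => [|k]; first exact: (Lw_zero a1 b1 p1).
  have h0 := wpairZl a1 b1 p1 0 (Rk k) Xf; rewrite mul0r in h0.
  rewrite /bpsum big_ord0 mul0r -[RHS]h0; apply: eq_Rintegral => x _.
  by rewrite !mul0r.
have [Xi hi] := iter_translation_spec t n Xf.
have E : frac_diff_psum a b p r t f n.+1 =
   (fun x => frac_diff_psum a b p r t f n x + bcoef (r / 2) n * iter n (T t) f x).
  by apply/funext => x; rewrite /frac_diff_psum big_ord_recr.
have Xc := Lw_scale p1 (bcoef (r / 2) n) Xi.
rewrite E; split => [|k]; first exact: (Lw_add p1).
rewrite (wpairDl a1 b1 p1) // (wpairZl a1 b1 p1) // hn hi /bpsum big_ord_recr /= mulrDl.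
by rewrite mulrA.
Qed.

(** The multiplier extension provides one limit of the partial sums; any other limit in norm has
the same coefficients, because these are continuous functionals. *)
Lemma frac_diff_spec r t f : 0 <= r -> X f ->
  X (D r t f) /\ forall k, D r t f ^^ k = bpow (r / 2) (Rk k).[cos t] * (f ^^ k).
Proof.
move=> r0 Xf; have s0 : 0 <= r / 2 by rewrite divr_ge0.
have [tau [tau0 tauc htau]] := binomial_tail hab hb p1 s0.
have Ic : I (cos t) by exact: cos_itv.
have hm P : nr (horner (jmul a b (fun k => bpow (r / 2) (Rk k).[cos t]) P)) <= tau 0%N * nr (horner P).
  have := htau 0%N (cos t) P Ic; congr (nr (horner _) <= _).
  by apply: (eq_jmul a1 b1) => k; rewrite /bpsum big_ord0 subr0.
have [g [Xg hg _]] := multiplier_ext a1 b1 p1 (tau0 0%N) hm Xf.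
have conv g' : X g' -> (forall k, g' ^^ k = bpow (r / 2) (Rk k).[cos t] * (f ^^ k)) ->
   forall n, nr (fun x => g' x - frac_diff_psum a b p r t f n x) <= tau n * nr f.
  move=> Xg' hg' n; have [Xn hn] := psum_spec r t n Xf.
  apply: (multiplier_bound a1 b1 p1 (tau0 n) (fun P => htau n (cos t) P Ic) Xf).
    exact: (Lw_sub p1).
  by move=> k; rewrite (wpairBl a1 b1 p1) // hn hg' mulrBl.
have tc : tau n * nr f @[n --> \oo] --> (0 : R).
  by rewrite -(mul0r (nr f)); apply: cvgM => //; exact: cvg_cst.
have [XD hD] : [set g | X g /\
    wnorm a b p (fun x => g x - frac_diff_psum a b p r t f N x) @[N --> \oo] --> 0%E] (D r t f).
  apply: (@xgetPex _ (fun=> 0)); exists g; split => //.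
  have cn : nr (fun x => g x - frac_diff_psum a b p r t f n x) @[n --> \oo] --> (0 : R).
    apply: (squeeze_cvgr _ (cvg_cst 0) tc); apply: nearW => n.
    by rewrite wnormr_ge0 // conv.
  have -> : (fun N => wnorm a b p (fun x => g x - frac_diff_psum a b p r t f N x)) =
     EFin \o (fun N => nr (fun x => g x - frac_diff_psum a b p r t f N x)).
    apply/funext => n /=; rewrite wnormrE //; apply: (Lw_sub p1) => //.
    by have [] := psum_spec r t n Xf.
  by apply: cvg_EFin; first exact: nearW.
split => // k.
have cD : nr (fun x => D r t f x - frac_diff_psum a b p r t f n x) @[n --> \oo] --> (0 : R).
  by apply: fine_cvg; exact: hD.
have [K K0 hK] := wpair_bounded a1 b1 p1 (Rk k).
have c1 : (D r t f ^^ k - frac_diff_psum a b p r t f n ^^ k) @[n --> \oo] --> (0 : R).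
  apply: norm_cvg0.
  have cK : K * nr (fun x => D r t f x - frac_diff_psum a b p r t f n x) @[n --> \oo] --> (0 : R).
    by rewrite -(mulr0 K); apply: cvgM => //; exact: cvg_cst.
  apply: (squeeze_cvgr _ (cvg_cst 0) cK); apply: nearW => n.
  have [Xn hn] := psum_spec r t n Xf.
  rewrite normr_ge0 /= -(wpairBl a1 b1 p1) //; apply: hK; exact: (Lw_sub p1).
have c2 : (bpow (r / 2) (Rk k).[cos t] * (f ^^ k) - frac_diff_psum a b p r t f n ^^ k)
     @[n --> \oo] --> (0 : R).
  have -> : (fun n => bpow (r / 2) (Rk k).[cos t] * (f ^^ k) - frac_diff_psum a b p r t f n ^^ k) =
            (fun n => (bpow (r / 2) (Rk k).[cos t] - bpsum (r / 2) n (Rk k).[cos t]) * (f ^^ k)).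
    by apply/funext => n; have [_ ->] := psum_spec r t n Xf; rewrite mulrBl.
  rewrite -(mul0r (f ^^ k)); apply: cvgM; last exact: cvg_cst.
  rewrite -(subrr (bpow (r / 2) (Rk k).[cos t])); apply: cvgB; first exact: cvg_cst.
  by apply: bpow_cvg => //; exact: (jpolyR_le1 hab hb p1).
set A := D r t f ^^ k in c1 *; set B := bpow _ _ * _ in c2 *.
have c3 : ((A - frac_diff_psum a b p r t f n ^^ k) - (B - frac_diff_psum a b p r t f n ^^ k))
     @[n --> \oo] --> (0 - 0 : R) by apply: cvgB.
have E : (fun n => (A - frac_diff_psum a b p r t f n ^^ k) - (B - frac_diff_psum a b p r t f n ^^ k)) =
         (fun=> A - B) by apply/funext => n; ring.
rewrite E subr0 in c3; apply/eqP; rewrite -subr_eq0; apply/eqP.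
have c4 : (fun=> A - B) n @[n --> \oo] --> A - B by exact: cvg_cst.
exact: (cvg_unique _ c4 c3).
Qed.

Lemma frac_diff_bounded r : 0 <= r -> exists2 A : R, 0 <= A &
  forall t f, X f -> nr (D r t f) <= A * nr f.
Proof.
move=> r0; have s0 : 0 <= r / 2 by rewrite divr_ge0.
have [tau [tau0 tauc htau]] := binomial_tail hab hb p1 s0.
exists (tau 0%N) => // t f Xf; have [XD hD] := frac_diff_spec t r0 Xf.
apply: (multiplier_bound a1 b1 p1 (tau0 0%N) _ Xf XD hD) => P.
have := htau 0%N (cos t) P (cos_itv t); congr (nr (horner _) <= _).
by apply: (eq_jmul a1 b1) => k; rewrite /bpsum big_ord0 subr0.
Qed.

Definition poly_frac_diff r t P : {poly R} := jmul a b (fun k => bpow (r / 2) (Rk k).[cos t]) P.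

(** The case [n = 0] says that differences annihilate constants: there [I - T] has norm at most
[e] for every [e > 0]. *)
Lemma frac_diff_bernstein k : 0 < k -> exists2 C : R, 0 <= C &
  forall t n (Q : {poly R}), 0 < t -> n%:R * t <= 1 -> (size Q <= n.+1)%N ->
  nr (horner (poly_frac_diff k t Q)) <= C * (n%:R * t) `^ k * nr (horner Q).
Proof.
move=> k0; have s0 : 0 <= k / 2 by rewrite divr_ge0 // ltW.
have [C C0 hC] := frac_power_bound hab hb p1 s0.
exists C => // t n Q t0 nt sQ.
case: n nt sQ => [|n] nt sQ.
  have TQ : poly_tr a b (cos t) Q = Q.
    by rewrite (size1_polyC sQ) (poly_trC hab hb).
  rewrite mul0r powR0 ?gt_eqF // mulr0 mul0r.
  have he e : 0 < e -> nr (horner (poly_frac_diff k t Q)) <= C * e `^ (k / 2) * nr (horner Q).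
    move=> e0; apply: (hC (cos t) e 1%N) => //; first exact: cos_itv.
    move=> Q' sQ'; rewrite (size1_polyC sQ') (poly_trC hab hb) subrr.
    rewrite -{1}(scale0r 0) (wnormr_polyZ a1 b1 p1) normr0 mul0r.
    by rewrite mulr_ge0 ?wnormr_ge0 // ltW.
  apply/ler_addgt0Pr => d d0; rewrite add0r.
  have K0 : 0 < C * nr (horner Q) + 1.
    by rewrite ltr_wpDl // mulr_ge0 // wnormr_ge0.
  have dK : 0 < d / (C * nr (horner Q) + 1) by rewrite divr_gt0.
  have := he ((d / (C * nr (horner Q) + 1)) `^ (2 / k)) (powR_gt0 _ dK).
  have -> : ((d / (C * nr (horner Q) + 1)) `^ (2 / k)) `^ (k / 2) = d / (C * nr (horner Q) + 1).
    rewrite -powRrM (_ : 2 / k * (k / 2) = 1) ?powRr1 ?(ltW dK) //.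
    by field; rewrite gt_eqF.
  move=> h.
  apply: (le_trans h); rewrite mulrAC mulrCA ler_piMr ?(ltW d0) //.
  by rewrite ler_pdivrMr // mul1r; lra.
have e0 : 0 < (n.+1%:R * t) ^+ 2 / 2 by rewrite divr_gt0 // exprn_gt0 // mulr_gt0.
apply: (le_trans (hC (cos t) _ n.+2 (cos_itv t) e0 _ Q sQ)).
  by move=> Q' sQ'; apply: (translation_bernstein hab hb p1).
rewrite ler_wpM2r ?wnormr_ge0 // ler_wpM2l //.
have z0 : 0 <= n.+1%:R * t by rewrite mulr_ge0 // ltW.
have -> : (n.+1%:R * t) `^ k = ((n.+1%:R * t) ^+ 2) `^ (k / 2).
  by rewrite -powR_mulrn // -powRrM mulrCA mulfV // mulr1.
apply: ge0_ler_powR => //; rewrite ?nnegrE ?exprn_ge0 ?divr_ge0 ?exprn_ge0 //.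
by rewrite ler_pdivrMr // ler_peMr ?exprn_ge0 //; lra.
Qed.

End OperatorsOnLw.

(** * The inverse estimate *)

Section DyadicSums.
Context {R : realType}.
Implicit Types (k : R) (e : nat -> R).

Lemma powR2_ge1 k : 0 < k -> 1 <= 2 `^ k.
Proof.
move=> k0; have h : 1 <= 2 :> R by rewrite ler1n.
by have := ler_powR h (ltW k0); rewrite powRr0.
Qed.

(** A block has [2^m] terms, each at least [(2^m)^k / 2^(m+1)] times the last value of [e]. *)
Lemma dyadic_block k e m : 0 < k ->
  (forall i j, (0 < i <= j)%N -> e j <= e i) -> (forall i, 0 <= e i) ->
  (2 ^ m.+1)%:R `^ k * e (2 ^ m.+1)%N <=
  2 * 2 `^ k * \sum_((2 ^ m).+1 <= nu < (2 ^ m.+1).+1) nu%:R `^ (k - 1) * e nu.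
Proof.
move=> k0 de e0.
have M0 : 0 < (2 ^ m)%:R :> R by rewrite ltr0n expn_gt0.
have M1 : 0 < (2 ^ m.+1)%:R :> R by rewrite ltr0n expn_gt0.
have ME : (2 ^ m.+1)%:R = 2 * (2 ^ m)%:R :> R by rewrite expnS natrM.
pose c : R := (2 ^ m)%:R `^ k / (2 ^ m.+1)%:R * e (2 ^ m.+1)%N.
have c0 : 0 <= c by rewrite mulr_ge0 // divr_ge0 ?powR_ge0 // ltW.
apply: (@le_trans _ _ (2 * 2 `^ k * \sum_((2 ^ m).+1 <= nu < (2 ^ m.+1).+1) c)).
  have sz : ((2 ^ m.+1).+1 - (2 ^ m).+1 = 2 ^ m)%N.
    by rewrite subSS expnS mul2n -addnn addnK.
  rewrite sumr_const_nat sz -[c *+ _]mulr_natr /c ME powRM ?(ltW M0) //.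
  move: (e _) (2 `^ k) ((2 ^ m)%:R `^ k) ((2 ^ m)%:R) (gt_eqF M0) => z u v y y0.
  rewrite le_eqVlt; apply/orP; left; apply/eqP; field; by rewrite y0.
apply: ler_wpM2l; first by rewrite mulr_ge0 ?powR_ge0.
apply: ler_sum_nat => nu /andP[h1 h2].
rewrite ltnS in h2; have nu0 : (0 < nu)%N by apply: leq_trans h1.
have nuR : 0 < nu%:R :> R by rewrite ltr0n.
apply: ler_pM => //.
- rewrite powRB ?(gt_eqF nuR) ?implybT // powRr1 ?(ltW nuR) //.
  apply: ler_pM; rewrite ?powR_ge0 ?invr_ge0 ?(ltW M1) //.
    by apply: ge0_ler_powR; rewrite ?nnegrE ?(ltW k0) ?ler0n // ler_nat ltnW.
  by rewrite lef_pV2 ?posrE // ler_nat.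
- by apply: de; rewrite nu0.
Qed.

Lemma dyadic_sum k e m : 0 < k ->
  (forall i j, (0 < i <= j)%N -> e j <= e i) -> (forall i, 0 <= e i) ->
  \sum_(i < m.+1) (2 ^ i)%:R `^ k * e (2 ^ i)%N <=
  2 * 2 `^ k * \sum_(1 <= nu < (2 ^ m).+1) nu%:R `^ (k - 1) * e nu.
Proof.
move=> k0 de e0; have p2 : 1 <= 2 `^ k :> R by exact: powR2_ge1.
elim: m => [|m IH].
  rewrite big_ord1 expn0 big_nat1 !powR1 !mul1r ler_peMl //; lra.
rewrite big_ord_recr /= (@big_cat_nat _ _ _ (2 ^ m).+1) //=; last first.
  by rewrite ltnS leq_exp2l.
by rewrite mulrDr; apply: lerD => //; exact: dyadic_block.
Qed.

End DyadicSums.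

Section InverseEstimate.
Context {R : realType}.
Variables a b : R.
Hypothesis hab : b <= a.
Hypothesis hb : - (1 / 2) <= b.
Variable p : \bar R.
Hypothesis p1 : (1 <= p)%E.
Local Notation Rk := (jpolyR a b).
Local Notation X := (Lw a b p).
Local Notation nr := (wnormr a b p).
Local Notation a1 := (jacobi_a_gtN1 hab hb).
Local Notation b1 := (jacobi_b_gtN1 hb).
Local Notation D := (frac_diff a b p).
Local Notation dp := (poly_frac_diff a b).
Local Notation "f '^^' k" := (wpair a b f (Rk k)) (at level 30).
Implicit Types (f g : R -> R) (r t h k : R) (P : nat -> {poly R}).

Local Notation Lw_horner := (Lw_poly a1 b1 p1).

Lemma poly_frac_diff_sub r h f (P Q : {poly R}) : 0 <= r -> X f ->
  nr (horner (dp r h (P - Q))) <=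
  nr (D r h (fun x => f x - Q.[x])) + nr (D r h (fun x => f x - P.[x])).
Proof.
move=> r0 Xf.
have XfP Q' : X (fun x => f x - Q'.[x]) by apply: (Lw_sub p1) => //; exact: Lw_horner.
have [X1 h1] := frac_diff_spec hab hb p1 h r0 (XfP Q).
have [X2 h2] := frac_diff_spec hab hb p1 h r0 (XfP P).
apply: le_trans (wnormrB p1 X1 X2).
rewrite le_eqVlt; apply/orP; left; apply/eqP.
apply: (wnormr_coef_eq a1 b1 p1 (Lw_horner _) (Lw_sub p1 X1 X2)) => j.
rewrite (wpairBl a1 b1 p1 _ X1 X2) h1 h2 !(wpairBl a1 b1 p1 _ Xf (Lw_horner _)).
rewrite (wpair_jmul a1 b1) !wpair_poly mulrBl (jmomentB a1 b1); ring.
Qed.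

(** Each step [P (j+1) - P j] has size at most [2^(j+1)], and its [h]-difference is the difference
of those of [f - P j] and [f - P (j+1)]. *)
Lemma dyadic_telescope r k (C : R) f P (eps : nat -> R) h t (c : R) m :
  0 <= r -> 0 < k -> 0 <= C ->
  (forall t n (Q : {poly R}), 0 < t -> n%:R * t <= 1 -> (size Q <= n.+1)%N ->
    nr (horner (dp k t Q)) <= C * (n%:R * t) `^ k * nr (horner Q)) ->
  X f -> (forall j, (size (P j) <= 2 ^ j)%N) ->
  (forall j, nr (D r h (fun x => f x - (P j).[x])) <= c * eps j) ->
  0 < t -> (2 ^ m)%:R * t <= 1 ->
  nr (horner (dp k t (dp r h (P m)))) <=
  c * \sum_(j < m) C * ((2 ^ j.+1)%:R * t) `^ k * (eps j + eps j.+1).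
Proof.
move=> r0 k0 C0 hC Xf sP hP t0; elim: m => [|m IH] mt.
  have := hC t 0%N (dp r h (P 0%N)) t0; rewrite mul0r powR0 ?gt_eqF // mulr0 mul0r.
  rewrite big_ord0 mulr0; apply => //.
  by apply: (leq_trans (size_jmul a1 b1 _ _)); exact: sP.
have mt' : (2 ^ m)%:R * t <= 1.
  by apply: le_trans mt; rewrite ler_wpM2r ?(ltW t0) // ler_nat leq_exp2l.
have -> : dp k t (dp r h (P m.+1)) =
   dp k t (dp r h (P m)) + dp k t (dp r h (P m.+1 - P m)).
  by rewrite /poly_frac_diff !(jmulB a1 b1) addrC subrK.
apply: (le_trans (wnormr_polyD a1 b1 p1 _ _)).
rewrite big_ord_recr /= mulrDr; apply: lerD; first exact: IH.
have sz : (size (dp r h (P m.+1 - P m)) <= (2 ^ m.+1).+1)%N.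
  apply: (leq_trans (size_jmul a1 b1 _ _)); apply: leqW.
  apply: (leq_trans (size_polyD _ _)); rewrite geq_max size_polyN sP /=.
  by apply: (leq_trans (sP m)); rewrite leq_exp2l.
apply: (le_trans (hC t _ _ t0 mt sz)).
rewrite [leRHS]mulrCA; apply: ler_wpM2l; first by rewrite mulr_ge0 ?powR_ge0.
apply: (le_trans (poly_frac_diff_sub h (P m.+1) (P m) r0 Xf)).
by rewrite mulrDr; apply: lerD.
Qed.

(** The decomposition [F = Fd + m2 m1 Q] of coefficient sequences, for abstract
representatives [F], [G], [Fd], [Gd]. *)
Lemma multiplier_split (m1 m2 : nat -> R) f F G Fd Gd (Q : {poly R}) :
  X f -> X F -> X Fd ->
  (forall j, G ^^ j = m1 j * (f ^^ j)) -> (forall j, F ^^ j = m2 j * (G ^^ j)) ->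
  (forall j, Gd ^^ j = m1 j * ((fun x => f x - Q.[x]) ^^ j)) ->
  (forall j, Fd ^^ j = m2 j * (Gd ^^ j)) ->
  nr F <= nr Fd + nr (horner (jmul a b m2 (jmul a b m1 Q))).
Proof.
move=> Xf XF XFd hG hF hGd hFd; apply: le_trans (wnormrD p1 XFd (Lw_horner _)).
rewrite le_eqVlt; apply/orP; left; apply/eqP.
apply: (wnormr_coef_eq a1 b1 p1 XF (Lw_add p1 XFd (Lw_horner _))) => j.
rewrite (wpairDl a1 b1 p1 _ XFd (Lw_horner _)) hF hG hFd hGd (wpairBl a1 b1 p1 _ Xf (Lw_horner _)).
rewrite !(wpair_jmul a1 b1); ring.
Qed.

(** The bound is uniform in the accuracies [eps j] of the approximants, so that nearly best ones
may be used. *)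
Lemma inverse_estimate r k : 0 <= r -> 0 < k -> exists2 K : R, 0 <= K &
  forall f P (eps : nat -> R) h (c : R) m n, X f -> 0 <= c ->
  (forall j, (size (P j) <= 2 ^ j)%N) -> (forall j, 0 <= eps j) ->
  (forall i j, (i <= j)%N -> eps j <= eps i) ->
  (forall j, nr (D r h (fun x => f x - (P j).[x])) <= c * eps j) ->
  (2 ^ m <= n)%N -> (n < 2 ^ m.+1)%N ->
  forall t, 0 < t -> t <= n%:R^-1 ->
  nr (D k t (D r h f)) <=
  c * (K / n%:R `^ k * \sum_(i < m.+1) (2 ^ i)%:R `^ k * eps i).
Proof.
move=> r0 k0.
have [A A0 hA] := frac_diff_bounded hab hb p1 (ltW k0).
have [C C0 hC] := frac_diff_bernstein hab hb p1 k0.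
exists (A * 2 `^ k + 2 * C * 2 `^ k) => [|f P eps h c m n Xf c0 sP e0 de hP mn nm t t0 tn].
  by rewrite addr_ge0 // !mulr_ge0 ?powR_ge0.
have n0 : (0 < n)%N by apply: leq_trans mn; rewrite expn_gt0.
have nR : 0 < n%:R :> R by rewrite ltr0n.
have nt : n%:R * t <= 1 by rewrite -ler_pdivlMl // mulr1.
have mt : (2 ^ m)%:R * t <= 1.
  by apply: le_trans nt; rewrite ler_wpM2r ?(ltW t0) // ler_nat.
have [Xh hh] := frac_diff_spec hab hb p1 h r0 Xf.
have [Xth hth] := frac_diff_spec hab hb p1 t (ltW k0) Xh.
have Xd : X (fun x => f x - (P m).[x]) by apply: (Lw_sub p1) => //; exact: Lw_horner.
have [Xdh hdh] := frac_diff_spec hab hb p1 h r0 Xd.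
have [Xdth hdth] := frac_diff_spec hab hb p1 t (ltW k0) Xdh.
apply: (le_trans (multiplier_split Xf Xth Xdth hh hth hdh hdth)).
have h1 : nr (D k t (D r h (fun x => f x - (P m).[x]))) <= c * (A * eps m).
  by rewrite mulrCA; apply: (le_trans (hA t _ Xdh)); exact: ler_wpM2l.
have h2 := dyadic_telescope r0 k0 C0 hC Xf sP hP t0 mt.
apply: (le_trans (lerD h1 h2)); rewrite -mulrDr; apply: ler_wpM2l => //.
have q0 : 0 < n%:R `^ k by exact: powR_gt0.
have p2 : 1 <= 2 `^ k :> R by exact: powR2_ge1.
rewrite mulrAC ler_pdivlMr // mulrDl [X in _ <= X]mulrDl; apply: lerD.
  rewrite -!mulrA ler_wpM2l // big_ord_recr /= mulrDr.
  apply: ler_wpDl; first by rewrite mulr_ge0 ?powR_ge0 // sumr_ge0 // => i _; rewrite mulr_ge0 ?powR_ge0.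
  rewrite mulrA mulrC ler_wpM2r // -powRM //.
  apply: ge0_ler_powR; rewrite ?nnegrE ?(ltW k0) ?mulr_ge0 //.
  by rewrite -natrM ler_nat -expnS ltnW.
rewrite big_ord_recr /= mulrDr; apply: ler_wpDr.
  by rewrite !mulr_ge0 ?powR_ge0.
rewrite mulr_suml mulr_sumr; apply: ler_sum => i _.
have g1 : ((2 ^ i.+1)%:R * t) `^ k * n%:R `^ k <= 2 `^ k * (2 ^ i)%:R `^ k.
  rewrite -!powRM //; last by rewrite mulr_ge0 // ltW.
  apply: ge0_ler_powR; rewrite ?nnegrE ?(ltW k0) ?mulr_ge0 ?(ltW t0) //.
  rewrite expnS natrM -mulrA [t * _]mulrC ler_piMr ?mulr_ge0 //.
have g2 : eps i + eps i.+1 <= 2 * eps i by have := de i i.+1 (leqnSn i); lra.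
have g0 : 0 <= eps i + eps i.+1 by rewrite addr_ge0.
have := ler_pM (mulr_ge0 (powR_ge0 _ _) (powR_ge0 _ _)) g0 g1 g2 => g3.
have := ler_wpM2l C0 g3.
move: (((2 ^ i.+1)%:R * t) `^ k) (n%:R `^ k) (2 `^ k) ((2 ^ i)%:R `^ k) => u v y z; lra.
Qed.

End InverseEstimate.

Section HolderNorm.
Context {R : realType}.
Variables a b : R.
Hypothesis hab : b <= a.
Hypothesis hb : - (1 / 2) <= b.
Variable p : \bar R.
Hypothesis p1 : (1 <= p)%E.
Variables r alpha : R.
Hypothesis r0 : 0 <= r.
Local Notation X := (Lw a b p).
Local Notation N := (wnorm a b p).
Local Notation nr := (wnormr a b p).
Local Notation D := (frac_diff a b p).
Local Notation a1 := (jacobi_a_gtN1 hab hb).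
Local Notation b1 := (jacobi_b_gtN1 hb).
Implicit Types (f g : R -> R) (h c : R) (nu : nat).

Lemma modulus_ge0 s g h : 0 < h -> (0 <= modulus a b p s g h)%E.
Proof.
move=> h0; have pi0 := pi_gt0 R; rewrite /modulus; case: ltP => hpi.
  apply: le_ereal_sup_tmp; exists (N (D s h g)); last exact: wnorm_ge0.
  by exists h => //=; rewrite h0 lexx.
apply: le_ereal_sup_tmp; exists (N (D s (pi / 2) g)); last exact: wnorm_ge0.
by exists (pi / 2) => //=; apply/andP; split; lra.
Qed.

Lemma holder_norm_ge0 g : (0 <= holder_norm a b p r alpha g)%E.
Proof.
apply: adde_ge0; first exact: wnorm_ge0.
apply: le_ereal_sup_tmp; exists ((1 `^ (- alpha))%:E * modulus a b p r g 1)%E.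
  by exists 1 => //=.
by rewrite mule_ge0 ?lee_fin ?powR_ge0 // modulus_ge0.
Qed.

(** The step [t = h] in the modulus at [h]. *)
Lemma frac_diff_le_holder g h c : X g -> (holder_norm a b p r alpha g <= c%:E)%E ->
  0 < h -> h < pi -> nr (D r h g) <= h `^ alpha * c.
Proof.
move=> Xg hc h0 hpi; have [XD _] := frac_diff_spec hab hb p1 h r0 Xg.
have q0 : 0 < h `^ alpha by exact: powR_gt0.
rewrite -ler_pdivrMl // -powRN -lee_fin; apply: le_trans hc.
rewrite /holder_norm EFinM -wnormrE //.
apply: (@le_trans _ _ ((h `^ (- alpha))%:E * modulus a b p r g h)%E).
  apply: lee_wpmul2l; first by rewrite lee_fin powR_ge0.
  by rewrite /modulus hpi; apply: ereal_sup_ubound; exists h => //=; rewrite h0 lexx.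
apply: (@le_trans _ _ (ereal_sup [set (h `^ (- alpha))%:E * modulus a b p r g h | h in [set h : R | (0 < h)%R]]%E)).
  by apply: ereal_sup_ubound; exists h.
by rewrite leeDr // wnorm_ge0.
Qed.

Lemma best_approx_ge0 nu f : (0 <= best_approx a b p r alpha nu f)%E.
Proof. by apply: le_ereal_inf_tmp => _ [P _ <-]; exact: holder_norm_ge0. Qed.

Lemma best_approx_anti i j f : (0 < i)%N -> (i <= j)%N ->
  (best_approx a b p r alpha j f <= best_approx a b p r alpha i f)%E.
Proof.
move=> i0 ij; apply: ereal_inf_le_tmp => _ [P sP <-]; exists P => //.
by rewrite /polys_deg_le /= in sP *; apply: (leq_trans sP); rewrite !prednK // (leq_trans i0).
Qed.

Lemma best_approx_le nu f :
  (best_approx a b p r alpha nu f <= holder_norm a b p r alpha f)%E.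
Proof.
apply: ereal_inf_lbound; exists 0; first by rewrite /polys_deg_le /= size_poly0.
by congr holder_norm; apply/funext => x; rewrite horner0 subr0.
Qed.

End HolderNorm.

Theorem theorem3p7 (R : realType) (a b : R) (hab : b <= a) (hb : - (1 / 2) <= b)
    (p : \bar R) (hp : (1%:E <= p)%E) (r alpha k : R)
    (halpha : 0 < alpha) (halphar : alpha <= r) (hk : 0 < k) :
  exists C : R, forall (f : R -> R) (n : nat),
    holder_space a b p r alpha f -> (0 < n)%N ->
    (psi_modulus a b p k r alpha f n%:R^-1 <=
      (C / n%:R `^ k)%:E *
        \sum_(1 <= nu < n.+1)
          (nu%:R `^ (k - 1))%:E * best_approx a b p r alpha nu f)%E.
Proof.
have r0 : 0 <= r by apply: le_trans halphar; exact: ltW.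
have [K K0 hK] := inverse_estimate hab hb hp r0 hk.
exists (K * (2 * 2 `^ k)) => f n [Xf Hf] n0.
have nR : 0 < n%:R :> R by rewrite ltr0n.
have n1 : n%:R^-1 <= 1 :> R by rewrite invf_le1 // ler1n.
have pi2 := pi_ge2 R.
pose e nu : R := fine (best_approx a b p r alpha nu f).
have eE nu : best_approx a b p r alpha nu f = (e nu)%:E.
  rewrite fineK // ge0_fin_numE; last exact: best_approx_ge0.
  exact: le_lt_trans (best_approx_le _ _ _ _ _ _ _) Hf.
have e0 nu : 0 <= e nu by rewrite -lee_fin -eE; exact: best_approx_ge0.
have de i j : (0 < i <= j)%N -> e j <= e i.
  by move=> /andP[i0 ij]; rewrite -lee_fin -!eE; exact: best_approx_anti.
have -> : (\sum_(1 <= nu < n.+1) (nu%:R `^ (k - 1))%:E * best_approx a b p r alpha nu f)%E =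
          (\sum_(1 <= nu < n.+1) nu%:R `^ (k - 1) * e nu)%:E.
  by rewrite -sumEFin; apply: eq_bigr => nu _; rewrite eE EFinM.
set S := \sum_(1 <= nu < n.+1) _.
have near_best eta j : 0 < eta -> exists P : {poly R}, (size P <= 2 ^ j)%N /\
    (holder_norm a b p r alpha (fun x => f x - P.[x])%R <= (e (2 ^ j)%N + eta)%R%:E)%E.
  move=> eta0.
  have : (best_approx a b p r alpha (2 ^ j) f < (e (2 ^ j)%N + eta)%R%:E)%E.
    by rewrite eE lte_fin ltrDl.
  move=> /ereal_inf_lt[_ [P sP <-] /ltW hP]; exists P; split => //.
  by move: sP; rewrite /polys_deg_le /= prednK // expn_gt0.
pose m := trunc_log 2 n.
have /andP[mn nm] : (2 ^ m <= n < 2 ^ m.+1)%N by exact: trunc_log_bounds.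
have main h t : 0 < h -> h <= n%:R^-1 -> 0 < t -> t <= n%:R^-1 ->
    wnormr a b p (frac_diff a b p k t (frac_diff a b p r h f)) <=
    h `^ alpha * (K * (2 * 2 `^ k) / n%:R `^ k * S).
  move=> h0 hn t0 tn.
  pose Z := \sum_(i < m.+1) (2 ^ i)%:R `^ k : R.
  have Z0 : 0 <= Z by apply: sumr_ge0 => i _; exact: powR_ge0.
  have Kn : 0 <= K / n%:R `^ k by rewrite divr_ge0 ?powR_ge0.
  have qh : 0 <= h `^ alpha by exact: powR_ge0.
  have step : wnormr a b p (frac_diff a b p k t (frac_diff a b p r h f)) <=
     h `^ alpha * (K / n%:R `^ k * \sum_(i < m.+1) (2 ^ i)%:R `^ k * e (2 ^ i)%N).
    apply: (@le_of_le_add_pow2 _ _ _ (h `^ alpha * (K / n%:R `^ k * Z))) => [|N].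
      by rewrite mulr_ge0 // mulr_ge0.
    have eta0 : 0 < (2 ^ N)%:R^-1 :> R by exact: inv2_gt0.
    move: ((2 ^ N)%:R^-1) eta0 => eta eta0.
    have /choice[P hP] j := near_best _ j eta0.
    have := hK f P (fun j => e (2 ^ j)%N + eta) h (h `^ alpha) m n Xf qh.
    move=> H; apply: (le_trans (H _ _ _ _ mn nm t t0 tn)).
    - by move=> j; have [] := hP j.
    - by move=> j; rewrite addr_ge0 // ltW.
    - by move=> i j ij; rewrite lerD2r; apply: de; rewrite expn_gt0 /= leq_exp2l.
    - move=> j; have [_ hj] := hP j; apply: (frac_diff_le_holder hab hb hp r0 _ hj h0).
        exact: (Lw_sub hp Xf (Lw_poly (jacobi_a_gtN1 hab hb) (jacobi_b_gtN1 hb) hp _)).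
      by lra.
    have -> : \sum_(i < m.+1) (2 ^ i)%:R `^ k * (e (2 ^ i)%N + eta) =
              \sum_(i < m.+1) (2 ^ i)%:R `^ k * e (2 ^ i)%N + Z * eta.
      by rewrite /Z mulr_suml -big_split /=; apply: eq_bigr => i _; rewrite mulrDr.
    rewrite le_eqVlt; apply/orP; left; apply/eqP; ring.
  apply: (le_trans step); apply: ler_wpM2l => //.
  apply: (le_trans (ler_wpM2l Kn (dyadic_sum m hk de e0))).
  rewrite [leLHS]mulrA (mulrAC K).
  apply: ler_wpM2l; first by rewrite divr_ge0 ?powR_ge0 // !mulr_ge0 ?powR_ge0.
  rewrite /S [leRHS](@big_cat_nat _ _ _ (2 ^ m).+1) //= lerDl.
  by apply: sumr_ge0 => i _; rewrite mulr_ge0 ?powR_ge0.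
rewrite -EFinM /psi_modulus; apply: ge_ereal_sup => _ [h /andP[h0 hn] <-].
have h1 : n%:R^-1 < pi :> R by lra.
have c0 : 0 <= K * (2 * 2 `^ k) / n%:R `^ k * S.
  rewrite mulr_ge0 ?divr_ge0 ?mulr_ge0 ?powR_ge0 //.
  by apply: sumr_ge0 => i _; rewrite mulr_ge0 ?powR_ge0.
apply: (@le_trans _ _ ((h `^ (- alpha))%:E * (h `^ alpha * (K * (2 * 2 `^ k) / n%:R `^ k * S))%:E)%E).
  apply: lee_wpmul2l; first by rewrite lee_fin powR_ge0.
  rewrite /modulus h1; apply: ge_ereal_sup => _ [t /andP[t0 tn] <-].
  have [Xh _] := frac_diff_spec hab hb hp h r0 Xf.
  have [Xth _] := frac_diff_spec hab hb hp t (ltW hk) Xh.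
  by rewrite wnormrE // lee_fin; exact: main.
have hh : h `^ (- alpha) * h `^ alpha = 1.
  by rewrite powRN mulVf // gt_eqF // powR_gt0.
by rewrite -EFinM lee_fin (mulrA (h `^ (- alpha))) hh mul1r.
Qed.
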